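(* Let $L\subset(1,\infty)$ and $M,N\subset[1,\infty)$ be finite sets, not all empty, and define \[ k=\begin{cases} |L|+|L\cup M|-1 & \text{if } N=\emptyset,\\ |L|+|L\cup M|+|N| & \text{otherwise.}\end{cases}\] Then the Banach space \[ X=\Bigl(\bigoplus_{p\in L}B_p\Bigr)\oplus\Bigl(\bigoplus_{q\in M}\ell_q\Bigr)\oplus\Bigl(\bigoplus_{r\in N}S_r\Bigr)\] satisfies: (i) every composition of $k+1$ strictly singular operators on $X$ is compact; (ii) there are $k$ strictly singular operators on $X$ whose composition is not compact. Hence the quotient algebra $\mathscr{S}(X)/\mathscr{K}(X)$ of strictly singular by compact operators on $X$ is nilpotent of index $k+1$.
   Context: All vector spaces are over a fixed scalar field $\mathbb{K}\in\{\mathbb{R},\mathbb{C}\}$, and $\mathbb{N}=\{1,2,3,\ldots\}$. For $x\in\mathbb{K}^{\mathbb{N}}$, $x(n)$ denotes its $n$th coordinate; $c_{00}$ is the space of finitely supported elements of $\mathbb{K}^{\mathbb{N}}$. A Schreier set is a finite set $F\subset\mathbb{N}$ with $F=\emptyset$ or $|F|\le\min F$; $\mathcal{S}_1$ is the family of all Schreier sets. For $1\le p<\infty$ and $x\in\mathbb{K}^{\mathbb{N}}$, put $\|x\|_{S_p}=\sup_{F\in\mathcal{S}_1}\bigl(\sum_{n\in F}|x(n)|^p\bigr)^{1/p}\in[0,\infty]$. The set $Z_p=\{x\in\mathbb{K}^{\mathbb{N}}:\|x\|_{S_p}<\infty\}$ is a Banach space in this norm, and the $p$-convexified Schreier space $S_p$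 is the closure of $c_{00}$ in $Z_p$. A Schreier chain is a non-empty finite collection $\mathcal{C}=\{F_1,\ldots,F_m\}$ of non-empty Schreier sets with $\max F_j<\min F_{j+1}$ for $1\le j<m$. For $1<p<\infty$ and $x\in\mathbb{K}^{\mathbb{N}}$, put $\|x\|_{B_p}=\sup_{\mathcal{C}}\bigl(\sum_{F\in\mathcal{C}}(\sum_{n\in F}|x(n)|)^p\bigr)^{1/p}\in[0,\infty]$, the supremum being over all Schreier chains $\mathcal{C}$. The $p$th Baernstein space is the Banach space $B_p=\{x\in\mathbb{K}^{\mathbb{N}}:\|x\|_{B_p}<\infty\}$ with this norm. $\ell_p=\ell_p(\mathbb{N})$. Finite direct sums carry, say, the maximum norm (any equivalent norm gives the same conclusions). An operator is a bounded linear map between Banach spaces; it is strictly singular if no restriction of it to an infinite-dimensional subspace of its domain is an isomorphic embedding. $\mathscr{S}(X)$ and $\mathscr{K}(X)$ denote the sets (ideals) of strictly singular, respectively compact, operators from $X$ to $X$. A ring $\mathscr{A}$ is nilpotent if, for some $k\in\mathbb{N}$, $a_1a_2\cdots a_k=0$ for all $a_1,\ldots,a_k\in\mathscr{A}$; the smallest such $k$ is its index of nilpotency. If $k=0$, the empty composition of operators on $X$ is understood as the identity operator. *)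

(* Defs.v *)
From HB Require Import structures.
From mathcomp Require Import all_boot all_order all_algebra.
From mathcomp Require Import generic_quotient ring_quotient.
From mathcomp Require Import finmap complex.
From mathcomp Require Import all_classical all_reals all_analysis.
Set Implicit Arguments.
Unset Strict Implicit.
Unset Printing Implicit Defensive.
Import Order.TTheory GRing.Theory Num.Theory numFieldNormedType.Exports.
Local Open Scope classical_set_scope.
Local Open Scope ring_scope.

Inductive scalar_kind := RealScalars | ComplexScalars.

Definition scalars (R : realType) (s : scalar_kind) : numFieldType :=
  match s with RealScalars => R | ComplexScalars => R[i]%C end.

(* A normed module over K has a K-valued norm; the next two maps move
   non-negative elements of K to R and back. *)
Definition of_real (R : realType) (s : scalar_kind) : R -> scalars R s :=
  match s with RealScalars => id | ComplexScalars => fun r => r%:C%C end.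

Definition re_part (R : realType) (s : scalar_kind) : scalars R s -> R :=
  match s with RealScalars => id | ComplexScalars => @complex.Re R end.

Definition rnorm (R : realType) (s : scalar_kind)
    (V : normedModType (scalars R s)) (v : V) : R := re_part `|v|.

Definition modulus (R : realType) (s : scalar_kind) (a : scalars R s) : R :=
  re_part `|a|.

Section ScalarTheory.
Variables (R : realType) (s : scalar_kind).
Local Notation K := (scalars R s).
Implicit Types (a b : K) (x y : R).

Lemma of_realK : cancel (@of_real R s) (@re_part R s).
Proof. by case: s. Qed.

Lemma re_partK a : 0 <= a -> of_real s (re_part a) = a.
Proof.
case: s a => [//|[u v]] /=.
by rewrite lecE /= => /andP[/eqP-> _].
Qed.

Lemma ler_of_real x y : (of_real s x <= of_real s y) = (x <= y).
Proof. by case: s => //=; rewrite lecR. Qed.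

Lemma of_realD x y : of_real s (x + y) = of_real s x + of_real s y.
Proof. by case: s => //=; rewrite rmorphD. Qed.

Lemma of_realM x y : of_real s (x * y) = of_real s x * of_real s y.
Proof. by case: s => //=; rewrite rmorphM. Qed.

Lemma of_real0 : of_real s (0 : R) = 0.
Proof. by case: s. Qed.

Lemma of_real_modulus a : of_real s (modulus a) = `|a|.
Proof. exact: re_partK. Qed.

Lemma modulus_ge0 a : 0 <= modulus a.
Proof. by rewrite -ler_of_real of_real_modulus of_real0. Qed.

Lemma modulus0 : modulus (0 : K) = 0.
Proof. by rewrite /modulus normr0 -of_real0 of_realK. Qed.

Lemma modulusM a b : modulus (a * b) = modulus a * modulus b.
Proof.
by apply: (can_inj of_realK); rewrite of_realM !of_real_modulus normrM.
Qed.

Lemma modulusD a b : modulus (a + b) <= modulus a + modulus b.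
Proof. by rewrite -ler_of_real of_realD !of_real_modulus ler_normD. Qed.

Lemma modulus_eq0 a : modulus a = 0 -> a = 0.
Proof.
by move=> a0; apply/normr0_eq0; rewrite -of_real_modulus a0 of_real0.
Qed.

Variable V : normedModType K.
Implicit Types u v : V.

Lemma of_real_rnorm v : of_real s (rnorm v) = `|v|.
Proof. exact: re_partK. Qed.

Lemma rnorm_ge0 v : 0 <= rnorm v.
Proof. by rewrite -ler_of_real of_real_rnorm of_real0. Qed.

Lemma rnormD u v : rnorm (u + v) <= rnorm u + rnorm v.
Proof. by rewrite -ler_of_real of_realD !of_real_rnorm ler_normD. Qed.

Lemma rnormZ a v : rnorm (a *: v) = modulus a * rnorm v.
Proof.
apply: (can_inj of_realK); rewrite of_realM of_real_modulus !of_real_rnorm.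
exact: normrZ.
Qed.

Lemma rnorm_eq0 v : rnorm v = 0 -> v = 0.
Proof.
by move=> v0; apply/normr0_eq0; rewrite -of_real_rnorm v0 of_real0.
Qed.

End ScalarTheory.

Record ext_norm (R : realType) (s : scalar_kind)
    (V : lmodType (scalars R s)) := ExtNorm {
  ext_norm_fun :> V -> \bar R;
  ext_norm_ge0 : forall x, (0 <= ext_norm_fun x)%E;
  ext_normD : forall x y,
    (ext_norm_fun (x + y)%R <= ext_norm_fun x + ext_norm_fun y)%E;
  ext_normZ : forall a x,
    (ext_norm_fun (a *: x)%R <= (modulus a)%:E * ext_norm_fun x)%E;
  ext_norm_eq0 : forall x, ext_norm_fun x = 0%E -> x = 0%R }.

Section FiniteNormSpace.
Variables (R : realType) (s : scalar_kind) (V : lmodType (scalars R s)).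
Variable nu : ext_norm V.
Local Notation K := (scalars R s).

Definition has_finite_norm : {pred V} := [pred x | (nu x < +oo)%E].

Lemma has_finite_norm_submod : submod_closed has_finite_norm.
Proof.
have Z a x : (nu x < +oo)%E -> (nu (a *: x) < +oo)%E.
  move=> xoo; apply: le_lt_trans (ext_normZ nu a x) _.
  have x_fin : nu x \is a fin_num by rewrite ge0_fin_numE// ext_norm_ge0.
  by rewrite -(fineK x_fin) -EFinM ltry.
split=> [|a x y]; rewrite !inE.
  apply: le_lt_trans (ltry 0%R); rewrite -(scale0r 0).
  by apply: le_trans (ext_normZ nu _ _) _; rewrite modulus0 mul0e.
move=> xoo yoo; apply: le_lt_trans (ext_normD nu _ _) _.
by rewrite lte_add_pinfty// Z.
Qed.
HB.instance Definition _ :=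
  GRing.isSubmodClosed.Build K V has_finite_norm has_finite_norm_submod.

Record finite_norm_space := FiniteNormSpace {
  finite_norm_val :> V;
  _ : finite_norm_val \in has_finite_norm }.

HB.instance Definition _ := [isSub for finite_norm_val].
HB.instance Definition _ := gen_eqMixin finite_norm_space.
HB.instance Definition _ := gen_choiceMixin finite_norm_space.
HB.instance Definition _ := [SubChoice_isSubLmodule of finite_norm_space by <:].

Lemma finite_norm_fin (x : finite_norm_space) : nu x \is a fin_num.
Proof. by rewrite ge0_fin_numE ?ext_norm_ge0//; case: x. Qed.

Definition finite_norm (x : finite_norm_space) : K := of_real s (fine (nu x)).

Lemma finite_normD x y : finite_norm (x + y) <= finite_norm x + finite_norm y.
Proof.
rewrite -of_realD ler_of_real -fineD ?finite_norm_fin// fine_le ?fin_numD//.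
- by rewrite finite_norm_fin.
- by rewrite !finite_norm_fin.
- exact: ext_normD.
Qed.

Lemma finite_normZ a x : finite_norm (a *: x) = `|a| * finite_norm x.
Proof.
have le_normZ b (z : finite_norm_space) :
    fine (nu (b *: z : finite_norm_space)) <= modulus b * fine (nu z).
  by rewrite -lee_fin EFinM !fineK ?finite_norm_fin//; exact: ext_normZ.
rewrite -of_real_modulus -of_realM; congr of_real.
apply/eqP; rewrite eq_le le_normZ /=.
have [->|a0] := eqVneq a 0.
  by rewrite modulus0 mul0r fine_ge0// ext_norm_ge0.
have {1}-> : x = a^-1 *: (a *: x) :> finite_norm_space by rewrite scalerA mulVf// scale1r.
apply: le_trans (ler_wpM2l (modulus_ge0 _) (le_normZ _ _)) _.
rewrite mulrA -modulusM divff// /modulus normr1.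
by rewrite (_ : 1 = of_real s 1) ?of_realK ?mul1r//; case: (s).
Qed.

Lemma finite_norm_eq0 x : finite_norm x = 0 -> x = 0.
Proof.
rewrite -(of_real0 R s) => /(can_inj (@of_realK R s)) x0.
apply: val_inj; apply: (@ext_norm_eq0 _ _ _ nu).
by rewrite -(fineK (finite_norm_fin x)) x0.
Qed.

HB.instance Definition _ := @Lmodule_isNormed.Build K finite_norm_space
  finite_norm finite_normD finite_normZ finite_norm_eq0.

End FiniteNormSpace.

Section Subspace.
Variables (K : numFieldType) (V : normedModType K) (D : submodClosed V).

Record subspace := Subspace { subspace_val :> V; _ : subspace_val \in D }.

HB.instance Definition _ := [isSub for subspace_val].
HB.instance Definition _ := gen_eqMixin subspace.
HB.instance Definition _ := gen_choiceMixin subspace.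
HB.instance Definition _ := [SubChoice_isSubLmodule of subspace by <:].

Definition subspace_norm (x : subspace) : K := `|x : V|.

Lemma subspace_normD x y :
  subspace_norm (x + y) <= subspace_norm x + subspace_norm y.
Proof. exact: ler_normD. Qed.

Lemma subspace_normZ a x : subspace_norm (a *: x) = `|a| * subspace_norm x.
Proof. exact: normrZ. Qed.

Lemma subspace_norm_eq0 x : subspace_norm x = 0 -> x = 0.
Proof. by move=> /normr0_eq0 x0; exact: val_inj. Qed.

HB.instance Definition _ := @Lmodule_isNormed.Build K subspace
  subspace_norm subspace_normD subspace_normZ subspace_norm_eq0.

End Subspace.

Section DirectSum.
Variables (R : realType) (s : scalar_kind) (I : finType).
Variable E : I -> normedModType (scalars R s).
Local Notation K := (scalars R s).

Record direct_sum := DirectSum { component :> forall i, E i }.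

Implicit Types x y : direct_sum.

Lemma direct_sumP x y : (forall i, x i = y i) -> x = y.
Proof.
by case: x y => [x] [y] /= xy; congr DirectSum; apply: functional_extensionality_dep.
Qed.

HB.instance Definition _ := gen_eqMixin direct_sum.
HB.instance Definition _ := gen_choiceMixin direct_sum.

Definition direct_sum0 := DirectSum (fun i => 0 : E i).
Definition direct_sumN x := DirectSum (fun i => - x i).
Definition direct_sumD x y := DirectSum (fun i => x i + y i).
Definition direct_sumZ (a : K) x := DirectSum (fun i => a *: x i).

Lemma direct_sumDA : associative direct_sumD.
Proof. by move=> x y z; apply: direct_sumP => i /=; rewrite addrA. Qed.
Lemma direct_sumDC : commutative direct_sumD.
Proof. by move=> x y; apply: direct_sumP => i /=; rewrite addrC. Qed.
Lemma direct_sum0D : left_id direct_sum0 direct_sumD.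
Proof. by move=> x; apply: direct_sumP => i /=; rewrite add0r. Qed.
Lemma direct_sumND : left_inverse direct_sum0 direct_sumN direct_sumD.
Proof. by move=> x; apply: direct_sumP => i /=; rewrite addNr. Qed.

HB.instance Definition _ := GRing.isZmodule.Build direct_sum
  direct_sumDA direct_sumDC direct_sum0D direct_sumND.

Lemma direct_sumZA a b x :
  direct_sumZ a (direct_sumZ b x) = direct_sumZ (a * b) x.
Proof. by apply: direct_sumP => i /=; rewrite scalerA. Qed.
Lemma direct_sum1Z : left_id 1 direct_sumZ.
Proof. by move=> x; apply: direct_sumP => i /=; rewrite scale1r. Qed.
Lemma direct_sumZDr : right_distributive direct_sumZ +%R.
Proof. by move=> a x y; apply: direct_sumP => i /=; rewrite scalerDr. Qed.
Lemma direct_sumZDl x : {morph direct_sumZ^~ x : a b / a + b}.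
Proof. by move=> a b; apply: direct_sumP => i /=; rewrite scalerDl. Qed.

HB.instance Definition _ := GRing.Zmodule_isLmodule.Build K direct_sum
  direct_sumZA direct_sum1Z direct_sumZDr direct_sumZDl.

Definition max_norm x : R := \big[Num.max/0]_i rnorm (x i).

Lemma rnorm_le_max x i : rnorm (x i) <= max_norm x.
Proof. exact: (le_bigmax _ (fun i => rnorm (x i))). Qed.

Lemma max_norm_ge0 x : 0 <= max_norm x.
Proof. exact: bigmax_ge_id. Qed.

Definition direct_sum_norm x : K := of_real s (max_norm x).

Lemma direct_sum_normD x y :
  direct_sum_norm (x + y) <= direct_sum_norm x + direct_sum_norm y.
Proof.
rewrite -of_realD ler_of_real; apply: bigmax_le => [|i _].
  by rewrite addr_ge0 ?max_norm_ge0.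
by apply: le_trans (rnormD _ _) _; rewrite lerD ?rnorm_le_max.
Qed.

Lemma direct_sum_normZ a x : direct_sum_norm (a *: x) = `|a| * direct_sum_norm x.
Proof.
rewrite -of_real_modulus -of_realM; congr of_real.
rewrite /max_norm (eq_bigr (fun i => modulus a * rnorm (x i))); last first.
  by move=> i _; rewrite rnormZ.
elim/big_rec2: _ => [|i y1 y2 _ ->]; first by rewrite mulr0.
by rewrite maxr_pMr// modulus_ge0.
Qed.

Lemma direct_sum_norm_eq0 x : direct_sum_norm x = 0 -> x = 0.
Proof.
rewrite -(of_real0 R s) => /(can_inj (@of_realK R s)) x0.
apply: direct_sumP => i; apply: rnorm_eq0; apply/eqP.
by rewrite eq_le rnorm_ge0 -x0 rnorm_le_max.
Qed.

HB.instance Definition _ := @Lmodule_isNormed.Build K direct_sum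
  direct_sum_norm direct_sum_normD direct_sum_normZ direct_sum_norm_eq0.

End DirectSum.

Section OperatorProperties.
Variables (K : numFieldType) (X Y : normedModType K).
Implicit Types (f : X -> Y) (W : set X).

Definition bounded_map f := exists M, forall x, `|f x| <= M * `|x|.

Definition finite_dimensional W :=
  exists (n : nat) (v : 'I_n -> X), (forall i, W (v i)) /\
    forall x, W x -> exists a : 'I_n -> K, x = \sum_i a i *: v i.

Definition embedding_on W f := exists c C : K, 0 < c /\
  forall x, W x -> c * `|x| <= `|f x| /\ `|f x| <= C * `|x|.

Definition strictly_singular f := forall W,
  submod_closed (mem W) -> ~ finite_dimensional W -> ~ embedding_on W f.

Definition compact_map f := precompact (f @` [set x | `|x| <= 1]).

End OperatorProperties.

Section OperatorRing.
Variables (K : numFieldType) (X : normedModType K).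

Definition is_operator : {pred X -> X} :=
  [pred f | `[< linear f /\ bounded_map f >] ].

Lemma is_operator_submod : submod_closed is_operator.
Proof.
split=> [|a f g]; rewrite !inE.
  split=> [a x y|]; first by rewrite /= scaler0 addr0.
  by exists 0 => x; rewrite /= normr0 mul0r.
move=> [lf [M fM]] [lg [N gN]]; split=> [b x y|].
  have E z : (a *: f + g) z = a *: f z + g z by [].
  by rewrite !E lf lg !scalerDr !scalerA (mulrC a) addrACA.
exists (`|a| * M + N) => x; rewrite mulrDl.
apply: le_trans (ler_normD _ _) _; rewrite lerD//.
by rewrite normrZ -mulrA ler_wpM2l.
Qed.
HB.instance Definition _ :=
  GRing.isSubmodClosed.Build K (X -> X) is_operator is_operator_submod.

Record operator := Operator {
  operator_fun :> X -> X; _ : operator_fun \in is_operator }.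

HB.instance Definition _ := [isSub for operator_fun].
HB.instance Definition _ := gen_eqMixin operator.
HB.instance Definition _ := gen_choiceMixin operator.
HB.instance Definition _ := [SubChoice_isSubLmodule of operator by <:].

Implicit Types S T : operator.

Lemma operator_linear T : linear T.
Proof. by case: T => f /=; rewrite inE => -[]. Qed.
HB.instance Definition _ T := GRing.isLinear.Build K X X *:%R T (operator_linear T).

Lemma operator_bounded T : bounded_map T.
Proof. by case: T => f /=; rewrite inE => -[]. Qed.

Lemma operatorP S T : (S : X -> X) =1 T -> S = T.
Proof. by move=> ST; apply: val_inj; apply/funext. Qed.

Lemma operator_id_subproof : (idfun : X -> X) \in is_operator.
Proof. by rewrite inE; split=> //; exists 1 => x; rewrite mul1r. Qed.

Lemma operator_comp_subproof S T : S \o T \in is_operator.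
Proof.
rewrite inE; split=> [a x y|]; first by rewrite /= !linearP.
have [M SM] := operator_bounded S; have [N TN] := operator_bounded T.
exists (`|M| * N) => x /=; apply: le_trans (SM _) _.
rewrite -mulrA (le_trans _ (ler_wpM2l _ (TN x)))//.
have [->|Tx0] := eqVneq (T x) 0; first by rewrite normr0 !mulr0.
rewrite ler_wpM2r// real_ler_norm// ger0_real//.
have Tx_gt0 : 0 < `|T x| by rewrite normr_gt0.
by rewrite -(pmulr_lge0 _ Tx_gt0) (le_trans _ (SM _)).
Qed.

Definition operator_id := Operator operator_id_subproof.
Definition operator_comp S T := Operator (operator_comp_subproof S T).

Lemma operator_compA : associative operator_comp.
Proof. by move=> S T U; exact: operatorP. Qed.
Lemma operator_comp1l : left_id operator_id operator_comp.
Proof. by move=> S; exact: operatorP. Qed.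
Lemma operator_comp1r : right_id operator_id operator_comp.
Proof. by move=> S; exact: operatorP. Qed.
Lemma operator_compDl : left_distributive operator_comp +%R.
Proof. by move=> S T U; exact: operatorP. Qed.
Lemma operator_compDr : right_distributive operator_comp +%R.
Proof. by move=> S T U; apply: operatorP => x; exact: (linearD S). Qed.

HB.instance Definition _ := GRing.Zmodule_isPzRing.Build operator
  operator_compA operator_comp1l operator_comp1r operator_compDl operator_compDr.

End OperatorRing.

Section CalkinAlgebra.
Variables (K : numFieldType) (X : normedModType K).
Local Notation B := (operator X).
Implicit Types S T : B.

Definition is_compact : {pred B} := [pred T : B | `[< compact_map T >] ].

Lemma operator_continuous T : continuous T.
Proof.
apply: bounded_linear_continuous; apply/linear_boundedP.
have [M TM] := operator_bounded T.
exists `|M|; split=> [|r /= Mr x]; first exact: normr_real.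
have [->|x0] := eqVneq x 0; first by rewrite linear0 !normr0 mulr0.
apply: le_trans (TM x) _; rewrite ler_wpM2r//.
have x_gt0 : 0 < `|x| by rewrite normr_gt0.
apply: le_trans (ltW Mr); rewrite real_ler_norm// ger0_real//.
by rewrite -(pmulr_lge0 _ x_gt0) (le_trans _ (TM x)).
Qed.

Lemma precompact_image (f : X -> X) (A : set X) :
  continuous f -> precompact A -> precompact (f @` A).
Proof.
move=> fc; rewrite precompactE => cA.
have cfA : compact (f @` closure A).
  by apply: continuous_compact => //; exact: continuous_subspaceT.
apply: precompact_subset (image_subset _ (@subset_closure _ A)) _.
exact/compact_precompact.
Qed.

Lemma compact_mapB S T : compact_map S -> compact_map T -> compact_map (S - T).
Proof.
rewrite /compact_map !precompactE => cS cT.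
pose sub (z : X * X) := z.1 - z.2.
set A := S @` _ in cS; set A' := T @` _ in cT.
have cAA' : compact (sub @` (closure A `*` closure A')).
  apply: continuous_compact; last exact: compact_setX.
  apply: continuous_subspaceT => z.
  by apply: cvgB; [exact: cvg_fst|exact: cvg_snd].
have pAA' := compact_precompact (@norm_hausdorff _ X) cAA'.
rewrite -precompactE; apply: (precompact_subset _ pAA').
move=> _ [x x1 <-]; exists (S x, T x) => //.
by split; apply: subset_closure; exists x.
Qed.

Lemma compact_mapMl S T : compact_map T -> compact_map (S * T).
Proof.
move=> /(precompact_image (operator_continuous (T := S))).
by rewrite image_comp.
Qed.

Lemma compact_mapMr S T : compact_map S -> compact_map (S * T).
Proof.
move=> cS; have [M TM] := operator_bounded T.
pose r := 1 + `|M|; have r_gt0 : 0 < r by rewrite ltr_pwDl.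
have TX x : `|x| <= 1 -> `|T x| <= r.
  move=> x1; have [->|x0] := eqVneq x 0.
    by rewrite linear0 normr0 ltW.
  have x_gt0 : 0 < `|x| by rewrite normr_gt0.
  have M0 : 0 <= M by rewrite -(pmulr_lge0 _ x_gt0) (le_trans _ (TM x)).
  apply: le_trans (TM x) _; rewrite /r ger0_norm//.
  by apply: le_trans (ler_wpM2l M0 x1) _; rewrite mulr1 lerDr.
have : precompact ((fun x => r *: x) @` (S @` [set x | `|x| <= 1])).
  exact: (precompact_image (@scaler_continuous _ _ r) cS).
apply: precompact_subset => _ [x x1 <-].
exists (S (r^-1 *: T x)).
  exists (r^-1 *: T x) => //=.
  rewrite normrZ gtr0_norm ?invr_gt0// mulrC ler_pdivrMr// mul1r.
  exact: TX.
by rewrite linearZ scalerA divff ?scale1r// gt_eqF.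
Qed.

Lemma is_compact_zmod : zmod_closed is_compact.
Proof.
split=> [|S T]; rewrite !inE; last exact: compact_mapB.
have : precompact [set (0 : X)].
  exact/compact_precompact/compact_set1.
by apply: precompact_subset => _ [x _ <-].
Qed.
HB.instance Definition _ := GRing.isZmodClosed.Build B is_compact is_compact_zmod.

Definition calkin := Quotient.quot is_compact.
HB.instance Definition _ := GRing.Zmodule.on calkin.
HB.instance Definition _ := EqQuotient.on calkin.

Definition to_calkin T : calkin := (\pi_calkin T)%qT.

Lemma to_calkinP S T : to_calkin S = to_calkin T <-> compact_map (S - T).
Proof.
have := Quotient.idealrBE is_compact S T; rewrite inE => ST.
split=> [/eqP|/asboolP]; first by rewrite -[_ == _]ST => /asboolP.
by rewrite ST => /eqP.
Qed.

Lemma repr_to_calkin (a : calkin) : to_calkin (repr a) = a.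
Proof. exact: reprK. Qed.

Lemma to_calkinB : {morph to_calkin : S T / S - T}.
Proof. by move=> S T; rewrite /to_calkin !piE. Qed.

Lemma to_calkinD : {morph to_calkin : S T / S + T}.
Proof. by move=> S T; rewrite /to_calkin !piE. Qed.

Definition calkin_mul (a b : calkin) := to_calkin (repr a * repr b).

Lemma to_calkinM S T : to_calkin (S * T) = calkin_mul (to_calkin S) (to_calkin T).
Proof.
apply/to_calkinP; set S' := repr _; set T' := repr _.
have cS : compact_map (S - S') by apply/to_calkinP; rewrite repr_to_calkin.
have cT : compact_map (T - T') by apply/to_calkinP; rewrite repr_to_calkin.
rewrite (_ : S * T - S' * T' = (S - S') * T - S' * (T' - T)); last first.
  by rewrite mulrBl mulrBr opprB addrA subrK.
apply: compact_mapB; first exact: compact_mapMr.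
by apply: compact_mapMl; apply/to_calkinP; rewrite repr_to_calkin.
Qed.

Lemma calkin_mulA : associative calkin_mul.
Proof.
move=> a b c; rewrite -(repr_to_calkin a) -(repr_to_calkin b) -(repr_to_calkin c).
by rewrite -!to_calkinM mulrA.
Qed.

Lemma calkin_mul1l : left_id (to_calkin 1) calkin_mul.
Proof. by move=> a; rewrite -(repr_to_calkin a) -to_calkinM mul1r. Qed.

Lemma calkin_mul1r : right_id (to_calkin 1) calkin_mul.
Proof. by move=> a; rewrite -(repr_to_calkin a) -to_calkinM mulr1. Qed.

Lemma calkin_mulDl : left_distributive calkin_mul +%R.
Proof.
move=> a b c; rewrite -(repr_to_calkin a) -(repr_to_calkin b) -(repr_to_calkin c).
by rewrite -to_calkinD -!to_calkinM -to_calkinD mulrDl.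
Qed.

Lemma calkin_mulDr : right_distributive calkin_mul +%R.
Proof.
move=> a b c; rewrite -(repr_to_calkin a) -(repr_to_calkin b) -(repr_to_calkin c).
by rewrite -to_calkinD -!to_calkinM -to_calkinD mulrDr.
Qed.

HB.instance Definition _ := GRing.Zmodule_isPzRing.Build calkin
  calkin_mulA calkin_mul1l calkin_mul1r calkin_mulDl calkin_mulDr.

(* The strictly singular operators modulo the compact ones, as a subset of
   the ring of all operators modulo the compact ones. *)
Definition singular_mod_compact : set calkin :=
  to_calkin @` [set T : B | strictly_singular T].

End CalkinAlgebra.

Definition nilpotent_at (A : pzRingType) (S : set A) (k : nat) :=
  forall a : 'I_k -> A, (forall i, S (a i)) -> \prod_i a i = 0.

Definition nilpotency_index (A : pzRingType) (S : set A) (k : nat) :=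
  [/\ (0 < k)%N, nilpotent_at S k &
      forall j, (0 < j)%N -> nilpotent_at S j -> (k <= j)%N].

Section PowerSums.
Variable R : realType.
Implicit Types (p : R) (u v : R ^nat).

Lemma lp_series_triangle p u v : 1 <= p ->
    (forall n, 0 <= u n) -> (forall n, 0 <= v n) ->
  ((\sum_(0 <= n <oo) ((u n + v n) `^ p)%:E) `^ p^-1 <=
   (\sum_(0 <= n <oo) (u n `^ p)%:E) `^ p^-1 +
   (\sum_(0 <= n <oo) (v n `^ p)%:E) `^ p^-1)%E.
Proof.
move=> p1 u0 v0; have p_gt0 : 0 < p by exact: lt_le_trans ltr01 p1.
have mf (f : R ^nat) : measurable_fun setT f by [].
have nrm (r : R) : 0 <= r -> (`|r%:E| `^ p)%E = (r `^ p)%:E.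
  by move=> r0; rewrite gee0_abs ?lee_fin.
have LE (f : R ^nat) : (forall n, 0 <= f n) ->
    Lnorm counting p%:E (EFin \o f) =
    ((\sum_(0 <= n <oo) (f n `^ p)%:E) `^ p^-1)%E.
  move=> f0; rewrite Lnorm_counting//; congr (poweR _ _).
  by apply: eq_eseriesr => n _; exact: nrm.
have := minkowski_EFin counting (mf u) (mf v) p1.
by rewrite !LE// => n; rewrite addr_ge0.
Qed.

Lemma lp_series_fin p u n : 0 < p -> (forall i, (n <= i)%N -> u i = 0) ->
  (\sum_(0 <= i <oo) (u i `^ p)%:E)%E = (\sum_(0 <= i < n) u i `^ p)%:E.
Proof.
move=> p_gt0 u0; rewrite (nneseries_split 0 n) ?add0n; last first.
  by move=> k _; rewrite lee_fin powR_ge0.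
rewrite [X in (_ + X)%E]eseries0 ?adde0 -?sumEFin//.
by move=> i ni _; rewrite u0// powR0// gt_eqF.
Qed.

Lemma power_sum_triangle p (T : Type) (r : seq T) (f g : T -> R) : 1 <= p ->
    (forall t, 0 <= f t) -> (forall t, 0 <= g t) ->
  (\sum_(t <- r) (f t + g t) `^ p) `^ p^-1 <=
  (\sum_(t <- r) f t `^ p) `^ p^-1 + (\sum_(t <- r) g t `^ p) `^ p^-1.
Proof.
move=> p1 f0 g0; have p_gt0 : 0 < p by exact: lt_le_trans ltr01 p1.
pose ext (h : T -> R) n := nth 0 (map h r) n.
have ext_out h n : (size r <= n)%N -> ext h n = 0.
  by move=> rn; rewrite /ext nth_default// size_map.
have ext_ge0 h n : (forall t, 0 <= h t) -> 0 <= ext h n.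
  move=> h0; rewrite /ext; have [rn|nr] := leqP (size (map h r)) n.
    by rewrite nth_default.
  move: nr; elim: (r) n => [|t r' IH] [|n] //=; exact: IH.
have sumE h : \sum_(0 <= i < size r) ext h i `^ p = \sum_(t <- r) h t `^ p.
  by rewrite -(big_map h xpredT (fun y => y `^ p)) [RHS](big_nth 0) size_map.
have extD n : ext (fun t => f t + g t) n = ext f n + ext g n.
  rewrite /ext; elim: (r) n => [|t r' IH] [|n] //=; rewrite ?addr0//; exact: IH.
have := @lp_series_triangle p (ext f) (ext g) p1
  (fun n => ext_ge0 f n f0) (fun n => ext_ge0 g n g0).
under eq_eseriesr do rewrite -extD.
rewrite !(@lp_series_fin p _ (size r))//; try by move=> *; exact: ext_out.
by rewrite !sumE !poweR_EFin -EFinD lee_fin.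
Qed.

Lemma power_sum_le p (T : Type) (r : seq T) (f g : T -> R) : 0 < p ->
    (forall t, 0 <= f t) -> (forall t, f t <= g t) ->
  (\sum_(t <- r) f t `^ p) `^ p^-1 <= (\sum_(t <- r) g t `^ p) `^ p^-1.
Proof.
move=> p_gt0 f0 fg.
apply: ge0_ler_powR; rewrite ?nnegrE ?invr_ge0 ?(ltW p_gt0)//.
- by rewrite sumr_ge0// => t _; rewrite powR_ge0.
- by rewrite sumr_ge0// => t _; rewrite powR_ge0.
apply: ler_sum => t _.
apply: ge0_ler_powR; rewrite ?nnegrE ?(ltW p_gt0)//.
exact: le_trans (f0 t) (fg t).
Qed.

Lemma power_sumZ p (T : Type) (r : seq T) (c : R) (f : T -> R) : 0 < p ->
    0 <= c -> (forall t, 0 <= f t) ->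
  (\sum_(t <- r) (c * f t) `^ p) `^ p^-1 =
  c * (\sum_(t <- r) f t `^ p) `^ p^-1.
Proof.
move=> p_gt0 c0 f0; under eq_bigr do rewrite powRM//.
rewrite -mulr_sumr powRM ?powR_ge0//; last first.
  by rewrite sumr_ge0// => t _; rewrite powR_ge0.
by rewrite -powRrM divff ?gt_eqF// powRr1.
Qed.

End PowerSums.

Definition exponent (R : realType) := {p : R | 1 <= p}.
HB.instance Definition _ (R : realType) := Choice.on (exponent R).

Lemma exponent_gt0 (R : realType) (p : exponent R) : 0 < val p.
Proof. exact: lt_le_trans ltr01 (valP p). Qed.

Section SequenceNorms.
Variables (R : realType) (s : scalar_kind).
Local Notation K := (scalars R s).

(* Sequences are usually indexed by the positive integers; here [i : nat]
   stands for the positive integer i + 1, so the n-th coordinate is [x n.-1]. *)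
Definition scalar_seq := nat -> K^o.
HB.instance Definition _ := GRing.Lmodule.on scalar_seq.
Implicit Types (x y : scalar_seq) (p : exponent R).

Definition c00 : set scalar_seq :=
  [set x | exists n, forall i, (n <= i)%N -> x i = 0].

Lemma modulus_seqD x y n : modulus ((x + y) n) <= modulus (x n) + modulus (y n).
Proof. exact: modulusD. Qed.

Lemma modulus_seqZ a x n : modulus ((a *: x) n) = modulus a * modulus (x n).
Proof. exact: modulusM. Qed.

Definition ell_norm p x : \bar R :=
  ((\sum_(0 <= n <oo) (modulus (x n) `^ val p)%:E) `^ (val p)^-1)%E.

Lemma ell_norm_ge0 p x : (0 <= ell_norm p x)%E.
Proof. exact: poweR_ge0. Qed.

Lemma ell_normD p x y : (ell_norm p (x + y)%R <= ell_norm p x + ell_norm p y)%E.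
Proof.
have p0 := exponent_gt0 p.
apply: le_trans (lp_series_triangle (valP p) (fun n => modulus_ge0 (x n))
  (fun n => modulus_ge0 (y n))).
have sum_in (f : R ^nat) : (\sum_(0 <= n <oo) (f n `^ val p)%:E)%E \in `[0%E, +oo%E].
  by rewrite in_itv /= leey andbT nneseries_ge0// => n _ _; rewrite lee_fin powR_ge0.
apply: gt0_ler_poweR; [by rewrite invr_ge0 ltW|exact: sum_in| |].
  exact: (sum_in (fun n => modulus (x n) + modulus (y n))).
apply: lee_nneseries => [i _ _|n _]; first by rewrite lee_fin powR_ge0.
rewrite lee_fin; apply: ge0_ler_powR;
  by rewrite ?nnegrE ?addr_ge0 ?modulus_ge0 ?modulus_seqD ?(ltW p0).
Qed.

Lemma ell_normZ p a x :
  (ell_norm p (a *: x)%R <= (modulus a)%:E * ell_norm p x)%E.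
Proof.
have p0 := exponent_gt0 p.
rewrite /ell_norm (eq_eseriesr
  (g := fun n => ((modulus a `^ val p)%:E * (modulus (x n) `^ val p)%:E)%E)).
  rewrite nneseriesZl//; last by move=> n _; rewrite lee_fin powR_ge0.
  rewrite poweRM ?lee_fin ?powR_ge0//; last first.
    by apply: nneseries_ge0 => n _ _; rewrite lee_fin powR_ge0.
  by rewrite poweR_EFin -powRrM divff ?gt_eqF// powRr1// modulus_ge0.
by move=> n _; rewrite modulus_seqZ powRM ?modulus_ge0// EFinM.
Qed.

Lemma ell_norm_eq0 p x : ell_norm p x = 0%E -> x = 0.
Proof.
move=> /poweR_eq0_eq0 sum0; apply/funext => n; apply: modulus_eq0.
have term_ge0 i : (0 <= (modulus (x i) `^ val p)%:E)%E by rewrite lee_fin powR_ge0.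
have := @nneseries_lim_ge R (fun i => (modulus (x i) `^ val p)%:E) xpredT 0 n.+1
  (fun i _ _ => term_ge0 i).
rewrite sum0 ?nneseries_ge0// big_nat_recr//= => sum_le0.
apply: (@powR_eq0_eq0 _ _ (val p)); apply/eqP.
rewrite eq_le powR_ge0 andbT -lee_fin (le_trans _ sum_le0)//.
by rewrite leeDr// sume_ge0.
Qed.

Definition ell_ext_norm p := ExtNorm
  (ell_norm_ge0 p) (ell_normD p) (ell_normZ p) (@ell_norm_eq0 p).

(* |F| <= min F, where n : nat stands for the positive integer n + 1. *)
Definition schreier : set {fset nat} :=
  [set F : {fset nat} | forall n : nat, n \in F -> (#|` F| <= n.+1)%N].

Lemma schreier1 n : schreier [fset n]%fset.
Proof. by move=> m; rewrite cardfs1. Qed.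

Definition schreier_norm p x : \bar R := ereal_sup
  [set ((\sum_(n <- F) modulus (x n) `^ val p) `^ (val p)^-1)%:E
     | F in schreier].

Lemma schreier_norm_ge0 p x : (0 <= schreier_norm p x)%E.
Proof.
apply: le_ereal_sup_tmp; exists
  ((\sum_(n <- [fset 0%N]%fset) modulus (x n) `^ val p) `^ (val p)^-1)%:E.
  by exists [fset 0%N]%fset => //; exact: schreier1.
by rewrite lee_fin powR_ge0.
Qed.

Lemma schreier_normD p x y :
  (schreier_norm p (x + y)%R <= schreier_norm p x + schreier_norm p y)%E.
Proof.
apply: ge_ereal_sup => _ [F sF <-].
apply: (@le_trans _ _
   (((\sum_(n <- F) modulus (x n) `^ val p) `^ (val p)^-1)%:E +
    ((\sum_(n <- F) modulus (y n) `^ val p) `^ (val p)^-1)%:E)%E).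
  rewrite -EFinD lee_fin; apply: le_trans (power_sum_triangle _ (valP p)
    (fun n => modulus_ge0 (x n)) (fun n => modulus_ge0 (y n))).
  by apply: power_sum_le => [|n|n]; rewrite ?exponent_gt0 ?modulus_ge0 ?modulus_seqD.
by rewrite leeD//; apply: ereal_sup_ubound; exists F.
Qed.

Lemma schreier_normZ p a x :
  (schreier_norm p (a *: x)%R <= (modulus a)%:E * schreier_norm p x)%E.
Proof.
apply: ge_ereal_sup => _ [F sF <-].
under eq_bigr do rewrite modulus_seqZ.
rewrite power_sumZ ?exponent_gt0 ?modulus_ge0//; last by move=> n; exact: modulus_ge0.
rewrite EFinM lee_wpmul2l ?lee_fin ?modulus_ge0//.
by apply: ereal_sup_ubound; exists F.
Qed.

Lemma schreier_norm_eq0 p x : schreier_norm p x = 0%E -> x = 0.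
Proof.
move=> x0; apply/funext => n; apply/modulus_eq0/eqP.
rewrite eq_le modulus_ge0 andbT -lee_fin.
suff : ((modulus (x n))%:E <= schreier_norm p x)%E by rewrite x0.
apply: ereal_sup_ubound.
exists [fset n]%fset; first exact: schreier1.
by rewrite big_seq_fset1 -powRrM divff ?gt_eqF ?exponent_gt0// powRr1// modulus_ge0.
Qed.

Definition schreier_ext_norm p := ExtNorm (schreier_norm_ge0 p)
  (schreier_normD p) (schreier_normZ p) (@schreier_norm_eq0 p).

Definition fset_before (F G : {fset nat}) : bool :=
  all (fun m => all (fun n => m < n)%N G) F.

Definition schreier_chain : set (seq {fset nat}) :=
  [set C : seq {fset nat} | [/\ C != [::],
               forall F, F \in C -> F != fset0 /\ schreier F &
               sorted fset_before C]].

Lemma schreier_chain1 n : schreier_chain [:: [fset n]%fset].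
Proof.
split=> // F; rewrite inE => /eqP ->; split; last exact: schreier1.
by apply/fset0Pn; exists n; rewrite inE.
Qed.

Definition baernstein_norm p x : \bar R := ereal_sup
  [set ((\sum_(F <- C) (\sum_(n <- F) modulus (x n)) `^ val p) `^ (val p)^-1)%:E
     | C in schreier_chain].

Let sum_modulus_ge0 x (F : {fset nat}) : 0 <= \sum_(n <- F) modulus (x n).
Proof. by rewrite sumr_ge0// => n _; exact: modulus_ge0. Qed.

Lemma baernstein_norm_ge0 p x : (0 <= baernstein_norm p x)%E.
Proof.
apply: le_ereal_sup_tmp; eexists.
  by exists [:: [fset 0%N]%fset] => //; exact: schreier_chain1.
by rewrite lee_fin powR_ge0.
Qed.

Lemma baernstein_normD p x y :
  (baernstein_norm p (x + y)%R <= baernstein_norm p x + baernstein_norm p y)%E.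
Proof.
apply: ge_ereal_sup => _ [C sC <-].
apply: (@le_trans _ _
   (((\sum_(F <- C) (\sum_(n <- F) modulus (x n)) `^ val p) `^ (val p)^-1)%:E +
    ((\sum_(F <- C) (\sum_(n <- F) modulus (y n)) `^ val p) `^ (val p)^-1)%:E)%E).
  rewrite -EFinD lee_fin; apply: le_trans (power_sum_triangle _ (valP p)
    (sum_modulus_ge0 x) (sum_modulus_ge0 y)).
  apply: power_sum_le => [|F|F]; rewrite ?exponent_gt0//.
  by rewrite -big_split; apply: ler_sum => n _; exact: modulus_seqD.
by rewrite leeD//; apply: ereal_sup_ubound; exists C.
Qed.

Lemma baernstein_normZ p a x :
  (baernstein_norm p (a *: x)%R <= (modulus a)%:E * baernstein_norm p x)%E.
Proof.
apply: ge_ereal_sup => _ [C sC <-].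
under eq_bigr => F _ do
  (under eq_bigr do rewrite modulus_seqZ; rewrite -mulr_sumr).
rewrite power_sumZ ?exponent_gt0 ?modulus_ge0//.
rewrite EFinM lee_wpmul2l ?lee_fin ?modulus_ge0//.
by apply: ereal_sup_ubound; exists C.
Qed.

Lemma baernstein_norm_eq0 p x : baernstein_norm p x = 0%E -> x = 0.
Proof.
move=> x0; apply/funext => n; apply/modulus_eq0/eqP.
rewrite eq_le modulus_ge0 andbT -lee_fin.
suff : ((modulus (x n))%:E <= baernstein_norm p x)%E by rewrite x0.
apply: ereal_sup_ubound.
exists [:: [fset n]%fset]; first exact: schreier_chain1.
rewrite big_seq1 big_seq_fset1 -powRrM divff ?gt_eqF ?exponent_gt0//.
by rewrite powRr1// modulus_ge0.
Qed.

Definition baernstein_ext_norm p := ExtNorm (baernstein_norm_ge0 p)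
  (baernstein_normD p) (baernstein_normZ p) (@baernstein_norm_eq0 p).

End SequenceNorms.

Section SequenceSpaces.
Variables (R : realType) (s : scalar_kind).
Implicit Types p : exponent R.

Definition ell p : normedModType (scalars R s) :=
  finite_norm_space (ell_ext_norm s p).

Definition baernstein p : normedModType (scalars R s) :=
  finite_norm_space (baernstein_ext_norm s p).

Definition Z_space p : normedModType (scalars R s) :=
  finite_norm_space (schreier_ext_norm s p).

Definition in_closure_c00 p : {pred Z_space p} :=
  [pred x | x \in closure [set y : Z_space p | c00 (finite_norm_val y)] ].

Lemma in_closure_c00_submod p : submod_closed (@in_closure_c00 p).
Proof.
split=> [|a x y]; rewrite !inE; first by apply: subset_closure; exists 0%N.
move=> cx cy B nB.
have fc : continuous (fun z : Z_space p * Z_space p => a *: z.1 + z.2).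
  move=> z; apply: cvgD; last exact: cvg_snd.
  by apply: (continuous_comp (g := fun u => a *: u));
    [exact: cvg_fst|exact: scaler_continuous].
have /= [[U V] /= [nU nV] UVB] := fc (x, y) B nB.
have [u [[m u0] Uu]] := cx _ nU; have [v [[n v0] Vv]] := cy _ nV.
exists (a *: u + v); split; last exact: (UVB (u, v)).
exists (maxn m n) => i; rewrite geq_max => /andP[mi ni].
rewrite (_ : finite_norm_val _ i = a * finite_norm_val u i + finite_norm_val v i)//.
by rewrite u0// v0// mulr0 addr0.
Qed.
HB.instance Definition _ p := GRing.isSubmodClosed.Build (scalars R s)
  (Z_space p) (@in_closure_c00 p) (@in_closure_c00_submod p).

Definition schreier_space p : normedModType (scalars R s) :=
  subspace (@in_closure_c00 p).

Definition summand (L M N : {fset exponent R}) (i : L + M + N) :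
    normedModType (scalars R s) :=
  match i with
  | inl (inl p) => baernstein (val p)
  | inl (inr q) => ell (val q)
  | inr r => schreier_space (val r)
  end.

Definition sum_space (L M N : {fset exponent R}) : normedModType (scalars R s) :=
  direct_sum (@summand L M N).

End SequenceSpaces.

(* Main.v *)
(** For 1 <= s <= p <= oo, let the norm of type (s, p) of a sequence x be the
    supremum over Schreier chains of the l_p norm of the family of the l_s norms
    of x on the members of the chain. This is the norm of B_p for (1, p), of l_q
    for (q, q), of S_r for (r, oo) and of c_0 for (oo, oo). Types are ordered
    lexicographically. The norm of type (s, p) dominates the weak l_s norm, since
    the upper half of a finite set of integers is a Schreier set; hence it
    dominates every norm of larger type, up to a constant.

    In the space of type (s, p), let a bounded coordinatewise null sequence stay
    away from 0 in norm. By a gliding hump argument a subsequence spans a copy of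
    a space of type (s, p) if its coordinates stay away from 0, and of type (p, p)
    otherwise. If an operator T does not strictly increase the type of such
    a sequence z, then the lower estimates of T z beat the upper estimates of z,
    and T is an embedding on the span of a subsequence. So strictly singular
    operators strictly increase types. Exactly k + 1 types occur in X, and
    therefore k + 1 strictly singular operators map bounded coordinatewise null
    sequences to norm null ones. A pigeonhole argument reduces compactness of the
    composition to this.

    Conversely, if (s, p) < (s', p'), the inclusion of the space of type (s, p)
    in that of type (s', p') is strictly singular, since every infinite-dimensional
    subspace contains unit vectors with small coordinates. Composing along the
    k + 1 types occurring in X gives a non-compact operator, as it maps basis
    vectors to basis vectors. The type (p, p) is realized in B_p, and (oo, oo) in
    S_r, by normalized indicators of fast growing maximal Schreier sets. *)

Require Import Defs.
From mathcomp Require Import all_boot all_order all_algebra.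
From mathcomp Require Import finmap complex.
From mathcomp Require Import all_classical all_reals all_analysis.
From mathcomp Require Import zify lra.
Set Implicit Arguments.
Unset Strict Implicit.
Unset Printing Implicit Defensive.
Import Order.TTheory GRing.Theory Num.Theory numFieldNormedType.Exports.
Local Open Scope classical_set_scope.
Local Open Scope ring_scope.

(** * l_p norms of finite families *)

(** The coefficients of a block sequence with blocks [m i, m (i + 1)) are always measured in the
    span of the e_(m i), not of the e_i: how many later blocks a Schreier set can meet depends on
    the positions of the blocks. Upper and lower estimates then speak of the same [bnd m], whatever
    the types, and T is an embedding on the span of a subsequence of z as soon as the type of T z in
    one component is at most every type of z.

    Types are counted by rank, in all components at once: a sequence at level l only has types of
    rank at least l, and each strictly singular operator raises the level by one. How T mixes the
    components is therefore irrelevant.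

    Instead, pairs of terms whose images under all partial products nearly agree on the first
    coordinates are subtracted. The differences are coordinatewise null, which is all that a gliding
    hump requires. *)

Section PowerNorm.
Variable R : realType.
Implicit Types (p s : \bar R) (T : eqType).

(* Junk value 0 at p = -oo; otherwise used for 1 <= p <= +oo only. *)
Definition lpn p T (r : seq T) (f : T -> R) : R :=
  match p with
  | EFin q => (\sum_(t <- r) f t `^ q) `^ q^-1
  | +oo%E => \big[Num.max/0]_(t <- r) f t
  | -oo%E => 0
  end.

Lemma ler_bigmax_seq T (r : seq T) (f : T -> R) t : t \in r ->
  f t <= \big[Num.max/0]_(u <- r) f u.
Proof. by move=> tr; exact: le_bigmax_seq. Qed.

Lemma lpn_ge0 p T (r : seq T) f : 0 <= lpn p r f.
Proof.
by case: p => [q| |] //=; rewrite ?powR_ge0//; exact: bigmax_ge_id.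
Qed.

Lemma exponentP p : (1 <= p)%E -> (exists2 q, 1 <= q & p = q%:E) \/ p = +oo%E.
Proof. by case: p => [q| |]//; [rewrite lee_fin => ?; left; exists q|right]. Qed.

Lemma powR_sum_ge0 T (r : seq T) (f : T -> R) q : 0 <= \sum_(t <- r) f t `^ q.
Proof. by apply: sumr_ge0 => t _; rewrite powR_ge0. Qed.

Lemma powR_root (x q : R) : 1 <= q -> 0 <= x -> (x `^ q^-1) `^ q = x.
Proof.
by move=> q1 x0; rewrite -powRrM mulVf ?powRr1// gt_eqF// (lt_le_trans ltr01).
Qed.

Lemma root_powR (x q : R) : 1 <= q -> 0 <= x -> (x `^ q) `^ q^-1 = x.
Proof.
by move=> q1 x0; rewrite -powRrM mulfV ?powRr1// gt_eqF// (lt_le_trans ltr01).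
Qed.

Lemma le_root_powR (x y q : R) : 1 <= q -> 0 <= x -> 0 <= y ->
  (x `^ q^-1 <= y) = (x <= y `^ q).
Proof.
move=> q1 x0 y0; have q0 : 0 <= q by rewrite (le_trans _ q1).
apply/idP/idP => h.
  rewrite -(powR_root q1 x0); apply: ge0_ler_powR => //;
    by rewrite nnegrE ?powR_ge0.
rewrite -(root_powR q1 y0); apply: ge0_ler_powR => //;
  by rewrite ?nnegrE ?powR_ge0 ?invr_ge0.
Qed.

Lemma lpn_fin q T (r : seq T) (f : T -> R) : 1 <= q ->
  lpn q%:E r f `^ q = \sum_(t <- r) f t `^ q.
Proof. by move=> q1; rewrite /= powR_root ?powR_sum_ge0. Qed.

Lemma eq_lpn p T (r : seq T) f g : {in r, f =1 g} -> lpn p r f = lpn p r g.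
Proof.
case: p => [q| |] fg; rewrite /lpn.
- by congr (_ `^ _); apply: eq_big_seq => t /fg ->.
- by apply: eq_big_seq => t /fg ->.
- by [].
Qed.

Lemma lpn_nil p T (f : T -> R) : (1 <= p)%E -> lpn p [::] f = 0.
Proof.
move=> /exponentP[[q q1 ->]|->] /=; rewrite big_nil// powR0//.
by rewrite invr_eq0 gt_eqF// (lt_le_trans ltr01).
Qed.


(** Upper bounds on [lpn] go through this lemma, by one argument on power sums and one on maxima. *)
Lemma lpn_leP p T (r : seq T) f (c : R) : (1 <= p)%E -> 0 <= c ->
  (forall q, 1 <= q -> p = q%:E -> \sum_(t <- r) f t `^ q <= c `^ q) ->
  (p = +oo%E -> {in r, forall t, f t <= c}) -> lpn p r f <= c.
Proof.
move=> /exponentP[[q q1 ->]|->] c0 h1 h2 /=.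
  by rewrite le_root_powR ?powR_sum_ge0//; exact: h1.
by rewrite [leLHS]big_seq; apply: bigmax_le => // t tr; exact: h2.
Qed.

Lemma lpn_ge_term p T (r : seq T) f t : (1 <= p)%E -> {in r, forall t, 0 <= f t} ->
  t \in r -> f t <= lpn p r f.
Proof.
move=> /exponentP[[q q1 ->]|->] f0 tr; last exact: le_bigmax_seq.
rewrite -(root_powR q1 (f0 _ tr)); apply: ge0_ler_powR.
- by rewrite invr_ge0 (le_trans _ q1).
- by rewrite nnegrE powR_ge0.
- by rewrite nnegrE powR_sum_ge0.
rewrite (big_rem t)//= lerDl; exact: powR_sum_ge0.
Qed.

Lemma lpn_mono p T (r : seq T) f g : (1 <= p)%E ->
  {in r, forall t, 0 <= f t} -> {in r, forall t, f t <= g t} ->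
  lpn p r f <= lpn p r g.
Proof.
move=> p1 f0 fg; apply: lpn_leP => //; first exact: lpn_ge0.
  move=> q q1 ->; rewrite lpn_fin// big_seq [leRHS]big_seq.
  apply: ler_sum => t tr; apply: ge0_ler_powR.
  - by rewrite (le_trans _ q1).
  - by rewrite nnegrE f0.
  - by rewrite nnegrE (le_trans (f0 _ tr))// fg.
  - exact: fg.
move=> -> t tr /=; apply: le_trans (fg _ tr) _.
exact: le_bigmax_seq.
Qed.

Lemma lpn_triangle p T (r : seq T) f g : (1 <= p)%E ->
  (forall t, 0 <= f t) -> (forall t, 0 <= g t) ->
  lpn p r (fun t => f t + g t) <= lpn p r f + lpn p r g.
Proof.
move=> p1 f0 g0; apply: lpn_leP => //; first by rewrite addr_ge0 ?lpn_ge0.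
  move=> q q1 ->; rewrite -le_root_powR ?powR_sum_ge0 ?addr_ge0 ?lpn_ge0//.
  exact: power_sum_triangle.
move=> _ t tr; apply: lerD.
  by apply: lpn_ge_term => // u _; exact: f0.
by apply: lpn_ge_term => // u _; exact: g0.
Qed.

Lemma lpn_scale p T (r : seq T) f (c : R) : (1 <= p)%E ->
  0 <= c -> (forall t, 0 <= f t) ->
  lpn p r (fun t => c * f t) = c * lpn p r f.
Proof.
move=> /exponentP[[q q1 ->]|->] c0 f0 /=.
  by rewrite power_sumZ// (lt_le_trans _ q1).
by elim/big_rec2: _ => [|t x y _ ->]; rewrite ?mulr0// maxr_pMr.
Qed.

Lemma lpn_subset p T (r r' : seq T) f : (1 <= p)%E ->
  {in r', forall t, 0 <= f t} ->
  uniq r -> {subset r <= r'} -> lpn p r f <= lpn p r' f.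
Proof.
move=> p1 f0 ur rr'; apply: lpn_leP => //; first exact: lpn_ge0.
  move=> q q1 ->; rewrite lpn_fin//.
  have ur' : uniq (undup r') by exact: undup_uniq.
  have -> : \sum_(t <- r) f t `^ q = \sum_(t <- undup r' | t \in r) f t `^ q.
    rewrite -[RHS]big_filter; apply: perm_big; apply: uniq_perm => //.
      exact: filter_uniq.
    by move=> t; rewrite mem_filter mem_undup; case: (boolP (t \in r)) => // /rr' ->.
  apply: (@le_trans _ _ (\sum_(t <- undup r') f t `^ q)).
    rewrite big_mkcond; apply: ler_sum => t _; case: ifP => // _.
    exact: powR_ge0.
  elim: r' {f0 rr' ur'} => [|t r' IH] //=; rewrite [leRHS]big_cons.
  case: ifP => _; last by rewrite big_cons lerD2l.
  by apply: le_trans IH _; rewrite lerDr powR_ge0.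
by move=> _ t tr; apply: lpn_ge_term => //; exact: rr'.
Qed.

Lemma lpn1 T (r : seq T) f : (forall t, 0 <= f t) -> lpn 1%:E r f = \sum_(t <- r) f t.
Proof.
move=> f0; rewrite /= invr1 powRr1 ?powR_sum_ge0//.
by apply: eq_bigr => t _; rewrite powRr1.
Qed.

Lemma ler_sum_subset T (r r' : seq T) (f : T -> R) : (forall t, 0 <= f t) ->
  uniq r -> {subset r <= r'} -> \sum_(t <- r) f t <= \sum_(t <- r') f t.
Proof. by move=> f0 ur rr'; rewrite -!lpn1//; apply: lpn_subset. Qed.

Lemma lpn_map p T (U : eqType) (h : U -> T) (r : seq U) f :
  lpn p (map h r) f = lpn p r (f \o h).
Proof. by case: p => [q| |]; rewrite /lpn ?big_map. Qed.

Lemma lpn_filter0 p T (a : pred T) (r : seq T) f : (1 <= p)%E ->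
  {in r, forall t, ~~ a t -> f t = 0} -> (forall t, 0 <= f t) ->
  lpn p [seq t <- r | a t] f = lpn p r f.
Proof.
move=> p1 a0 f0; apply/eqP; rewrite eq_le; apply/andP; split; apply: lpn_leP => //;
  rewrite ?lpn_ge0//.
- move=> q q1 ->; rewrite lpn_fin// big_filter big_mkcond.
  by apply: ler_sum => t _; case: ifP => // _; exact: powR_ge0.
- by move=> _ t; rewrite mem_filter => /andP[_ tr]; exact: lpn_ge_term.
- move=> q q1 ->; rewrite lpn_fin// big_filter [leRHS]big_mkcond [leLHS]big_seq [leRHS]big_seq.
  apply: ler_sum => t tr; case: ifP => // /negbT /(a0 _ tr) ->.
  by rewrite powR0// gt_eqF// (lt_le_trans _ q1).
- move=> _ t tr; case: (boolP (a t)) => [at_|/(a0 _ tr) ->]; last exact: lpn_ge0.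
  by apply: lpn_ge_term => //; rewrite mem_filter at_.
Qed.

Lemma lpn_partition p T (U : eqType) (g : T -> U) (u : seq U) (r : seq T) f :
  (1 <= p)%E -> (forall t, 0 <= f t) -> uniq u -> {in r, forall t, g t \in u} ->
  lpn p r f = lpn p u (fun i => lpn p [seq t <- r | g t == i] f).
Proof.
move=> /exponentP[[q q1 ->]|->] f0 uu gu.
  congr (_ `^ _).
  under [RHS]eq_bigr do rewrite lpn_fin// big_filter.
  rewrite (exchange_big_dep xpredT)//= big_seq [RHS]big_seq; apply: eq_bigr => t tr.
  rewrite -big_filter (eq_filter (a2 := pred1 (g t))); last by move=> i; rewrite /= eq_sym.
  by rewrite filter_pred1_uniq ?gu// big_seq1.
apply/eqP; rewrite eq_le; apply/andP; split => /=.
  rewrite [leLHS]big_seq; apply: bigmax_le; first exact: bigmax_ge_id.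
  move=> t tr; apply: le_trans (ler_bigmax_seq _ (gu _ tr)).
  by apply: le_bigmax_seq => //; rewrite mem_filter eqxx.
apply: bigmax_le => [|i _]; first exact: bigmax_ge_id.
rewrite [leLHS]big_seq; apply: bigmax_le => [|t]; first exact: bigmax_ge_id.
by rewrite mem_filter => /andP[_ tr]; exact: le_bigmax_seq.
Qed.

Lemma lpn_flatten p T (rr : seq (seq T)) f : (1 <= p)%E ->
  (forall t, 0 <= f t) ->
  lpn p (flatten rr) f = lpn p rr (fun r => lpn p r f).
Proof.
move=> /exponentP[[q q1 ->]|->] f0.
  by congr (_ `^ _); rewrite big_flatten; apply: eq_bigr => r _; rewrite lpn_fin.
apply/eqP; rewrite eq_le; apply/andP; split => /=.
  rewrite [leLHS]big_seq; apply: bigmax_le; first exact: bigmax_ge_id.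
  move=> t /flattenP[r rrr tr]; apply: le_trans (ler_bigmax_seq _ rrr).
  exact: le_bigmax_seq.
rewrite [leLHS]big_seq; apply: bigmax_le => [|r rrr]; first exact: bigmax_ge_id.
rewrite [leLHS]big_seq; apply: bigmax_le => [|t tr]; first exact: bigmax_ge_id.
by apply: ler_bigmax_seq; apply/flattenP; exists r.
Qed.

(** For finite exponents s <= q each term satisfies f^q = f^s f^(q - s) <= f^s N^(q - s), where N is
    the l_s norm. The sum of these bounds is N^q. *)
Lemma lpn_antimono s p T (r : seq T) f : (1 <= s)%E -> (s <= p)%E ->
  (forall t, 0 <= f t) -> lpn p r f <= lpn s r f.
Proof.
move=> s1 sp f0; have p1 := le_trans s1 sp.
apply: lpn_leP => //; [exact: lpn_ge0| |by move=> _ t tr; apply: lpn_ge_term => // u _; exact: f0].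
move=> q q1 pq; move: sp s1; rewrite {}pq => {p p1}.
case: s => [s| |]//; rewrite !lee_fin => sq s1.
set N := lpn _ _ _; have N0 : 0 <= N by exact: lpn_ge0.
have s0 : 0 < s by exact: lt_le_trans s1.
have [N00|Nn0] := eqVneq N 0.
  rewrite big_seq big1 ?powR_ge0// => t tr.
  have := @lpn_ge_term s%:E _ r f t s1 (fun t _ => f0 t) tr.
  rewrite -/N N00 => ft; have -> : f t = 0 by apply/eqP; rewrite eq_le ft f0.
  by rewrite powR0// gt_eqF// (lt_le_trans _ q1).
have N_gt0 : 0 < N by rewrite lt_def Nn0.
have -> : q = s + (q - s) by rewrite addrC subrK.
rewrite powRD; last by rewrite Nn0 implybT.
rewrite {1}/N lpn_fin// mulr_suml big_seq [leRHS]big_seq.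
apply: ler_sum => t tr; have [ft0|ftn0] := eqVneq (f t) 0.
  rewrite ft0 powR0 ?mulr_ge0 ?powR_ge0//.
  by rewrite addrC subrK gt_eqF// (lt_le_trans _ q1).
rewrite powRD ?ftn0 ?implybT// ler_wpM2l ?powR_ge0//.
apply: ge0_ler_powR; rewrite ?nnegrE ?subr_ge0//.
exact: lpn_ge_term.
Qed.

Lemma lpn_le_sum p T (r : seq T) f : (1 <= p)%E -> (forall t, 0 <= f t) ->
  lpn p r f <= \sum_(t <- r) f t.
Proof.
move=> p1 f0; rewrite -lpn1//; exact: lpn_antimono.
Qed.

Lemma lpn_seq1 p T (t : T) f : (1 <= p)%E -> 0 <= f t -> lpn p [:: t] f = f t.
Proof.
move=> /exponentP[[q q1 ->]|->] f0 /=; first by rewrite big_seq1 root_powR.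
by rewrite big_cons big_nil; apply/max_idPl.
Qed.

(** The reciprocal 1/p with 1/+oo = 0, so that J ones have l_p norm J^(1/p) for all p >= 1. *)
Definition iexp p : R := if p is q%:E then q^-1 else 0.

Lemma lpn_const p T (r : seq T) (c : R) : (1 <= p)%E -> 0 <= c -> r != [::] ->
  lpn p r (fun=> c) = (size r)%:R `^ iexp p * c.
Proof.
move=> /exponentP[[q q1 ->]|->] c0 r0 /=.
  rewrite big_const_seq count_predT iter_addr addr0 -[in LHS]mulr_natl powRM ?powR_ge0//.
  by rewrite root_powR.
rewrite powRr0 mul1r; case: r r0 => // t r _.
apply/eqP; rewrite eq_le bigmax_le//=.
exact: (ler_bigmax_seq (fun=> c) (mem_head _ _)).
Qed.

End PowerNorm.

(** * Norms of type (s, p) *)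

Section ChainNorm.
Variable R : realType.
Implicit Types (p s : \bar R) (sg : \bar R * \bar R) (k : nat -> nat)
  (C : seq (seq nat)) (F : seq nat) (y a : nat -> R).

Lemma lpn_split p (T : eqType) (q : pred T) (r : seq T) (f : T -> R) :
  (1 <= p)%E -> (forall t, 0 <= f t) ->
  lpn p r f <= lpn p [seq t <- r | q t] f + lpn p [seq t <- r | ~~ q t] f.
Proof.
move=> p1 f0.
have f1 (q' : pred T) : lpn p [seq t <- r | q' t] f =
    lpn p r (fun t => if q' t then f t else 0).
  rewrite -(@lpn_filter0 _ p _ q' r)//.
  - by apply: eq_lpn => t; rewrite mem_filter => /andP[->].
  - by move=> t _ /negbTE ->.
  - by move=> t; case: ifP.
rewrite !f1; apply: le_trans (lpn_triangle _ p1 _ _).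
- apply: lpn_mono => // t _; case: (q t); rewrite /= ?addr0 ?add0r//.
- by move=> t; case: ifP.
- by move=> t; case: ifP.
Qed.

Definition chain_norm sg C y : R := lpn sg.2 C (fun F => lpn sg.1 F y).

(* Members of a chain are increasing lists, possibly empty, instead of finite
   sets; index i stands for the position k i, that is for the positive integer
   k i + 1. The norm of a sequence y of type sg is at most c when
   [bnd id sg y c]; [bnd k] is the norm in the span of the e_(k i). *)
Definition chain k C :=
  pairwise ltn (flatten C) /\
  forall F, F \in C -> forall i, i \in F -> (size F <= (k i).+1)%N.

Definition bnd k sg y (c : R) := forall C, chain k C -> chain_norm sg C y <= c.

(* sg = (s, p): B_p has type (1, p), l_q type (q, q), S_r type (r, +oo) and c_0
   type (+oo, +oo). *)
Definition good sg := (1 <= sg.1 <= sg.2)%E.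

Lemma good1 sg : good sg -> (1 <= sg.1)%E.
Proof. by case/andP. Qed.

Lemma good12 sg : good sg -> (sg.1 <= sg.2)%E.
Proof. by case/andP. Qed.

Lemma good2 sg : good sg -> (1 <= sg.2)%E.
Proof. by case/andP; exact: le_trans. Qed.

Lemma chain_norm_ge0 sg C y : 0 <= chain_norm sg C y.
Proof. exact: lpn_ge0. Qed.

Lemma chain_nil k : chain k [::].
Proof. by split. Qed.

Lemma bnd_ge0 k sg y c : bnd k sg y c -> 0 <= c.
Proof. by move=> /(_ _ (chain_nil k)); apply: le_trans; exact: chain_norm_ge0. Qed.

Lemma chain_norm_mono sg C y y' : good sg -> (forall n, 0 <= y n) ->
  {in flatten C, forall n, y n <= y' n} -> chain_norm sg C y <= chain_norm sg C y'.
Proof.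
move=> g y0 yy'; apply: lpn_mono; first exact: good2.
  by move=> F _; exact: lpn_ge0.
move=> F FC; apply: lpn_mono => //; first exact: good1.
by move=> n nF; apply: yy'; apply/flattenP; exists F.
Qed.

Lemma eq_chain_norm sg C y y' : {in flatten C, y =1 y'} ->
  chain_norm sg C y = chain_norm sg C y'.
Proof.
move=> yy'; apply: eq_lpn => F FC; apply: eq_lpn => n nF.
by apply: yy'; apply/flattenP; exists F.
Qed.

Lemma chain_normD sg C y y' : good sg -> (forall n, 0 <= y n) ->
  (forall n, 0 <= y' n) ->
  chain_norm sg C (fun n => y n + y' n) <= chain_norm sg C y + chain_norm sg C y'.
Proof.
move=> g y0 y'0; apply: le_trans (lpn_triangle _ (good2 g) _ _);
  try by move=> t; exact: lpn_ge0.
apply: lpn_mono; first exact: good2.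
  by move=> F _; exact: lpn_ge0.
by move=> F _; apply: lpn_triangle => //; exact: good1.
Qed.

Lemma chain_normZ sg C y (c : R) : good sg -> (forall n, 0 <= y n) -> 0 <= c ->
  chain_norm sg C (fun n => c * y n) = c * chain_norm sg C y.
Proof.
move=> g y0 c0; rewrite /chain_norm -lpn_scale//; [|exact: good2|by move=> t; exact: lpn_ge0].
by apply: eq_lpn => F _; rewrite lpn_scale//; exact: good1.
Qed.

(** Lowering the outer exponent to the inner one enlarges the norm and turns it into an l_s norm
    over all points of the chain. *)
Lemma chain_norm_le_flatten sg C y : good sg -> (forall n, 0 <= y n) ->
  chain_norm sg C y <= lpn sg.1 (flatten C) y.
Proof.
move=> g y0; rewrite (lpn_flatten _ (good1 g))//.
by apply: lpn_antimono; [exact: good1|exact: good12|move=> t; exact: lpn_ge0].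
Qed.

Lemma chain_norm_diag p C y : (1 <= p)%E -> (forall n, 0 <= y n) ->
  chain_norm (p, p) C y = lpn p (flatten C) y.
Proof. by move=> p1 y0; rewrite lpn_flatten. Qed.

Lemma chain_norm_le_sum sg C y : good sg -> (forall n, 0 <= y n) ->
  chain_norm sg C y <= \sum_(n <- flatten C) y n.
Proof.
move=> g y0; apply: le_trans (chain_norm_le_flatten _ g y0) _.
by apply: lpn_le_sum => //; exact: good1.
Qed.

Lemma bnd_mono k sg y y' c : good sg -> (forall n, 0 <= y n) ->
  (forall n, y n <= y' n) -> bnd k sg y' c -> bnd k sg y c.
Proof.
move=> g y0 yy' h C hC; apply: le_trans (h _ hC).
by apply: chain_norm_mono => // n _.
Qed.

Lemma bnd_le k sg y c c' : bnd k sg y c -> c <= c' -> bnd k sg y c'.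
Proof. by move=> h cc' C /h /le_trans; exact. Qed.

Lemma bndD k sg y y' c c' : good sg -> (forall n, 0 <= y n) ->
  (forall n, 0 <= y' n) -> bnd k sg y c -> bnd k sg y' c' ->
  bnd k sg (fun n => y n + y' n) (c + c').
Proof.
move=> g y0 y'0 h h' C hC; apply: le_trans (chain_normD _ g y0 y'0) _.
by rewrite lerD ?h ?h'.
Qed.

Lemma bndZ k sg y (d c : R) : good sg -> (forall n, 0 <= y n) -> 0 <= d ->
  bnd k sg y c -> bnd k sg (fun n => d * y n) (d * c).
Proof. by move=> g y0 d0 h C hC; rewrite chain_normZ// ler_wpM2l// h. Qed.

Lemma bnd0 k sg : good sg -> bnd k sg (fun=> 0) 0.
Proof.
move=> g C _; apply: le_trans (chain_norm_le_sum _ g _) _ => //.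
by rewrite big1.
Qed.

Lemma bnd_sum k sg (T : Type) (r : seq T) (y : T -> nat -> R) (c : T -> R) :
  good sg -> (forall t n, 0 <= y t n) -> (forall t, bnd k sg (y t) (c t)) ->
  bnd k sg (fun n => \sum_(t <- r) y t n) (\sum_(t <- r) c t).
Proof.
move=> g y0 h; elim: r => [|t r IH].
  by rewrite big_nil; refine (bnd_mono g _ _ (bnd0 g)) => n; rewrite ?big_nil.
rewrite big_cons; refine (bnd_mono g _ _ (bndD g _ _ (h t) IH)).
all: by move=> n; rewrite ?sumr_ge0 ?big_cons.
Qed.

Lemma chain_le k k' C : (forall i, (k i <= k' i)%N) -> chain k C -> chain k' C.
Proof.
move=> kk' [h1 h2]; split=> // F FC i iF; apply: leq_trans (h2 _ FC _ iF) _.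
by rewrite ltnS.
Qed.

Lemma subseq_flatten_map (f : seq nat -> seq nat) (q : pred (seq nat)) C :
  (forall F, subseq (f F) F) -> subseq (flatten [seq f F | F <- C & q F]) (flatten C).
Proof.
move=> fF; elim: C => //= F C IH; case: (q F) => /=; first exact: cat_subseq.
exact: subseq_trans IH (suffix_subseq _ _).
Qed.

Lemma chain_sub k (f : seq nat -> seq nat) (q : pred (seq nat)) C :
  (forall F, subseq (f F) F) -> chain k C -> chain k [seq f F | F <- C & q F].
Proof.
move=> fF [h1 h2]; split; first by apply: subseq_pairwise h1; exact: subseq_flatten_map.
move=> _ /mapP[F + ->] i; rewrite mem_filter => /andP[_ FC] /(mem_subseq (fF F)) iF.
by apply: leq_trans (size_subseq (fF F)) _; exact: h2.
Qed.

Lemma chain_subl k (f : seq nat -> seq nat) C :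
  (forall F, subseq (f F) F) -> chain k C -> chain k [seq f F | F <- C].
Proof.
by move=> fF h; have := chain_sub xpredT fF h; rewrite filter_predT.
Qed.

Lemma chain1 k F : pairwise ltn F -> (forall i, i \in F -> (size F <= (k i).+1)%N) ->
  chain k [:: F].
Proof. by move=> h1 h2; split=> [|G]; rewrite /= ?cats0// inE => /eqP ->. Qed.

Lemma chain_mem k C F : chain k C -> F \in C -> chain k [:: F].
Proof.
move=> [h1 h2] FC; apply: chain1; last exact: h2.
apply: subseq_pairwise h1; elim: C FC {h2} => //= G C IH; rewrite inE => /predU1P[->|FC].
  exact: prefix_subseq.
by apply: subseq_trans (IH FC) (suffix_subseq _ _).
Qed.

Lemma flatten_seq1 F : flatten [seq [:: i] | i <- F] = F.
Proof. by elim: F => //= i F ->. Qed.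

Lemma chain_seq1 k F : pairwise ltn F -> chain k [seq [:: i] | i <- F].
Proof.
move=> h; split; first by rewrite flatten_seq1.
by move=> _ /mapP[j _ ->].
Qed.

Lemma pairwise_ltn_iota n K : pairwise ltn (iota n K).
Proof. by rewrite -sorted_pairwise ?iota_ltn_sorted//; exact: ltn_trans. Qed.

Lemma chain_norm_seq1 sg F y : good sg -> (forall n, 0 <= y n) ->
  chain_norm sg [seq [:: i] | i <- F] y = lpn sg.2 F y.
Proof.
move=> g y0; rewrite /chain_norm lpn_map; apply: eq_lpn => i _ /=.
by rewrite lpn_seq1//; exact: good1.
Qed.

Lemma bnd_lpn k sg y c F : good sg -> (forall n, 0 <= y n) -> bnd k sg y c ->
  pairwise ltn F -> lpn sg.2 F y <= c.
Proof.
by move=> g y0 h hF; rewrite -(chain_norm_seq1 _ g)//; apply: h; exact: chain_seq1.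
Qed.

Lemma bnd_term k sg y c n : good sg -> (forall n, 0 <= y n) -> bnd k sg y c ->
  y n <= c.
Proof.
move=> g y0 h; have := bnd_lpn g y0 h (erefl : pairwise ltn [:: n]).
by rewrite lpn_seq1//; exact: good2.
Qed.

(** For equal exponents [chain_norm] only sees the points of the chain and not their grouping, so
    the Schreier condition disappears. *)
Lemma bnd_diag k p y c : (1 <= p)%E -> (forall n, 0 <= y n) ->
  (forall F, pairwise ltn F -> lpn p F y <= c) -> bnd k (p, p) y c.
Proof. by move=> p1 y0 h C [hC _]; rewrite chain_norm_diag//; exact: h. Qed.

(* Moving the support to the right only enlarges the norm. *)
Lemma bnd_spread sg (k : nat -> nat) y a c : good sg -> {homo k : i j / (i < j)%N} ->
  (forall i, 0 <= a i) -> (forall n, 0 <= y n) -> (forall i, a i <= y (k i)) ->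
  bnd id sg y c -> bnd k sg a c.
Proof.
move=> g kinc a0 y0 ay h C [hC1 hC2].
apply: (@le_trans _ _ (chain_norm sg [seq [seq k i | i <- F] | F <- C] y)).
  rewrite /chain_norm lpn_map; apply: lpn_mono; first exact: good2.
    by move=> F _; exact: lpn_ge0.
  move=> F _ /=; rewrite lpn_map; apply: lpn_mono => //; exact: good1.
apply: h; split.
  rewrite -map_flatten pairwise_map; apply: sub_pairwise hC1 => i j; exact: kinc.
by move=> _ /mapP[F FC ->] _ /mapP[i iF ->]; rewrite size_map; exact: hC2.
Qed.

End ChainNorm.

(** * Estimates on successive blocks *)

Section Blocks.
Variables (R : realType) (m b : nat -> nat).
Hypothesis m_homo : {homo m : i j / (i < j)%N}.
Hypothesis m_b : forall n, (m (b n) <= n < m (b n).+1)%N.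
Implicit Types (p s : \bar R) (sg : \bar R * \bar R)
  (C : seq (seq nat)) (F : seq nat) (y a : nat -> R).

Lemma boundary_le i j : (i <= j)%N -> (m i <= m j)%N.
Proof. by rewrite leq_eqVlt => /predU1P[->//|/m_homo/ltnW]. Qed.

Lemma block_eq n i : (m i <= n < m i.+1)%N -> b n = i.
Proof.
move=> /andP[h1 h2]; have /andP[h3 h4] := m_b n.
apply/eqP; rewrite eqn_leq; apply/andP; split; rewrite leqNgt; apply/negP => /boundary_le.
  by move/leq_trans => /(_ _ h3); rewrite leqNgt h2.
by move/leq_trans => /(_ _ h1); rewrite leqNgt h4.
Qed.

Lemma block_homo n n' : (n <= n')%N -> (b n <= b n')%N.
Proof.
move=> nn'; rewrite leqNgt; apply/negP => /boundary_le h.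
have /andP[h3 _] := m_b n; have /andP[_ h4] := m_b n'.
by have := leq_trans (leq_trans h4 (leq_trans h h3)) nn'; rewrite ltnn.
Qed.

(** Members of chains increase, so the head of F is its minimum. The default 0 only occurs for the
    empty list, for which [later] is empty. *)
Let later F := [seq n <- F | b n != b (head 0%N F)].
Let blocks F := undup [seq b n | n <- later F].

Lemma later_cons n F : later (n :: F) = [seq i <- F | b i != b n].
Proof. by rewrite /later /= eqxx. Qed.

Lemma pairwise_ltn_undup (r : seq nat) : pairwise leq r -> pairwise ltn (undup r).
Proof.
elim: r => //= x r IH /andP[/allP h1 h2]; case: ifP => xr; first exact: IH.
rewrite /= IH// andbT; apply/allP => z; rewrite mem_undup => zr.
by rewrite /= ltn_neqAle (h1 _ zr) andbT; apply: contraFneq xr => ->.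
Qed.

(** If G comes after F, the last block of F is at most that of min G, which is not among the later
    blocks of G; so the indices increase strictly along the chain. The later blocks of F number at
    most |F| - 1, as min F lies in none of them, hence at most the position of min F, which precedes
    the start of each. *)
Lemma chain_blocks C : chain id C -> chain m [seq blocks F | F <- C].
Proof.
move=> [h1 h2]; split.
  elim: C h1 {h2} => //= F C IH; rewrite !pairwise_cat => /and3P[/allrelP h1 h2 h3].
  rewrite IH// andbT; apply/andP; split.
    apply/allrelP => i j; rewrite mem_undup => /mapP[n + ->].
    rewrite mem_filter => /andP[_ nF] /flattenP[_ /mapP[G GC ->]].
    rewrite mem_undup => /mapP[n' + ->]; rewrite mem_filter => /andP[bn' n'G].
    case: G GC n'G bn' => // g G GC n'G /= bn'.
    have gn : (n < g)%N by apply: h1 => //; apply/flattenP; exists (g :: G); rewrite ?mem_head.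
    apply: leq_ltn_trans (block_homo (ltnW gn)) _.
    rewrite /= ltn_neqAle eq_sym bn'/= block_homo//.
    move: n'G; rewrite inE => /predU1P[->//|n'G].
    suff : pairwise ltn (g :: G) by move=> /= /andP[/allP /(_ _ n'G) /ltnW].
    apply: subseq_pairwise h3; elim: C GC {IH h1} => //= H C IH.
    rewrite inE => /predU1P[->|GC]; first exact: prefix_subseq.
    by apply: subseq_trans (IH GC) (suffix_subseq _ _).
  apply: pairwise_ltn_undup; rewrite pairwise_map.
  apply: sub_pairwise (pairwise_filter _ h2) => i j /= /ltnW; exact: block_homo.
move=> _ /mapP[F FC ->] i; rewrite mem_undup => /mapP[n + ->].
case: F FC => // f F FC; rewrite {1}later_cons mem_filter => /andP[bn nF].
have sF : (size F <= f)%N by have := h2 _ FC f (mem_head _ _).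
apply: leq_trans (size_undup _) _; rewrite size_map later_cons size_filter.
apply: leq_trans (count_size _ _) _; apply: leq_trans sF _.
have := chain_mem (conj h1 h2 : chain id C) FC => -[] /=.
rewrite cats0 => /andP[/allP /(_ _ nF) fn _] _.
have bf : (b f < b n)%N by rewrite ltn_neqAle eq_sym bn block_homo// ltnW.
have /andP[_ /ltnW] := m_b f; move=> /leq_trans; apply.
exact: leqW (boundary_le bf).
Qed.

(* Every member F of the chain is cut into its part in the block of min F, which
   is estimated by a, and the rest. As F is a Schreier set, it has at most m i
   elements if it meets a block i later than that of min F, so that the indices
   of these later blocks form a chain for m. *)
Lemma block_decomposition sg y a a' C : good sg -> (forall n, 0 <= y n) ->
  (forall n, 0 <= a n) -> (forall n, 0 <= a' n) ->
  (forall i C', chain id C' -> {in flatten C', forall n, b n = i} ->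
     chain_norm sg C' y <= a i) ->
  (forall i F, chain id [:: F] -> {in F, forall n, b n = i} -> (size F <= m i)%N ->
     lpn sg.1 F y <= a' i) ->
  chain id C ->
  exists K C', chain m C' /\
    chain_norm sg C y <= lpn sg.2 (iota 0 K) a + chain_norm sg C' a'.
Proof.
move=> g y0 a0 a'0 h1 h2 hC.
pose K := (\max_(F <- C) b (head 0%N F)).+1.
exists K, [seq blocks F | F <- C]; split; first exact: chain_blocks.
pose early F := [seq n <- F | b n == b (head 0%N F)].
have e1 : chain_norm sg C y <= lpn sg.2 C (fun F => lpn sg.1 (early F) y) +
    lpn sg.2 C (fun F => lpn sg.1 (later F) y).
  apply: le_trans (lpn_triangle _ (good2 g) _ _);
    [|by move=> ?; exact: lpn_ge0|by move=> ?; exact: lpn_ge0].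
  apply: lpn_mono; first exact: good2.
    by move=> ? _; exact: lpn_ge0.
  by move=> F _; apply: lpn_split => //; exact: good1.
apply: le_trans e1 _; apply: lerD.
  (* The early parts of the members with minimum in block i form a chain inside that block, of norm
     at most [a i]. *)
  rewrite (@lpn_partition _ _ _ nat (fun F => b (head 0%N F)) (iota 0 K)).
  - apply: lpn_mono; first exact: good2.
      by move=> ? _; exact: lpn_ge0.
    move=> i _; rewrite -(lpn_map _ early [seq t <- C | b (head 0%N t) == i] (fun F => lpn sg.1 F y)).
    apply: h1; first by apply: chain_sub => // F; exact: filter_subseq.
    move=> n /flattenP[_ /mapP[F + ->]].
    by rewrite !mem_filter => /andP[/eqP <- FC] /andP[/eqP].
  - exact: good2.
  - by move=> F; exact: lpn_ge0.
  - exact: iota_uniq.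
  - move=> F FC; rewrite mem_iota add0n leq0n/= ltnS.
    exact: (@leq_bigmax_seq _ _ xpredT (fun F => b (head 0%N F)) F).
rewrite /chain_norm lpn_map; apply: lpn_mono; first exact: good2.
  by move=> ? _; exact: lpn_ge0.
move=> F FC /=.
(* The later part of F is cut along blocks. Each piece misses min F, so a piece in block i has at
   most m i points. *)
rewrite (@lpn_partition _ _ _ nat b (blocks F))//.
- apply: lpn_mono; first exact: good1.
    by move=> ? _; exact: lpn_ge0.
  move=> i iF; apply: h2.
  + have := chain_mem hC FC; have -> : [:: [seq t <- later F | b t == i]] =
      [seq [seq t <- later F | b t == i] | F <- [:: F]] by [].
    move=> [c1 c2]; apply: chain1.
      rewrite /= cats0 in c1.
      by do 2 apply: pairwise_filter.
    move=> n; rewrite !mem_filter => /andP[_ /andP[_ nF]].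
    apply: leq_trans (c2 F (mem_head _ _) _ nF).
    by rewrite -filter_predI size_filter count_size.
  + by move=> n; rewrite mem_filter => /andP[/eqP].
  + move: iF; rewrite mem_undup => /mapP[n nF ->]; case: F FC nF => // f F FC.
    rewrite later_cons mem_filter => /andP[bn nF].
    rewrite -filter_predI size_filter; apply: leq_trans (count_size _ _) _.
    have sF : (size F <= f)%N by case: hC => _ /(_ _ FC f (mem_head _ _)).
    apply: leq_trans sF _.
    have := chain_mem hC FC => -[] /=.
    rewrite cats0 => /andP[/allP /(_ _ nF) fn _] _.
    have bf : (b f < b n)%N by rewrite ltn_neqAle eq_sym bn block_homo// ltnW.
    have /andP[_ /ltnW] := m_b f; move=> /leq_trans; apply.
    exact: boundary_le bf.
- exact: good1.
- exact: undup_uniq.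
- by move=> n nF; rewrite mem_undup map_f.
Qed.

(** Here a' = a in [block_decomposition], and c bounds both parts: the first because singletons form
    a chain, the second because the later blocks do. *)
Lemma bnd_block_steep sg y a c : good sg -> (forall n, 0 <= y n) ->
  (forall n, 0 <= a n) ->
  (forall i C', chain id C' -> {in flatten C', forall n, b n = i} ->
     chain_norm sg C' y <= a i) ->
  bnd m sg a c -> bnd id sg y (c + c).
Proof.
move=> g y0 a0 h1 hc C hC.
have [|K [C' [hC' h]]] := block_decomposition g y0 a0 a0 h1 _ hC.
  move=> i F hF bF _; have := h1 i _ hF.
  rewrite /chain_norm lpn_seq1 ?lpn_ge0//; last exact: good2.
  by apply; rewrite /= cats0.
apply: le_trans h _; apply: lerD; last exact: hc.
by apply: (bnd_lpn g a0 hc); exact: pairwise_ltn_iota.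
Qed.

(** Flatness removes the inner exponent: the piece of a Schreier set in a later block i has at most
    m i points, each of size at most a' i / m i, so it contributes at most a' i. For summable a'
    only the l_p norm of the block norms remains. *)
Lemma bnd_block_flat sg y a a' (c c' : R) : good sg -> (forall n, 0 <= y n) ->
  (forall n, 0 <= a n) -> (forall n, 0 <= a' n) ->
  (forall i C', chain id C' -> {in flatten C', forall n, b n = i} ->
     chain_norm sg C' y <= a i) ->
  (forall n, (m (b n))%:R * y n <= a' (b n)) ->
  (forall K, lpn sg.2 (iota 0 K) a <= c) ->
  (forall K, \sum_(i <- iota 0 K) a' i <= c') ->
  bnd id sg y (c + c').
Proof.
move=> g y0 a0 a'0 h1 h2 hc hc' C hC.
have [|K [C' [[hC' _] h]]] := block_decomposition g y0 a0 a'0 h1 _ hC.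
  move=> i F _ bF sF; apply: le_trans (lpn_le_sum _ (good1 g) y0) _.
  have [F0|F0] := eqVneq F [::]; first by rewrite F0 big_nil a'0.
  have m0 : (0 < m i)%N by apply: leq_trans sF; case: (F) F0.
  have yF n : n \in F -> y n <= a' i / (m i)%:R.
    by move=> nF; rewrite ler_pdivlMr ?ltr0n// mulrC -(bF n nF).
  apply: (@le_trans _ _ (\sum_(n <- F) a' i / (m i)%:R)).
    by rewrite big_seq [leRHS]big_seq; apply: ler_sum => n /yF.
  rewrite big_const_seq count_predT iter_addr addr0 -[leLHS]mulr_natr.
  rewrite mulrAC ler_pdivrMr ?ltr0n//.
  by rewrite ler_wpM2l// ler_nat.
apply: le_trans h _; apply: lerD => //.
apply: le_trans (chain_norm_le_sum _ g a'0) _.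
apply: le_trans (hc' (\max_(n <- flatten C') n).+1).
apply: ler_sum_subset => //.
  by apply: (@pairwise_uniq _ ltn) => //; exact: ltnn.
move=> n nC; rewrite mem_iota add0n leq0n/= ltnS.
exact: (@leq_bigmax_seq _ _ xpredT id n).
Qed.

(** Chains inside successive blocks concatenate to a single chain, over which the outer exponent
    combines their norms. *)
Lemma lpn_block_lower sg y (d : nat -> R) c (Cs : nat -> seq (seq nat)) K :
  good sg -> (forall n, 0 <= y n) -> (forall n, 0 <= d n) -> bnd id sg y c ->
  (forall i, chain id (Cs i)) ->
  (forall i, {in flatten (Cs i), forall n, b n = i}) ->
  (forall i, (i < K)%N -> d i <= chain_norm sg (Cs i) y) ->
  lpn sg.2 (iota 0 K) d <= c.
Proof.
move=> g y0 d0 hy hC bC hd.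
have : chain id (flatten [seq Cs i | i <- iota 0 K]).
  split.
    elim: (iota 0 K) (pairwise_ltn_iota 0 K) => //= i r IH /andP[/allP ir /IH {}IH].
    rewrite flatten_cat pairwise_cat IH (hC i).1 !andbT.
    apply/allrelP => n n' nC /flattenP[F /flattenP[_ /mapP[j jr ->] FC] n'F].
    have n'C : n' \in flatten (Cs j) by apply/flattenP; exists F.
    rewrite /= ltnNge; apply/negP => /block_homo; rewrite (bC _ _ nC) (bC _ _ n'C).
    by move=> ji; have := ir _ jr; rewrite /= ltnNge ji.
  by move=> F /flattenP[_ /mapP[j jr ->] FC]; exact: (hC j).2.
move=> /hy; apply: le_trans.
rewrite /chain_norm lpn_flatten; [|exact: good2|by move=> ?; exact: lpn_ge0].
rewrite lpn_map; apply: lpn_mono; [exact: good2|by []|].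
by move=> i; rewrite mem_iota => /andP[_ iK]; exact: hd.
Qed.

End Blocks.

Lemma block_index (m : nat -> nat) : m 0%N = 0%N -> {homo m : i j / (i < j)%N} ->
  exists b, forall n, (m (b n) <= n < m (b n).+1)%N.
Proof.
move=> m0 mh; suff /choice[b hb] n : exists i, (m i <= n < m i.+1)%N by exists b.
have im i : (i <= m i)%N by elim: i => // i IH; exact: leq_ltn_trans IH (mh _ _ (ltnSn i)).
have ex0 : exists i, (m i <= n)%N by exists 0%N; rewrite m0.
have [i h1 h2] := ex_maxnP ex0 (fun i => leq_trans (im i)).
exists i; rewrite h1/= ltnNge; apply/negP => /h2; by rewrite ltnn.
Qed.

(** * Comparison of types *)

Section Comparison.
Variable R : realType.
Implicit Types (p s : \bar R) (sg mu tau : \bar R * \bar R)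
  (C : seq (seq nat)) (F : seq nat) (y a : nat -> R).

Lemma powR_unbounded (d M : R) : 0 < d -> exists2 K : nat, (0 < K)%N & M < K%:R `^ d.
Proof.
move=> d0; pose x := (`|M| + 1) `^ d^-1.
have x0 : 0 <= x by exact: powR_ge0.
exists (Num.bound x); first by rewrite -(ltr_nat R) (le_lt_trans x0)// archi_boundP.
apply: (@lt_le_trans _ _ (`|M| + 1)).
  by apply: le_lt_trans (ler_norm _) _; rewrite ltrDl.
have -> : `|M| + 1 = x `^ d.
  by rewrite /x -powRrM mulVf ?gt_eqF// powRr1// addr_ge0.
apply: ge0_ler_powR; [exact: ltW|by rewrite nnegrE|by rewrite nnegrE|].
exact: ltW (archi_boundP x0).
Qed.

Lemma sum_const (W : nmodType) (T : Type) (r : seq T) (x : W) : \sum_(t <- r) x = x *+ size r.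
Proof. by rewrite big_const_seq count_predT iter_addr addr0. Qed.

Lemma exists_powR_lt (d M e : R) : 0 < d -> 0 <= M -> 0 < e ->
  exists2 h, 0 < h & h `^ d * M <= e.
Proof.
move=> d0 M0 e0; exists ((e / (M + 1)) `^ d^-1).
  by apply: powR_gt0; rewrite divr_gt0// ltr_wpDl.
rewrite -powRrM mulVf ?gt_eqF// powRr1; last first.
  by rewrite divr_ge0 ?ltW// ltr_wpDl.
rewrite mulrAC ler_pdivrMr ?ltr_wpDl//.
by rewrite ler_wpM2l ?(ltW e0)// lerDl.
Qed.

Lemma nth_pairwise_ltn l F i : pairwise ltn F -> {in F, forall n, l <= n}%N ->
  (i < size F)%N -> (l + i <= nth 0%N F i)%N.
Proof.
elim: F l i => // n F IH l [|i] /= /andP[/allP nF hF] lF iF.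
  by rewrite addn0 lF ?mem_head.
rewrite addnS -addSn; apply: IH => // n' /nF; apply: leq_ltn_trans.
by rewrite lF ?mem_head.
Qed.

Lemma mem_drop_half F n : pairwise ltn F -> n \in drop (size F)./2 F ->
  ((size F)./2 <= n)%N.
Proof.
move=> hF nF; move: nF (nF); rewrite -{1}index_mem size_drop => iF /(nth_index 0%N) <-.
move: iF; move: (index _ _) => i iF; rewrite nth_drop.
have := @nth_pairwise_ltn 0 F ((size F)./2 + i)%N hF (fun _ _ => leq0n _).
rewrite add0n => h; apply: leq_trans (leq_addr i _) (h _).
by move: iF; rewrite ltn_subRL.
Qed.

(* The upper half of a finite set of positions is a Schreier set. *)
Lemma bnd_weak k sg (q : R) a (c t : R) F : good sg -> sg.1 = q%:E -> 1 <= q ->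
  (forall i, (i <= k i)%N) ->
  (forall n, 0 <= a n) -> bnd k sg a c -> pairwise ltn F -> 0 <= t ->
  {in F, forall n, t <= a n} -> (size F)%:R * t `^ q <= 2 * c `^ q.
Proof.
move=> g sq q1 kk a0 hc hF t0 ta; have c0 := bnd_ge0 hc.
have q0 : 0 <= q by rewrite (le_trans _ q1).
pose F' := drop (size F)./2 F.
have F'F : {subset F' <= F} by move=> n; exact: mem_drop.
have hF' : chain k [:: F'].
  apply: chain1; first by apply: subseq_pairwise hF; exact: drop_subseq.
  move=> n nF'; have := mem_drop_half hF nF'; have := kk n.
  by rewrite size_drop; lia.
have := hc _ hF'; rewrite /chain_norm lpn_seq1 ?lpn_ge0//; last exact: good2.
rewrite sq => hF'c.
have : (size F')%:R * t `^ q <= c `^ q.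
  apply: (@le_trans _ _ (lpn q%:E F' a `^ q)); last first.
    by apply: ge0_ler_powR; rewrite ?nnegrE ?lpn_ge0.
  rewrite lpn_fin// mulr_natl -sum_const.
  rewrite [leLHS]big_seq [leRHS]big_seq; apply: ler_sum => n nF'.
  by apply: ge0_ler_powR; rewrite ?nnegrE ?ta ?F'F.
have : (size F <= 2 * size F')%N by rewrite size_drop; lia.
rewrite -(ler_nat R) natrM => h1 h2.
apply: (@le_trans _ _ (2 * ((size F')%:R * t `^ q))); last by rewrite ler_wpM2l.
by rewrite mulrA ler_wpM2r ?powR_ge0.
Qed.

(* The weak l_q norm dominates the l_r norm for q < r. *)
Lemma dyadic_sum (q r : R) : 1 <= q -> q < r -> exists2 D, 0 <= D &
  forall F a (c : R), (forall n, 0 <= a n) -> 0 <= c ->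
  (forall t, 0 <= t -> (size [seq n <- F | t <= a n])%:R * t `^ q <= 2 * c `^ q) ->
  \sum_(n <- F) a n `^ r <= D * c `^ r.
Proof.
move=> q1 qr; have q0 : 0 < q by exact: lt_le_trans q1.
have r0 : 0 < r by exact: lt_trans qr.
have d0 : 0 < r - q by rewrite subr_gt0.
pose rho : R := (2^-1) `^ (r - q).
have rho0 : 0 < rho by apply: powR_gt0; rewrite invr_gt0.
have rho1 : rho < 1.
  have <- : (1 : R) `^ (r - q) = 1 by rewrite powR1.
  by apply: gt0_ltr_powR => //; rewrite ?nnegrE ?invr_ge0// invf_lt1// ltr1n.
(* The factors come from t l = 2 t (l + 1), from the weak estimate at t (l + 1), and from t l = 2 c
   / 2^l raised to r - q; rho is the ratio of the resulting geometric series. *)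
pose A : R := 2 `^ q * 2 * 2 `^ (r - q).
have A0 : 0 <= A by rewrite !mulr_ge0 ?powR_ge0.
exists (A / (1 - rho)) => [|F a c a0 c0 h]; first by rewrite divr_ge0// subr_ge0 ltW.
pose t (l : nat) : R := 2 * c * 2^-1 ^+ l.
have t0 l : 0 <= t l by rewrite !mulr_ge0// exprn_ge0// invr_ge0.
have tS l : t l = 2 * t l.+1 by rewrite /t exprS; lra.
have level l : (size [seq n <- F | t l.+1 <= a n])%:R * t l `^ r <= A * c `^ r * rho ^+ l.
  have [c00|cn0] := eqVneq c 0.
    rewrite /t c00 !(mulr0, mul0r) powR0 ?gt_eqF//.
    by rewrite !(mulr0, mul0r).
  have c_gt0 : 0 < c by rewrite lt_def cn0.
  have tl_gt0 : 0 < t l by rewrite !mulr_gt0// exprn_gt0// invr_gt0.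
  have -> : t l `^ r = t l `^ q * t l `^ (r - q).
    by rewrite -powRD ?(gt_eqF tl_gt0) ?implybT// addrC subrK.
  have -> : c `^ r = c `^ q * c `^ (r - q).
    by rewrite -powRD ?cn0 ?implybT// addrC subrK.
  have -> : t l `^ (r - q) = 2 `^ (r - q) * c `^ (r - q) * rho ^+ l.
    rewrite /t !powRM ?mulr_ge0 ?exprn_ge0 ?invr_ge0//.
    have h0 : 0 <= 2^-1 :> R by rewrite invr_ge0.
    congr (_ * _); rewrite /rho -(powR_mulrn _ h0) -(powR_mulrn _ (powR_ge0 _ _)).
    by rewrite powRAC.
  have -> : t l `^ q = 2 `^ q * t l.+1 `^ q by rewrite tS powRM.
  have := h _ (t0 l.+1); set N := (size _)%:R; set u := t l.+1 `^ q => hN.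
  rewrite /A; set v := c `^ (r - q); set w := c `^ q; set x := 2 `^ (r - q).
  have : 0 <= 2 `^ q * x * v * rho ^+ l.
    by rewrite !mulr_ge0 ?powR_ge0// exprn_ge0// ltW.
  move: hN; rewrite -/w; set z := 2 `^ q => hN zx.
  have := ler_wpM2l zx hN; lra.
pose S l := \sum_(n <- F | t l < a n) a n `^ r.
have SS l : S l.+1 <= S l + A * c `^ r * rho ^+ l.
  apply: le_trans (lerD (lexx _) (level l)).
  rewrite mulr_natl -sum_const big_filter /S !(big_mkcond (fun n => _ < a n)).
  rewrite (big_mkcond (fun n => _ <= a n)) -big_split/=.
  apply: ler_sum => n _; case: ifP => [h1|_]; last first.
    by case: ifP => _; case: ifP => _; rewrite ?addr0 ?add0r ?addr_ge0 ?powR_ge0.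
  rewrite (ltW h1); case: ifP => [_|/negbT]; first by rewrite lerDl powR_ge0.
  rewrite -leNgt add0r => h2; apply: ge0_ler_powR => //; first exact: ltW.
    by rewrite nnegrE.
  by rewrite nnegrE.
(* No term exceeds t 0 = 2 c: the weak estimate at the height of that term gives a^q <= 2 c^q <= (2
   c)^q. *)
have S0 : S 0%N = 0.
  rewrite /S big_seq_cond big1// => n /andP[nF].
  rewrite /t expr0 mulr1 => cn; exfalso.
  have : 1 * a n `^ q <= 2 * c `^ q.
    apply: le_trans (h _ (a0 n)); rewrite ler_wpM2r ?powR_ge0// ler1n.
    by rewrite size_filter -has_count; apply/hasP; exists n.
  rewrite mul1r leNgt => /negP; apply.
  apply: (@le_lt_trans _ _ ((2 * c) `^ q)).
    by rewrite powRM// ler_wpM2r ?powR_ge0// le1r_powR// ler1n.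
  by apply: gt0_ltr_powR; rewrite ?nnegrE// mulr_ge0.
have Sl l : S l * (1 - rho) <= A * c `^ r * (1 - rho ^+ l).
  elim: l => [|l IH]; first by rewrite S0 mul0r expr0 subrr mulr0.
  have rho1' : 0 <= 1 - rho by rewrite subr_ge0 ltW.
  have := ler_wpM2r rho1' (SS l); rewrite exprS; lra.
(* F is finite, so its non-zero terms all exceed one of the levels. *)
have [l hl] : exists l, {in F, forall n, a n = 0 \/ t l < a n}.
  elim: (F) => [|n F' [l IH]]; first by exists 0%N.
  have tmono l1 l2 : (l1 <= l2)%N -> t l2 <= t l1.
    move=> l12; rewrite /t ler_wpM2l ?mulr_ge0//.
    by apply: ler_wiXn2l => //; rewrite invf_le1// ler1n.
  have [an0|an0] := eqVneq (a n) 0.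
    by exists l => n'; rewrite inE => /predU1P[->|/IH//]; left.
  have an_gt0 : 0 < a n by rewrite lt_def an0 a0.
  pose l' := Num.bound (2 * c / a n).
  have hl' : t l' < a n.
    rewrite /t exprVn ltr_pdivrMr ?exprn_gt0// [ltRHS]mulrC -ltr_pdivrMr//.
    apply: (@lt_le_trans _ _ l'%:R).
      have y0 : 0 <= 2 * c / a n by rewrite divr_ge0 ?mulr_ge0.
      exact: (archi_boundP y0).
    by rewrite -natrX ler_nat ltnW// ltn_expl.
  exists (maxn l l') => n'; rewrite inE => /predU1P[->|/IH[?|h2]]; [right|by left|right].
    by apply: le_lt_trans hl'; apply: tmono; exact: leq_maxr.
  by apply: le_lt_trans h2; apply: tmono; exact: leq_maxl.
have -> : \sum_(n <- F) a n `^ r = S l.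
  rewrite /S [RHS]big_mkcond big_seq [RHS]big_seq; apply: eq_bigr => n nF.
  by case: (hl _ nF) => [->|->]//; rewrite powR0 ?gt_eqF//; case: ifP.
rewrite mulrAC ler_pdivlMr ?subr_gt0//; apply: le_trans (Sl l) _.
by rewrite -[leRHS]mulr1 ler_wpM2l ?mulr_ge0 ?powR_ge0// gerBl exprn_ge0// ltW.
Qed.

Lemma lex_le_cases mu tau :
  (mu <= tau :> (\bar R *l \bar R)%type)%O ->
  (mu.1 = tau.1 /\ (mu.2 <= tau.2)%E) \/ (mu.1 < tau.1)%E.
Proof.
case: mu tau => [s p] [s' p']; rewrite leEprodlexi /= => /andP[].
rewrite le_eqVlt => /predU1P[->|]; last by right.
by rewrite lexx/= => pp; left.
Qed.

Lemma lex_lt_cases mu tau :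
  (mu < tau :> (\bar R *l \bar R)%type)%O ->
  (mu.1 = tau.1 /\ (mu.2 < tau.2)%E) \/ (mu.1 < tau.1)%E.
Proof.
case: mu tau => [s p] [s' p']; rewrite ltEprodlexi /= => /andP[].
rewrite le_eqVlt => /predU1P[->|]; last by right.
by rewrite lexx/= => pp; left.
Qed.

Lemma chain_norm_sum_le tau C a (r e : R) : good tau -> tau.1 = r%:E ->
  (forall n, 0 <= a n) -> 0 <= e ->
  \sum_(n <- flatten C) a n `^ r <= e `^ r -> chain_norm tau C a <= e.
Proof.
move=> g tr a0 e0 h; apply: le_trans (chain_norm_le_flatten _ g a0) _.
have := good1 g; rewrite tr lee_fin => r1.
by rewrite /= le_root_powR// powR_sum_ge0.
Qed.

Lemma chain_norm_sup_le tau C a (e : R) : good tau -> tau.1 = +oo%E ->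
  (forall n, 0 <= a n) -> 0 <= e ->
  (forall n, a n <= e) -> chain_norm tau C a <= e.
Proof.
move=> g tr a0 e0 h; apply: le_trans (chain_norm_le_flatten _ g a0) _.
by rewrite tr /=; apply: bigmax_le.
Qed.

Lemma bnd_dyadic mu (q r : R) : good mu -> mu.1 = q%:E -> q < r ->
  exists2 D, 0 <= D & forall k a c F, (forall i, (i <= k i)%N) ->
  (forall n, 0 <= a n) -> bnd k mu a c -> pairwise ltn F ->
  \sum_(n <- F) a n `^ r <= D * c `^ r.
Proof.
move=> g mq qr; have q1 : 1 <= q by have := good1 g; rewrite mq lee_fin.
have [D D0 hD] := dyadic_sum q1 qr; exists D => // k a c F kk a0 hc hF.
apply: hD => //; first exact: bnd_ge0 hc.
move=> t t0; apply: (bnd_weak g mq q1 kk a0 hc) => //; first exact: pairwise_filter.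
by move=> n; rewrite mem_filter => /andP[].
Qed.

Lemma bnd_inclusion mu tau : good mu -> good tau ->
  (mu <= tau :> (\bar R *l \bar R)%type)%O ->
  exists2 D, 0 < D & forall k a c, (forall i, (i <= k i)%N) ->
  (forall n, 0 <= a n) -> bnd k mu a c -> bnd k tau a (D * c).
Proof.
move=> gm gt /lex_le_cases[[e1 e2]|].
  exists 1 => // k a c kk a0 hc C hC; rewrite mul1r; apply: le_trans (hc _ hC).
  rewrite /chain_norm -e1; apply: lpn_antimono => //; first exact: good2.
  by move=> F; exact: lpn_ge0.
case me: (mu.1) (good1 gm) => [q| |]// q1; last by rewrite ltNge leey.
case/exponentP: (good1 gt) => [[r r1 te]|te] => [|_].
  rewrite te lte_fin => qr; have [D D0 hD] := bnd_dyadic gm me qr.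
  exists (D `^ r^-1 + 1) => [|k a c kk a0 hc C [hC1 hC2]].
    by rewrite ltr_wpDl// powR_ge0.
  have c0 := bnd_ge0 hc.
  apply: (@chain_norm_sum_le _ _ _ r) => //; first by rewrite mulr_ge0// addr_ge0 ?powR_ge0.
  apply: le_trans (hD _ _ _ _ kk a0 hc hC1) _.
  rewrite powRM ?addr_ge0 ?powR_ge0// ler_wpM2r ?powR_ge0//.
  by rewrite -le_root_powR ?addr_ge0 ?powR_ge0// lerDl.
exists 1 => // k a c kk a0 hc C hC; rewrite mul1r.
apply: chain_norm_sup_le => //; first exact: bnd_ge0 hc.
by move=> n; exact: bnd_term hc.
Qed.

(** For q < v < r the sum of a^r is at most h^(r - v) times the sum of a^v, which the weak l_q norm
    controls as q < v. One cannot take v = q, since the chain norm does not in general bound the l_q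
    norm. *)
Lemma bnd_flat_small mu tau (c e : R) : good mu -> good tau -> (mu.1 < tau.1)%E ->
  0 < e -> exists2 h, 0 < h & forall a,
  (forall n, 0 <= a n) -> bnd id mu a c -> (forall n, a n <= h) -> bnd id tau a e.
Proof.
move=> gm gt + e0.
case me: (mu.1) (good1 gm) => [q| |]// q1; last by rewrite ltNge leey.
case/exponentP: (good1 gt) => [[r r1 te]|te] => [|_]; last first.
  exists e => // a a0 hc ae C hC; apply: chain_norm_sup_le => //; exact: ltW.
rewrite te lte_fin => qr.
pose v := (q + r) / 2; have qv : q < v by rewrite /v; lra.
have vr : 0 < r - v by rewrite /v; lra.
have [D D0 hD] := bnd_dyadic gm me qv.
have [h h0 hh] := exists_powR_lt vr (mulr_ge0 D0 (powR_ge0 c v)) (powR_gt0 r e0).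
exists h => // a a0 hc ah C [hC1 hC2].
apply: (@chain_norm_sum_le _ _ _ r) => //; first exact: ltW.
apply: le_trans hh; apply: le_trans (ler_wpM2l (powR_ge0 _ _) (hD _ _ _ _ (fun=> leqnn _) a0 hc hC1)).
rewrite mulr_sumr; apply: ler_sum => n _.
have [->|an0] := eqVneq (a n) 0.
  by rewrite powR0 ?mulr_ge0 ?powR_ge0// gt_eqF// (lt_le_trans ltr01).
rewrite -{1}(subrK v r) powRD ?an0 ?implybT// ler_wpM2r ?powR_ge0//.
by apply: ge0_ler_powR; rewrite ?nnegrE ?(ltW vr) ?(ltW h0).
Qed.

Definition from (n : nat) y (i : nat) : R := if (n <= i)%N then y i else 0.

Lemma from_ge0 n y : (forall i, 0 <= y i) -> forall i, 0 <= from n y i.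
Proof. by move=> y0 i; rewrite /from; case: ifP. Qed.

(** Otherwise there are chains of norm at least e arbitrarily far out, and K successive ones give e
    K^(1/p) <= c for every K. For p = +oo this argument breaks down; there, vanishing tails single
    out the closure of [c00]. *)
Lemma bnd_tail sg y c : good sg -> (sg.2 < +oo)%E -> (forall n, 0 <= y n) ->
  bnd id sg y c -> forall e, 0 < e -> exists n, bnd id sg (from n y) e.
Proof.
move=> g p_fin y0 hc e e0; apply: contrapT => /forallNP no.
have /choice[f hf] n : exists C, [/\ chain id C, {in flatten C, forall i, (n <= i)%N} &
    e <= chain_norm sg C y].
  have /existsNP[C /not_implyP[hC /negP]] := no n; rewrite -ltNge => h.
  exists [seq [seq i <- F | (n <= i)%N] | F <- C]; split.
  - by apply: chain_subl => // F; exact: filter_subseq.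
  - by move=> i; rewrite -filter_flatten mem_filter => /andP[].
  - apply: le_trans (ltW h) _; rewrite /chain_norm lpn_map.
    apply: lpn_mono; [exact: good2|by move=> ? _; exact: lpn_ge0|].
    move=> F FC /=; rewrite -(@lpn_filter0 _ _ _ (fun i => n <= i)%N F); first last.
    + exact: from_ge0.
    + by move=> i _ /negbTE; rewrite /from => ->.
    + exact: good1.
    apply: lpn_mono; [exact: good1|by move=> ? _; exact: from_ge0|].
    by move=> i; rewrite mem_filter /from => /andP[->].
pose next n := (maxn n (\max_(i <- flatten (f n)) i)).+1.
pose m i := iter i next 0%N.
have mS i : m i.+1 = next (m i) by [].
have m_homo : {homo m : i j / (i < j)%N}.
  have mlt i : (m i < m i.+1)%N by rewrite mS ltnS leq_maxl.
  by apply: homo_ltn => //; exact: ltn_trans.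
have [b hb] := block_index (erefl : m 0%N = 0%N) m_homo.
have low K : lpn sg.2 (iota 0 K) (fun=> e) <= c.
  apply: (@lpn_block_lower _ m b m_homo hb sg y (fun=> e) c (fun i => f (m i))) => //.
  - by move=> n; exact: ltW.
  - by move=> i; case: (hf (m i)).
  - move=> i n nf; apply: (block_eq m_homo hb); case: (hf (m i)) => _ /(_ _ nf) -> _.
    rewrite mS ltnS leq_max; apply/orP; right.
    exact: (@leq_bigmax_seq _ _ xpredT id n).
  - by move=> i _; case: (hf (m i)).
have [[p p1 pe]|pe] := exponentP (good2 g); last by rewrite pe ltxx in p_fin.
have p0 : 0 < p^-1 by rewrite invr_gt0 (lt_le_trans ltr01).
have [K K0 hK] := powR_unbounded (c / e) p0.
have := low K; rewrite lpn_const ?(ltW e0)//; [|exact: good2|by case: K K0 {hK}].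
by rewrite size_iota pe /= leNgt -ltr_pdivrMr// hK.
Qed.

Lemma norm_attained k sg y c : bnd k sg y c -> exists r,
  bnd k sg y r /\ forall c', bnd k sg y c' -> r <= c'.
Proof.
move=> hc; pose A := [set chain_norm sg C y | C in [set C | chain k C]].
have A0 : A !=set0 by exists (chain_norm sg [::] y), [::] => //; exact: chain_nil.
have hA : has_sup A by split=> //; exists c => _ [C hC <-]; exact: hc.
exists (sup A); split=> [C hC|c' hc'].
  by apply: (sup_upper_bound hA); exists C.
by apply: ge_sup => // _ [C hC <-]; exact: hc'.
Qed.

End Comparison.

(** * Sums of nearly disjoint blocks *)

Section ScalarSequences.
Variables (R : realType) (s : scalar_kind).
Local Notation K := (scalars R s).
Local Notation sseq := (scalar_seq R s).
Implicit Types (x : sseq) (sg mu tau : \bar R * \bar R).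

Definition amp x : nat -> R := fun n => modulus (x n).

Lemma amp_ge0 x n : 0 <= amp x n.
Proof. exact: modulus_ge0. Qed.

Lemma modulusN (a : K) : modulus (- a) = modulus a.
Proof. by rewrite /modulus normrN. Qed.

Lemma modulus1 : modulus (1 : K) = 1.
Proof. by rewrite /modulus normr1 (_ : 1 = of_real s 1) ?of_realK//; case: (s). Qed.

Lemma modulus_of_real (r : R) : 0 <= r -> modulus (of_real s r) = r.
Proof.
move=> r0; apply: (can_inj (@of_realK R s)); rewrite of_real_modulus ger0_norm//.
by rewrite -(of_real0 R s) ler_of_real.
Qed.

Lemma modulusB_le (a b : K) : modulus a <= modulus (a + b) + modulus b.
Proof. by rewrite -{1}(addrK b a) -(modulusN b); exact: modulusD. Qed.

Lemma modulus_sum (T : Type) (r : seq T) (f : T -> K) :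
  modulus (\sum_(t <- r) f t) <= \sum_(t <- r) modulus (f t).
Proof.
elim/big_rec2: _ => [|t u v _ h]; first by rewrite modulus0.
by apply: le_trans (modulusD _ _) _; rewrite lerD2l.
Qed.

Lemma amp0 n : amp 0 n = 0.
Proof. exact: modulus0. Qed.

Lemma ampD x x' n : amp (x + x') n <= amp x n + amp x' n.
Proof. exact: modulusD. Qed.

Lemma ampZ a x n : amp (a *: x) n = modulus a * amp x n.
Proof. exact: modulusM. Qed.

Lemma ampN x n : amp (- x) n = amp x n.
Proof. exact: modulusN. Qed.

Lemma sum_scalar_seqE (T : Type) (r : seq T) (f : T -> sseq) n :
  (\sum_(t <- r) f t) n = \sum_(t <- r) f t n.
Proof. by elim/big_rec2: _ => // t u v _ <-. Qed.

Lemma bnd_ampD sg x x' c c' : good sg -> bnd id sg (amp x) c -> bnd id sg (amp x') c' ->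
  bnd id sg (amp (x + x')) (c + c').
Proof.
move=> g h h'; refine (bnd_mono g _ _ (bndD g _ _ h h')) => n; try exact: amp_ge0.
exact: ampD.
Qed.

Lemma bnd_ampZ sg a x c : good sg -> bnd id sg (amp x) c ->
  bnd id sg (amp (a *: x)) (modulus a * c).
Proof.
move=> g h; refine (bnd_mono g _ _ (bndZ g _ (modulus_ge0 a) h)) => n; try exact: amp_ge0.
by rewrite ampZ.
Qed.

Lemma bnd_ampN sg x c : good sg -> bnd id sg (amp x) c -> bnd id sg (amp (- x)) c.
Proof.
move=> g; apply: bnd_mono => //; first exact: amp_ge0.
by move=> n; rewrite ampN.
Qed.

Lemma bnd_amp0 sg : good sg -> bnd id sg (amp 0) 0.
Proof.
move=> g; refine (bnd_mono g _ _ (bnd0 g)) => n; first exact: amp_ge0.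
by rewrite amp0.
Qed.

End ScalarSequences.

Section NearBlocks.
Variables (R : realType) (s : scalar_kind) (sg : \bar R * \bar R).
Local Notation K := (scalars R s).
Local Notation sseq := (scalar_seq R s).
Variables (zeta : nat -> sseq) (m b : nat -> nat) (eps : nat -> R) (e : R).
Hypothesis g : good sg.
Hypothesis m_homo : {homo m : i j / (i < j)%N}.
Hypothesis m_b : forall n, (m (b n) <= n < m (b n).+1)%N.
Hypothesis eps0 : forall i, 0 <= eps i.
Hypothesis eps_sum : forall N, \sum_(i <- iota 0 N) eps i <= e.

(** Erasing block i measures how far zeta i is from being supported there. The total error e will be
    small against the lower bounds on the zeta i. *)
Definition off i (y : nat -> R) n : R := if b n == i then 0 else y n.

Hypothesis near : forall i, bnd id sg (off i (amp (zeta i))) (eps i).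

Variables (alpha : nat -> K) (N : nat).
Hypothesis alpha0 : forall i, (N <= i)%N -> alpha i = 0.
Let A i := modulus (alpha i).
Let x : sseq := \sum_(i <- iota 0 N) alpha i *: zeta i.
(** [diag] is the modulus that x would have if each zeta i were supported in block i; [error] bounds
    the pointwise deviation in both directions. *)
Let diag n := A (b n) * amp (zeta (b n)) n.
Let error n := \sum_(i <- iota 0 N) A i * off i (amp (zeta i)) n.

Let A0 i : 0 <= A i. Proof. exact: modulus_ge0. Qed.

Let diag_ge0 n : 0 <= diag n. Proof. by rewrite mulr_ge0 ?amp_ge0. Qed.

Let off_ge0 i n : 0 <= off i (amp (zeta i)) n.
Proof. by rewrite /off; case: ifP => // _; exact: amp_ge0. Qed.

Let error_ge0 n : 0 <= error n.
Proof. by apply: sumr_ge0 => i _; rewrite mulr_ge0. Qed.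

Lemma weighted_eps_le M J : (forall i, A i <= M) ->
  \sum_(i <- iota 0 J) A i * eps i <= M * e.
Proof.
move=> AM; have M0 : 0 <= M by apply: le_trans (AM 0%N).
apply: le_trans (ler_wpM2l M0 (eps_sum J)); rewrite mulr_sumr.
by apply: ler_sum => i _; rewrite ler_wpM2r.
Qed.

Let error_bnd M : (forall i, A i <= M) -> bnd id sg error (M * e).
Proof.
move=> AM; apply: bnd_le (weighted_eps_le N AM).
apply: (@bnd_sum _ _ _ nat _ (fun i n => A i * off i (amp (zeta i)) n)) => //.
  by move=> i n; rewrite mulr_ge0.
by move=> i; apply: bndZ.
Qed.

(* Near position n only the term of index b n is not small. *)
Let split_coordinate n : exists2 d : K, modulus d <= error n &
  x n = alpha (b n) * zeta (b n) n + d.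
Proof.
pose f i : K := if b n == i then 0 else alpha i * zeta i n.
exists (\sum_(i <- iota 0 N) f i).
  apply: le_trans (modulus_sum _ _) _; apply: ler_sum => i _.
  rewrite /f /off; case: ifP => _; first by rewrite modulus0 mulr0.
  by rewrite modulusM.
rewrite /x sum_scalar_seqE.
rewrite (eq_bigr (fun i => (if b n == i then alpha i * zeta i n else 0) + f i)); last first.
  by move=> i _; rewrite /f; case: ifP => _; rewrite ?addr0 ?add0r.
rewrite big_split; congr (_ + _); rewrite -big_mkcond -big_filter.
rewrite (eq_filter (a2 := pred1 (b n))); last by move=> i; rewrite /= eq_sym.
have [bN|Nb] := ltnP (b n) N.
  by rewrite filter_pred1_uniq ?iota_uniq ?mem_iota// big_seq1.
rewrite alpha0// mul0r big_filter big_seq_cond big1// => i /andP[iN /eqP ib].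
by move: iN; rewrite mem_iota ib add0n /= ltnNge Nb.
Qed.

Let amp_le_diag n : amp x n <= diag n + error n.
Proof.
have [d hd xn] := split_coordinate n; rewrite /amp xn.
by apply: le_trans (modulusD _ _) _; rewrite modulusM lerD.
Qed.

Let diag_le_amp n : diag n <= amp x n + error n.
Proof.
have [d hd xn] := split_coordinate n; rewrite /amp xn /diag /A -modulusM.
by apply: le_trans (modulusB_le _ d) _; rewrite lerD2l.
Qed.

Let max_coefficient : exists M, (forall i, A i <= M) /\ (M = 0 \/ exists i, M = A i).
Proof.
exists (\big[Num.max/0]_(i <- iota 0 N) A i); split=> [i|].
  have [Ni|iN] := leqP N i; first by rewrite /A alpha0// modulus0 bigmax_ge_id.
  by apply: ler_bigmax_seq; rewrite mem_iota.
elim: (iota 0 N) => [|i r [IH|[j IH]]]; first by left; rewrite big_nil.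
  by right; exists i; rewrite big_cons IH; apply/max_idPl.
rewrite big_cons IH; case: (leP (A i) (A j)) => _; right; first by exists j.
by exists i.
Qed.

(** B appears twice for the two parts of [block_decomposition]; e accounts for the overlaps. *)
Lemma steep_upper B tau c : tau = sg -> (forall i, bnd id sg (amp (zeta i)) B) ->
  bnd m tau A c -> bnd id sg (amp x) ((B + B + e) * c).
Proof.
move=> -> hB hA; have B0 := bnd_ge0 (hB 0%N).
have AM i : A i <= c by exact: bnd_term hA.
refine (bnd_mono g _ amp_le_diag _); first exact: amp_ge0.
rewrite mulrDl (mulrC e); apply: bndD => //; last exact: error_bnd.
rewrite mulrDl; apply: (@bnd_block_steep _ m b m_homo m_b sg _ (fun i => B * A i)) => //.
- by move=> i; rewrite mulr_ge0.
- move=> i C hC bC; rewrite (@eq_chain_norm _ _ _ _ (fun n => A i * amp (zeta i) n)); last first.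
    by move=> n /bC bn; rewrite /diag bn.
  rewrite chain_normZ//; last exact: amp_ge0.
  by rewrite mulrC ler_wpM2r//; exact: hB.
- exact: bndZ.
Qed.

(** B comes from the blocks of the minima, one e from the later blocks, which are negligible by
    flatness, and the other from the overlaps. *)
Lemma flat_upper B tau c : tau = (sg.2, sg.2) ->
  (forall i, bnd id sg (amp (zeta i)) B) ->
  (forall i n, (m i)%:R * amp (zeta i) n <= eps i) ->
  bnd m tau A c -> bnd id sg (amp x) ((B + e + e) * c).
Proof.
move=> -> hB flat hA; have B0 := bnd_ge0 (hB 0%N).
have gp : good (sg.2, sg.2) by rewrite /good lexx good2.
have AM i : A i <= c by exact: (bnd_term i gp _ hA).
refine (bnd_mono g _ amp_le_diag _); first exact: amp_ge0.
rewrite mulrDl (mulrC e); apply: bndD => //; last exact: error_bnd.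
rewrite mulrDl.
apply: (@bnd_block_flat _ m b m_homo m_b sg _ (fun i => B * A i) (fun i => A i * eps i)) => //.
- by move=> i; rewrite mulr_ge0.
- by move=> i; rewrite mulr_ge0.
- move=> i C hC bC; rewrite (@eq_chain_norm _ _ _ _ (fun n => A i * amp (zeta i) n)); last first.
    by move=> n /bC bn; rewrite /diag bn.
  rewrite chain_normZ//; last exact: amp_ge0.
  by rewrite mulrC ler_wpM2r//; exact: hB.
- by move=> n; rewrite /diag mulrCA ler_wpM2l.
- move=> J; rewrite lpn_scale//; last exact: good2.
  rewrite ler_wpM2l//.
  exact: (bnd_lpn gp A0 hA (pairwise_ltn_iota 0 J)).
- by move=> J; rewrite [leRHS]mulrC; exact: weighted_eps_le.
Qed.

(** The norms of the zeta i are summable, so the triangle inequality suffices, and bounded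
    coefficients are all that is used of the type tau. *)
Lemma null_upper tau c : good tau -> (forall i, bnd id sg (amp (zeta i)) (eps i)) ->
  bnd m tau A c -> bnd id sg (amp x) (e * c).
Proof.
move=> gt hz hA; have AM i : A i <= c by exact: (bnd_term i gt _ hA).
rewrite mulrC; apply: bnd_le (weighted_eps_le N AM).
have : bnd id sg (fun n => \sum_(i <- iota 0 N) A i * amp (zeta i) n)
    (\sum_(i <- iota 0 N) A i * eps i).
  apply: (@bnd_sum _ _ _ nat _ (fun i n => A i * amp (zeta i) n)) => //.
    by move=> i n; rewrite mulr_ge0 ?amp_ge0.
  by move=> i; apply: bndZ => // n; exact: amp_ge0.
apply: bnd_mono => // n; first exact: amp_ge0.
rewrite {1}/amp /x sum_scalar_seqE; apply: le_trans (modulus_sum _ _) _.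
by apply: ler_sum => i _; rewrite modulusM.
Qed.

(** The overlaps cost M e, where M is the largest coefficient. As M is itself one of the
    coefficients, d M <= t + M e, and e <= d / 2 gives M e <= t. This doubles the constant 1 / d. *)
Let lower_absorb mu d t : good mu -> 0 < d -> e <= d / 2 ->
  bnd id sg (amp x) t ->
  (forall c, bnd id sg diag c -> bnd m mu A (c / d)) ->
  bnd m mu A (2 / d * t).
Proof.
move=> gm d0 ed ht low; have [M [AM hM]] := max_coefficient.
have t0 := bnd_ge0 ht.
have hd : bnd id sg diag (t + M * e).
  refine (bnd_mono g diag_ge0 diag_le_amp _); apply: bndD => //; first exact: amp_ge0.
  exact: error_bnd.
have hA := low _ hd; apply: (bnd_le hA).
have M0 : 0 <= M by apply: le_trans (AM 0%N).
have Mt : M <= (t + M * e) / d.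
  case: hM => [->|[i Mi]]; first by rewrite mul0r addr0 divr_ge0// ltW.
  rewrite {1}Mi; exact: (bnd_term i gm A0 hA).
have := ler_wpM2l M0 ed; move: Mt; rewrite ler_pdivlMr// => h1 h2.
by rewrite ler_pdivrMr// mulrAC divfK ?gt_eqF//; lra.
Qed.

(** Keeping one coordinate k i with value at least d in each block leaves a sequence that dominates
    d times the coefficients, placed at positions k i >= m i. *)
Lemma steep_lower d t : 0 < d -> e <= d / 2 ->
  (forall i, exists k, b k = i /\ d <= amp (zeta i) k) ->
  bnd id sg (amp x) t -> bnd m sg A (2 / d * t).
Proof.
move=> d0 ed /choice[k hk] ht.
apply: lower_absorb ht _ => // c hc.
have hk1 i : b (k i) = i by case: (hk i).
have k_homo : {homo k : i j / (i < j)%N}.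
  move=> i j ij; rewrite ltnNge; apply/negP => /(block_homo m_homo m_b).
  by rewrite !hk1 leqNgt ij.
have : bnd k sg (fun i => d * A i) c.
  apply: (bnd_spread g k_homo _ diag_ge0 _ hc) => i; first by rewrite mulr_ge0// ltW.
  by rewrite /diag hk1 mulrC ler_wpM2l//; case: (hk i).
move=> hdA; rewrite mulrC.
have : bnd k sg (fun i => d^-1 * (d * A i)) (d^-1 * c).
  by apply: bndZ => // [i|]; rewrite ?mulr_ge0// ?invr_ge0 ltW.
move=> h C hC; rewrite (@eq_chain_norm _ _ _ _ (fun i => d^-1 * (d * A i))); last first.
  by move=> i _; rewrite mulrA mulVf ?mul1r ?gt_eqF.
apply: h; apply: chain_le hC => i.
by have := m_b (k i); rewrite hk1 => /andP[].
Qed.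

(** The part of zeta i outside block i has norm at most eps i <= d, so a norm above 2 d forces a
    chain of norm at least d inside the block. Concatenating these chains recovers the l_p norm of
    the coefficients. *)
Lemma flat_lower d t : 0 < d -> e <= d / 2 ->
  (forall i, ~ bnd id sg (amp (zeta i)) (d + d)) ->
  bnd id sg (amp x) t -> bnd m (sg.2, sg.2) A (2 / d * t).
Proof.
move=> d0 ed hz ht.
have gp : good (sg.2, sg.2) by rewrite /good lexx good2.
have eps_le i : eps i <= d.
  apply: le_trans (_ : e <= _); last by lra.
  apply: le_trans (eps_sum i.+1); rewrite -addn1 iotaD big_cat big_seq1 add0n lerDr.
  exact: sumr_ge0.
apply: lower_absorb ht _ => // c hc.
have /choice[C hC] i : exists C, [/\ chain id C, {in flatten C, forall n, b n = i} &
    d <= chain_norm sg C (amp (zeta i))].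
  apply: contrapT => noC; apply: (hz i).
  have : bnd id sg (fun n => (if b n == i then amp (zeta i) n else 0) +
      off i (amp (zeta i)) n) (d + eps i).
    apply: bndD => //; first by move=> n; case: ifP => // _; exact: amp_ge0.
    move=> C hC; rewrite leNgt; apply/negP => /ltW hd; apply: noC.
    exists [seq [seq n <- F | b n == i] | F <- C]; split.
    - by apply: chain_subl => // F; exact: filter_subseq.
    - by move=> n; rewrite -filter_flatten mem_filter => /andP[/eqP].
    - apply: le_trans hd _; rewrite /chain_norm lpn_map.
      apply: lpn_mono; [exact: good2|by move=> ? _; exact: lpn_ge0|].
      move=> F FC /=; rewrite -(@lpn_filter0 _ _ _ (fun n => b n == i) F); first last.
      + by move=> n; case: ifP => // _; exact: amp_ge0.
      + by move=> n _ /negbTE ->.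
      + exact: good1.
      apply: lpn_mono; [exact: good1| |].
        by move=> n _; case: ifP => // _; exact: amp_ge0.
      by move=> n; rewrite mem_filter => /andP[->].
  move=> /bnd_le -/(_ (d + d)); rewrite lerD2l => /(_ (eps_le i)).
  apply: bnd_mono => // n; first exact: amp_ge0.
  by rewrite /off; case: ifP; rewrite ?addr0 ?add0r.
have low J : lpn sg.2 (iota 0 J) (fun i => d * A i) <= c.
  apply: (@lpn_block_lower _ m b m_homo m_b sg diag _ c C) => //.
  - by move=> i; rewrite mulr_ge0// ltW.
  - by move=> i; case: (hC i).
  - by move=> i; case: (hC i).
  - move=> i _; case: (hC i) => _ hb hd.
    rewrite (@eq_chain_norm _ _ _ diag (fun n => A i * amp (zeta i) n)); last first.
      by move=> n /hb bn; rewrite /diag bn.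
    rewrite chain_normZ//; last exact: amp_ge0.
    by rewrite mulrC ler_wpM2l.
apply: bnd_diag => //; first exact: good2.
move=> F hF; rewrite ler_pdivlMr// mulrC -lpn_scale//; [|exact: good2|exact: ltW].
apply: le_trans (low (\max_(n <- F) n).+1); apply: lpn_subset.
- exact: good2.
- by move=> i _; rewrite mulr_ge0// ltW.
- by apply: (@pairwise_uniq _ ltn) => //; exact: ltnn.
- move=> n nF; rewrite mem_iota add0n leq0n/= ltnS.
  exact: (@leq_bigmax_seq _ _ xpredT id n).
Qed.

End NearBlocks.

(** * Sequence models and direct sums *)

Section RealNorm.
Variables (R : realType) (s : scalar_kind).
Local Notation K := (scalars R s).

Lemma rnorm_le (V W : normedModType K) (v : V) (w : W) (c : R) :
  (rnorm v <= c * rnorm w) = (`|v| <= of_real s c * `|w|).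
Proof. by rewrite -!of_real_rnorm -of_realM ler_of_real. Qed.

Lemma rnorm_ge (V W : normedModType K) (v : V) (w : W) (c : R) :
  (c * rnorm w <= rnorm v) = (of_real s c * `|w| <= `|v|).
Proof. by rewrite -!of_real_rnorm -of_realM ler_of_real. Qed.

Lemma ltr_of_real (x y : R) : (of_real s x < of_real s y) = (x < y).
Proof. by rewrite !lt_def ler_of_real (can_eq (@of_realK R s)). Qed.

Lemma of_real_gt0 (c : R) : (0 < of_real s c) = (0 < c).
Proof. by rewrite -(of_real0 R s) ltr_of_real. Qed.

Lemma bounded_map_real (V W : normedModType K) (f : V -> W) : bounded_map f ->
  exists2 B : R, 0 <= B & forall v, rnorm (f v) <= B * rnorm v.
Proof.
move=> [M hM]; exists (modulus M); first exact: modulus_ge0.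
move=> v; rewrite rnorm_le of_real_modulus.
have h := hM v; apply: le_trans h _.
by have := le_trans (normr_ge0 _) (hM v) => /ger0_norm <-; rewrite normrM normr_id.
Qed.

Lemma real_bounded_map (V W : normedModType K) (f : V -> W) (B : R) :
  (forall v, rnorm (f v) <= B * rnorm v) -> bounded_map f.
Proof. by move=> h; exists (of_real s B) => v; rewrite -rnorm_le. Qed.

Lemma rnorm0 (V : normedModType K) : rnorm (0 : V) = 0.
Proof. by apply: (can_inj (@of_realK R s)); rewrite of_real_rnorm normr0 of_real0. Qed.

Lemma rnormN (V : normedModType K) (v : V) : rnorm (- v) = rnorm v.
Proof. by rewrite /rnorm normrN. Qed.

Lemma not_embedding (V W : normedModType K) (f : V -> W) (D : set V) :
  bounded_map f -> ~ embedding_on D f ->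
  ~ (exists C : R, forall v, D v -> rnorm v <= C * rnorm (f v)).
Proof.
move=> /bounded_map_real[B B0 hB] nemb [C hC]; apply: nemb.
exists (of_real s (`|C| + 1)^-1), (of_real s B).
rewrite of_real_gt0 invr_gt0 ltr_wpDl//; split=> // v Dv.
rewrite -rnorm_ge -rnorm_le; split=> //.
rewrite mulrC ler_pdivrMr ?ltr_wpDl//; apply: le_trans (hC v Dv) _.
rewrite mulrC ler_wpM2l ?rnorm_ge0//.
by apply: le_trans (ler_norm _) _; rewrite lerDl.
Qed.

Lemma embedding_lower (V W : normedModType K) (f : V -> W) (D : set V) :
  embedding_on D f ->
  exists2 C : R, 0 < C & forall v, D v -> rnorm v <= C * rnorm (f v).
Proof.
move=> [c [C [c0 h]]]; have cE : c = of_real s (modulus c).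
  by rewrite of_real_modulus gtr0_norm.
have c0' : 0 < modulus c by rewrite -of_real_gt0 -cE.
exists (modulus c)^-1; first by rewrite invr_gt0.
move=> v /h[+ _]; rewrite {1}cE -rnorm_ge => h1.
by rewrite [leRHS]mulrC ler_pdivlMr// mulrC.
Qed.

End RealNorm.

(** * Spans of sequences and finite dimension *)

Section Dimension.
Variables (K : numFieldType) (V : normedModType K).

Definition span_of (z : nat -> V) : set V :=
  [set x | exists N (alpha : nat -> K), x = \sum_(i <- iota 0 N) alpha i *: z i].

Lemma span_of_submod (z : nat -> V) : submod_closed (mem (span_of z)).
Proof.
split=> [|a x y]; rewrite !inE.
  by exists 0%N, (fun=> 0); rewrite big_nil.
move=> [N [al ->]] [M [be ->]].
exists (maxn N M), (fun i => a * (if (i < N)%N then al i else 0) +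
  (if (i < M)%N then be i else 0)).
have trunc (J : nat) (ga : nat -> K) : (J <= maxn N M)%N ->
    \sum_(i <- iota 0 J) ga i *: z i =
    \sum_(i <- iota 0 (maxn N M)) (if (i < J)%N then ga i else 0) *: z i.
  move=> JM; rewrite -(subnKC JM) iotaD big_cat/= [X in _ = _ + X]big_seq.
  rewrite [X in _ = _ + X]big1 ?addr0; last first.
    by move=> i; rewrite mem_iota add0n => /andP[Ji _]; rewrite ltnNge Ji scale0r.
  rewrite big_seq [RHS]big_seq; apply: eq_bigr => i; rewrite mem_iota => /andP[_].
  by rewrite add0n => ->.
rewrite (trunc N) ?leq_maxl// (trunc M) ?leq_maxr// scaler_sumr -big_split.
by apply: eq_bigr => i _; rewrite /= scalerDl scalerA.
Qed.

(** If n vectors spanned, the coefficients of n + 1 of the z i would form a matrix with more rows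
    than columns, and a vector of its left kernel would be a linear relation. *)
Lemma span_of_infinite (z : nat -> V) :
  (forall N (alpha : nat -> K), \sum_(i <- iota 0 N) alpha i *: z i = 0 ->
     forall i, (i < N)%N -> alpha i = 0) ->
  ~ finite_dimensional (span_of z).
Proof.
move=> free [n [v [_ vspan]]].
have zspan i : exists a : 'I_n -> K, z i = \sum_j a j *: v j.
  apply: vspan; exists i.+1, (fun j => (j == i)%:R).
  rewrite -addn1 iotaD big_cat big_seq1 add0n eqxx scale1r big_seq big1 => [|j]; first by rewrite /= add0r.
  by rewrite mem_iota add0n => /andP[_ ji]; rewrite (ltn_eqF ji) scale0r.
have [a za] := choice zspan.
pose A : 'M[K]_(n.+1, n) := \matrix_(i, j) a i j.
have : kermx A != 0.
  rewrite -mxrank_eq0 mxrank_ker -lt0n subn_gt0.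
  by apply: leq_ltn_trans (rank_leq_col _) _.
case/rowV0Pn => w /sub_kermxP wA; apply/negP; rewrite negbK.
apply/eqP/rowP => i; rewrite mxE.
pose al j := if (j < n.+1)%N then w 0 (inord j) else 0.
have al0 : \sum_(j <- iota 0 n.+1) al j *: z j = 0.
  rewrite -(subn0 n.+1) -/(index_iota 0 n.+1) big_mkord.
  under eq_bigr => j _ do rewrite za scaler_sumr.
  rewrite exchange_big big1// => k _ /=.
  under eq_bigr => j _ do rewrite scalerA.
  rewrite -scaler_suml (_ : \sum_(j < n.+1) _ = (w *m A) 0 k); last first.
    by rewrite mxE; apply: eq_bigr => j _; rewrite mxE /al ltn_ord inord_val.
  by rewrite wA mxE scale0r.
by have := free _ _ al0 i (ltn_ord i); rewrite /al ltn_ord inord_val.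
Qed.

(** Induction on n: the kernel of the last functional on W is finite-dimensional, and one further
    vector spans the rest. Applied to coordinates, it yields vectors that vanish on a given initial
    segment. *)
Lemma finite_dimensional_separated (n : nat) (phi : 'I_n -> V -> K) (W : set V) :
  (forall i a x y, phi i (a *: x + y) = a * phi i x + phi i y) ->
  submod_closed (mem W) ->
  (forall x, W x -> (forall i, phi i x = 0) -> x = 0) -> finite_dimensional W.
Proof.
elim: n phi W => [|n IH] phi W lin sub sep.
  exists 0%N, (fun=> 0); split=> [[]//|x Wx]; exists (fun=> 0).
  by rewrite big_ord0; apply: sep => // -[].
have Wlin a x y : W x -> W y -> W (a *: x + y).
  by have := sub.2 a x y; rewrite !inE.
have W0 : W 0 by have := sub.1; rewrite inE.
pose W' := W `&` [set x | phi ord_max x = 0].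
have phi0 i : phi i 0 = 0.
  have := lin i 1 0 0; rewrite scaler0 addr0 mul1r => /eqP.
  by rewrite -{1}[phi i 0]addr0 (inj_eq (addrI _)) eq_sym => /eqP.
have [|||k [v [Wv vspan]]] := IH (fun i => phi (lift ord_max i)) W'.
- by move=> i; exact: lin.
- split=> [|a x y]; rewrite !inE; first by split=> //; exact: phi0.
  move=> [Wx px] [Wy py]; split; first exact: Wlin.
  by rewrite /= lin px py mulr0 addr0.
- move=> x [Wx px] h; apply: sep => // i.
  by case: (unliftP ord_max i) => [j|] ->.
have [[w [Ww pw]]|now] := pselect (exists w, W w /\ phi ord_max w != 0); last first.
  exists k, v; split=> [i|x Wx]; first by case: (Wv i).
  apply: vspan; split=> //=; apply/eqP/negPn/negP => px; apply: now.
  by exists x.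
exists k.+1, (fun i => if unlift ord_max i is Some j then v j else w).
split=> [i|x Wx].
  by case: (unlift _ _) => // j; case: (Wv j).
pose c := phi ord_max x / phi ord_max w.
have [|a ha] := vspan (- c *: w + x).
  split; first exact: Wlin.
  by rewrite /= lin /c mulNr divfK// addNr.
exists (fun i => if unlift ord_max i is Some j then a j else c).
rewrite big_ord_recr /= unlift_none.
rewrite (eq_bigr (fun i : 'I_k => a i *: v i)); last first.
  move=> i _; have -> : widen_ord (leqnSn k) i = lift ord_max i.
    by apply: val_inj; rewrite /= /bump leqNgt ltn_ord.
  by rewrite liftK.
by rewrite -ha scaleNr addrAC addNr add0r.
Qed.

End Dimension.

Section Model.
Variables (R : realType) (s : scalar_kind).
Local Notation K := (scalars R s).
Local Notation sseq := (scalar_seq R s).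

Definition tails_vanish (sg : \bar R * \bar R) (y : nat -> R) :=
  forall e, 0 < e -> exists n, bnd id sg (from n y) e.

(** The common interface to the three kinds of summands: V is isometric to the space of the
    sequences of finite norm of type sg with vanishing tails. The tail condition is automatic for
    finite sg.2 and describes the closure of [c00] for S_r. *)
Record sequence_model (sg : \bar R * \bar R) (V : normedModType K)
    (coord : V -> sseq) : Prop := SequenceModel {
  model_good : good sg;
  model_linear : forall a u v, coord (a *: u + v) = a *: coord u + coord v;
  model_norm : forall v c, rnorm v <= c <-> bnd id sg (amp (coord v)) c;
  model_tail : forall v, tails_vanish sg (amp (coord v));
  model_onto : forall y c, bnd id sg (amp y) c -> tails_vanish sg (amp y) ->
    exists v, coord v = y }.

Section ModelTheory.
Variables (sg : \bar R * \bar R) (V : normedModType K) (coord : V -> sseq).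
Hypothesis mV : sequence_model sg coord.

Lemma model0 : coord 0 = 0.
Proof.
have := model_linear mV 1 0 0; rewrite !scale1r addr0 => /eqP.
by rewrite -{1}[coord 0]addr0 (inj_eq (addrI _)) eq_sym => /eqP.
Qed.

Lemma modelD u v : coord (u + v) = coord u + coord v.
Proof. by rewrite -{1}(scale1r u) (model_linear mV) scale1r. Qed.

Lemma modelZ a u : coord (a *: u) = a *: coord u.
Proof. by rewrite -{1}(addr0 (a *: u)) (model_linear mV) model0 addr0. Qed.

Lemma modelB u v : coord (u - v) = coord u - coord v.
Proof. by rewrite modelD -scaleN1r modelZ scaleN1r. Qed.

Lemma model_sum (T : Type) (r : seq T) (f : T -> V) :
  coord (\sum_(t <- r) f t) = \sum_(t <- r) coord (f t).
Proof. by elim/big_rec2: _ => [|t u v _ <-]; [exact: model0|exact: modelD]. Qed.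

Lemma model_rnorm v : bnd id sg (amp (coord v)) (rnorm v).
Proof. exact/(model_norm mV). Qed.

Lemma model_inj : injective coord.
Proof.
move=> u v uv; apply/eqP; rewrite -subr_eq0; apply/eqP; apply: rnorm_eq0.
apply/eqP; rewrite eq_le rnorm_ge0 andbT; apply/(model_norm mV).
by rewrite modelB uv subrr; exact: bnd_amp0 (model_good mV).
Qed.

End ModelTheory.

End Model.

Section GeometricWeights.
Variable R : realType.

Definition half_pow (e : R) (i : nat) : R := e * 2^-1 ^+ i.+1.

Lemma half_pow_gt0 e i : 0 < e -> 0 < half_pow e i.
Proof. by move=> e0; rewrite mulr_gt0// exprn_gt0// invr_gt0. Qed.

Lemma half_pow_sum e N : 0 <= e -> \sum_(i <- iota 0 N) half_pow e i <= e.
Proof.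
move=> e0; suff -> : \sum_(i <- iota 0 N) half_pow e i = e - e * 2^-1 ^+ N.
  by rewrite gerBl mulr_ge0// exprn_ge0// invr_ge0.
elim: N => [|N IH]; first by rewrite big_nil expr0 mulr1 subrr.
rewrite -{1}addn1 iotaD big_cat big_seq1 add0n /= IH /half_pow exprS; lra.
Qed.

End GeometricWeights.

Section DirectSum.
Variables (R : realType) (s : scalar_kind) (I : finType).
Local Notation K := (scalars R s).
Local Notation sseq := (scalar_seq R s).
Variables (E : I -> normedModType K) (sg : I -> \bar R * \bar R).
Variable coord : forall i, E i -> sseq.
Hypothesis mE : forall i, sequence_model (sg i) (@coord i).
Local Notation X := (direct_sum E).
Local Notation cf x i := (coord (component x i)).

Lemma rnorm_direct_sum (x : X) : rnorm x = max_norm x.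
Proof. exact: of_realK. Qed.

Lemma component_le (x : X) i : rnorm (component x i) <= rnorm x.
Proof. rewrite rnorm_direct_sum; exact: rnorm_le_max. Qed.

Lemma bnd_component (x : X) i : bnd id (sg i) (amp (cf x i)) (rnorm x).
Proof. by apply/(model_norm (mE i)); exact: component_le. Qed.

Lemma rnorm_direct_sum_le (x : X) c : 0 <= c ->
  (forall i, bnd id (sg i) (amp (cf x i)) c) -> rnorm x <= c.
Proof.
move=> c0 h; rewrite rnorm_direct_sum; apply: bigmax_le => // i _.
by apply/(model_norm (mE i)).
Qed.

Lemma component_sum (T : Type) (r : seq T) (f : T -> X) i :
  component (\sum_(t <- r) f t) i = \sum_(t <- r) component (f t) i.
Proof. by elim/big_rec2: _ => // t u v _ <-. Qed.

Lemma coord_lincomb (al : nat -> K) (z : nat -> X) N i :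
  cf (\sum_(j <- iota 0 N) al j *: z j) i = \sum_(j <- iota 0 N) al j *: cf (z j) i.
Proof.
rewrite component_sum (model_sum (mE i)); apply: eq_bigr => j _.
exact: (modelZ (mE i)).
Qed.

Definition coordinatewise_null (z : nat -> X) := forall i k e, 0 < e ->
  \forall n \near \oo, amp (cf (z n) i) k <= e.

Definition flat_at i (z : nat -> X) := forall e, 0 < e ->
  \forall n \near \oo, forall k, amp (cf (z n) i) k <= e.

Definition null_at i (z : nat -> X) := forall e, 0 < e ->
  \forall n \near \oo, bnd id (sg i) (amp (cf (z n) i)) e.

Lemma null_head (z : nat -> X) l e : coordinatewise_null z -> 0 < e ->
  \forall n \near \oo, forall i, \sum_(k <- iota 0 l) amp (cf (z n) i) k <= e.
Proof.
move=> hz e0; apply: filter_forall => i.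
elim: l e e0 => [|l IH] e e0.
  by near=> n; rewrite big_nil ltW.
have e2 : 0 < e / 2 by rewrite divr_gt0.
near=> n.
rewrite -addn1 iotaD big_cat big_seq1 add0n /= [leRHS](splitr e).
apply: lerD; first by near: n; exact: IH.
by near: n; exact: hz.
Unshelve. all: by end_near. Qed.

Lemma common_tail (x y : X) e : 0 < e -> exists l, forall l', (l <= l')%N ->
  forall i, bnd id (sg i) (from l' (amp (cf x i))) e /\
            bnd id (sg i) (from l' (amp (cf y i))) e.
Proof.
move=> e0.
have tl i (w : X) : exists l, bnd id (sg i) (from l (amp (cf w i))) e.
  exact: (model_tail (mE i)).
have [l hl] := choice (fun iw : I * bool => tl iw.1 (if iw.2 then x else y)).
exists (\max_iw l iw) => l' ll' i.
have mono (w : X) k : (k <= l')%N -> bnd id (sg i) (from k (amp (cf w i))) e ->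
    bnd id (sg i) (from l' (amp (cf w i))) e.
  move=> kl; apply: bnd_mono => //; first exact: model_good (mE i).
    by apply: from_ge0; exact: amp_ge0.
  move=> n; rewrite /from; case: ifP => [ln|_]; first by rewrite (leq_trans kl ln).
  by case: ifP => // _; exact: amp_ge0.
split.
  apply: (mono x (l (i, true))); last exact: (hl (i, true)).
  by apply: leq_trans ll'; exact: (leq_bigmax (i, true)).
apply: (mono y (l (i, false))); last exact: (hl (i, false)).
by apply: leq_trans ll'; exact: (leq_bigmax (i, false)).
Qed.

End DirectSum.

(** * Strictly singular operators increase types *)

Section GlidingHump.
Variable R : realType.
Implicit Types (sg : \bar R * \bar R) (y : nat -> R).

Lemma bnd_head sg y l : good sg -> (forall n, 0 <= y n) ->
  bnd id sg (fun n => if (n < l)%N then y n else 0) (\sum_(n <- iota 0 l) y n).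
Proof.
move=> g y0 C [hC _].
have h0 n : 0 <= (if (n < l)%N then y n else 0) by case: ifP.
apply: le_trans (chain_norm_le_sum _ g h0) _.
rewrite -big_mkcond -big_filter; apply: ler_sum_subset => //.
  by apply: filter_uniq; apply: (@pairwise_uniq _ ltn) => //; exact: ltnn.
by move=> n; rewrite mem_filter mem_iota => /andP[].
Qed.

Lemma bnd_off sg y (m b : nat -> nat) j e : good sg -> (forall n, 0 <= y n) ->
  {homo m : i j / (i < j)%N} -> (forall n, (m (b n) <= n < m (b n).+1)%N) ->
  \sum_(n <- iota 0 (m j)) y n <= e / 2 -> bnd id sg (from (m j.+1) y) (e / 2) ->
  bnd id sg (off b j y) e.
Proof.
move=> g y0 mh mb h1 h2; rewrite (splitr e).
have hh n : 0 <= (if (n < m j)%N then y n else 0) by case: ifP.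
have := bndD g hh (fun i => from_ge0 (m j.+1) y0 i) (bnd_le (bnd_head (m j) g y0) h1) h2.
apply: bnd_mono => // [n|n]; rewrite /off; first by case: ifP.
case: eqP => [_|/eqP bj]; first by rewrite addr_ge0//; exact: from_ge0.
have [nj|jn] := ltnP n (m j); first by rewrite lerDl; exact: from_ge0.
rewrite add0r /from; case: ifPn => //; rewrite -ltnNge => nj.
by rewrite (block_eq mh mb (i := j)) ?jn ?eqxx// in bj.
Qed.

End GlidingHump.

Section Core.
Variables (R : realType) (s : scalar_kind) (I : finType).
Local Notation K := (scalars R s).
Local Notation sseq := (scalar_seq R s).
Variables (E : I -> normedModType K) (sg : I -> \bar R * \bar R).
Variable coord : forall i, E i -> sseq.
Hypothesis mE : forall i, sequence_model (sg i) (@coord i).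
Local Notation X := (direct_sum E).
Local Notation cf x i := (coord (component x i)).
Let gE i : good (sg i) := model_good (mE i).

(** A gliding hump run for z and w = T z in all components at once. Heads before the current
    boundary and [P] are under control from some index on, so they can be combined with [low], which
    only holds infinitely often. The next boundary is then put where the tails are small. *)
Lemma block_selection (z w : nat -> X) (low : nat -> Prop)
    (P : nat -> R -> nat -> Prop) (e : R) :
  coordinatewise_null coord z -> coordinatewise_null coord w -> 0 < e ->
  (forall n0, exists2 n, (n0 <= n)%N & low n) ->
  (forall l eps, 0 < eps -> \forall n \near \oo, P l eps n) ->
  exists nn m b : nat -> nat, [/\ {homo m : i j / (i < j)%N},
    forall n, (m (b n) <= n < m (b n).+1)%N &
    forall j, [/\ low (nn j), P (m j) (half_pow e j) (nn j),
      forall i, bnd id (sg i) (off b j (amp (cf (z (nn j)) i))) (half_pow e j) &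
      forall i, bnd id (sg i) (off b j (amp (cf (w (nn j)) i))) (half_pow e j)]].
Proof.
move=> hz hw e0 hlow hP.
have step (jl : nat * nat) : exists nl : nat * nat, [/\ (jl.2 < nl.2)%N, low nl.1,
    P jl.2 (half_pow e jl.1) nl.1,
    forall i, \sum_(k <- iota 0 jl.2) amp (cf (z nl.1) i) k <= half_pow e jl.1 / 2 /\
              \sum_(k <- iota 0 jl.2) amp (cf (w nl.1) i) k <= half_pow e jl.1 / 2 &
    forall i, bnd id (sg i) (from nl.2 (amp (cf (z nl.1) i))) (half_pow e jl.1 / 2) /\
              bnd id (sg i) (from nl.2 (amp (cf (w nl.1) i))) (half_pow e jl.1 / 2)].
  case: jl => j l /=; have ej0 := half_pow_gt0 j e0.
  have ej2 : 0 < half_pow e j / 2 by rewrite divr_gt0.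
  have [n1 _ h1] := null_head l hz ej2.
  have [n2 _ h2] := null_head l hw ej2.
  have [n3 _ h3] := hP l _ ej0.
  have [n + ln] := hlow (maxn n1 (maxn n2 n3)).
  rewrite !geq_max => /and3P[n1n n2n n3n].
  have [l' hl'] := common_tail mE (z n) (w n) ej2.
  exists (n, maxn l.+1 l') => /=; split=> //.
  - by rewrite leq_maxl.
  - exact: h3.
  - by move=> i; split; [exact: h1|exact: h2].
  - by move=> i; apply: hl'; exact: leq_maxr.
have [f hf] := choice step.
pose m := fix m j := if j is j'.+1 then (f (j', m j')).2 else 0%N.
have mS j : m j.+1 = (f (j, m j)).2 by [].
have mlt j : (m j < m j.+1)%N by rewrite mS; case: (hf (j, m j)).
have mh : {homo m : i j / (i < j)%N} by apply: homo_ltn => //; exact: ltn_trans.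
have [b hb] := block_index (erefl : m 0%N = 0%N) mh.
exists (fun j => (f (j, m j)).1), m, b; split=> // j.
case: (hf (j, m j)) => /= _ h1 h2 h3 h4; split=> // i.
  by apply: (bnd_off (gE i) _ mh hb (h3 i).1 (h4 i).1); exact: amp_ge0.
by apply: (bnd_off (gE i) _ mh hb (h3 i).2 (h4 i).2); exact: amp_ge0.
Qed.

(* A sequence that stays away from 0 in a component of type (s, p) has type
   (s, p) there if its coordinates stay away from 0, and type (p, p) otherwise. *)
Definition type_of i (steep : bool) : \bar R * \bar R :=
  if steep then sg i else ((sg i).2, (sg i).2).

Definition lower_type (steep : bool) (x : X) i (d : R) :=
  if steep then exists k, d <= amp (cf x i) k
  else ~ bnd id (sg i) (amp (cf x i)) (d + d).

Lemma type_of_good i steep : good (type_of i steep).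
Proof. by case: steep; [exact: gE|rewrite /good lexx good2]. Qed.

(** Each alternative lets the norm of type mu of the coefficients control the span of a subsequence
    of z in component i: by [steep_upper], [flat_upper] and [null_upper] respectively. *)
Definition upper_type (z : nat -> X) i (mu : \bar R * \bar R) :=
  [\/ (mu <= sg i :> (\bar R *l \bar R)%type)%O,
      (mu <= ((sg i).2, (sg i).2) :> (\bar R *l \bar R)%type)%O /\ flat_at coord i z |
      null_at sg coord i z].

(* The lower estimate of T z in component i0 dominates the upper estimates of z
   in all components, so T is an embedding on the span of a subsequence of z. *)
Lemma not_strictly_singular (T : operator X) (z : nat -> X) (B d : R) i0 steep :
  (forall n, rnorm (z n) <= B) ->
  coordinatewise_null coord z -> coordinatewise_null coord (fun n => T (z n)) ->
  0 < d -> (forall n0, exists2 n, (n0 <= n)%N & lower_type steep (T (z n)) i0 d) ->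
  (forall i, upper_type z i (type_of i0 steep)) -> ~ strictly_singular T.
Proof.
move=> hB hz hTz d0 hlow hup ss.
pose mu := type_of i0 steep; have gmu : good mu by exact: type_of_good.
(* Smallness is only demanded in those components where z is flat or null, hence the
   implications. *)
pose P l (eps : R) n := forall i, (flat_at coord i z -> forall k, l%:R * amp (cf (z n) i) k <= eps)
  /\ (null_at sg coord i z -> bnd id (sg i) (amp (cf (z n) i)) eps).
have hP l eps : 0 < eps -> \forall n \near \oo, P l eps n.
  move=> eps0; apply: filter_forall => i; apply: filterI.
    have [/(_ (eps / l.+1%:R))|nf] := pselect (flat_at coord i z); last by exists 0%N.
    rewrite divr_gt0// => /(_ isT) [N _ hN]; exists N => // n Nn _ k.
    have := hN _ Nn k; rewrite ler_pdivlMr// mulrC; apply: le_trans.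
    by rewrite ler_wpM2r ?amp_ge0// ler_nat.
  have [/(_ eps eps0)[N _ hN]|nf] := pselect (null_at sg coord i z); last by exists 0%N.
  by exists N => // n Nn _; exact: hN.
have d20 : 0 < d / 2 by rewrite divr_gt0.
have [nn [m [b [mh mb sel]]]] := block_selection hz hTz d20 hlow hP.
pose eps := half_pow (d / 2).
have eps0 j : 0 <= eps j by rewrite ltW// half_pow_gt0.
have epsS J : \sum_(j <- iota 0 J) eps j <= d / 2 by apply: half_pow_sum; exact: ltW.
have eps_le j : eps j <= d / 2.
  apply: le_trans (epsS j.+1); rewrite -addn1 iotaD big_cat big_seq1 add0n lerDr.
  exact: sumr_ge0.
pose zz j := z (nn j); pose W := span_of zz.
have Tsum (al : nat -> K) J : T (\sum_(j <- iota 0 J) al j *: zz j) =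
    \sum_(j <- iota 0 J) al j *: T (zz j).
  rewrite raddf_sum; apply: eq_bigr => j _; exact: linearZ.
have low (al : nat -> K) J : (forall j, (J <= j)%N -> al j = 0) ->
    bnd m mu (fun j => modulus (al j))
      (2 / d * rnorm (T (\sum_(j <- iota 0 J) al j *: zz j))).
  move=> al0; have := bnd_component mE (T (\sum_(j <- iota 0 J) al j *: zz j)) i0.
  rewrite {1}Tsum (coord_lincomb mE) => ht.
  have near j : bnd id (sg i0) (off b j (amp (cf (T (zz j)) i0))) (eps j).
    by case: (sel j).
  have lowz j : lower_type steep (T (zz j)) i0 d by case: (sel j).
  rewrite /mu /type_of; case: (steep) lowz => lowz; last first.
    exact: (flat_lower (gE i0) mh mb eps0 epsS near al0 d0 (lexx _) lowz ht).
  apply: (steep_lower (gE i0) mh mb eps0 epsS near al0 d0 (lexx _) _ ht) => j.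
  (* The large coordinate must lie in block j, as those outside are at most d / 2. *)
  have [k hk] := lowz j; exists k; split => //; apply/eqP/negPn/negP => bk.
  have off0 n : 0 <= off b j (amp (cf (T (zz j)) i0)) n.
    by rewrite /off; case: ifP => // _; exact: amp_ge0.
  have := bnd_term k (gE i0) off0 (near j); rewrite /off (negbTE bk).
  by have := eps_le j; move: hk d0; lra.
have up i : exists C : R, forall (al : nat -> K) J t, (forall j, (J <= j)%N -> al j = 0) ->
    bnd m mu (fun j => modulus (al j)) t ->
    bnd id (sg i) (amp (cf (\sum_(j <- iota 0 J) al j *: zz j) i)) (C * t).
  have near j : bnd id (sg i) (off b j (amp (cf (zz j) i))) (eps j).
    by case: (sel j).
  have mge j : (j <= m j)%N by elim: j => // j IH; exact: leq_ltn_trans IH (mh _ _ (ltnSn j)).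
  have bndB j : bnd id (sg i) (amp (cf (zz j) i)) B.
    by apply: bnd_le (hB (nn j)); exact: bnd_component.
  have gp : good ((sg i).2, (sg i).2) by rewrite /good lexx good2.
  case: (hup i) => [le|[le fl]|nl].
  - have [D D0 hD] := bnd_inclusion gmu (gE i) le.
    exists ((B + B + d / 2) * D) => al J t al0 /(hD _ _ _ mge) hA; rewrite -mulrA (coord_lincomb mE).
    apply: (steep_upper (gE i) mh mb eps0 epsS near al0 erefl bndB); apply: hA => j; exact: modulus_ge0.
  - have [D D0 hD] := bnd_inclusion gmu gp le.
    exists ((B + d / 2 + d / 2) * D) => al J t al0 /(hD _ _ _ mge) hA; rewrite -mulrA (coord_lincomb mE).
    apply: (flat_upper (gE i) mh mb eps0 epsS near al0 erefl bndB).
      by move=> j k; case: (sel j) => _ /(_ i)[/(_ fl k)].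
    by apply: hA => j; exact: modulus_ge0.
  - exists (d / 2) => al J t al0 hA; rewrite (coord_lincomb mE).
    have small j : bnd id (sg i) (amp (cf (zz j) i)) (eps j).
      by case: (sel j) => _ /(_ i)[_ /(_ nl)].
    exact: (null_upper (gE i) eps0 epsS J gmu small hA).
have {up}[C hC] := choice up.
pose CC := \sum_i `|C i|.
(* The block estimates require coefficients that vanish from J on. *)
have trunc (al : nat -> K) J : \sum_(j <- iota 0 J) al j *: zz j =
    \sum_(j <- iota 0 J) (if (j < J)%N then al j else 0) *: zz j.
  by rewrite big_seq [RHS]big_seq; apply: eq_bigr => j; rewrite mem_iota add0n => /andP[_ ->].
have trunc0 (al : nat -> K) J j : (J <= j)%N -> (if (j < J)%N then al j else 0) = 0.
  by move=> Jj; rewrite ltnNge Jj.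
have embed v : W v -> rnorm v <= (CC * (2 / d)) * rnorm (T v).
  move=> [J [al ->]]; rewrite trunc.
  have CC0 : 0 <= CC by exact: sumr_ge0.
  have d0' : 0 <= 2 / d by rewrite divr_ge0// ltW.
  apply: (rnorm_direct_sum_le mE) => [|i]; first by apply: mulr_ge0 (rnorm_ge0 _); exact: mulr_ge0.
  apply: bnd_le (hC i _ _ _ (trunc0 al J) (low _ _ (trunc0 al J))) _.
  rewrite -[leRHS]mulrA; apply: ler_wpM2r; first exact: mulr_ge0 (rnorm_ge0 _).
  apply: le_trans (ler_norm _) _; rewrite /CC (bigD1 i)//= lerDl.
  exact: sumr_ge0.
apply: (ss W (span_of_submod zz)).
  (* Independence also follows from the lower estimate: if a combination vanishes, its coefficients
     have norm 0. *)
  apply: span_of_infinite => J al; rewrite trunc => al0 i iJ.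
  have := low _ _ (trunc0 al J); rewrite al0 linear0 rnorm0 mulr0 => h.
  have := bnd_term i gmu _ h; rewrite iJ => h0.
  by apply: modulus_eq0; apply/eqP; rewrite eq_le modulus_ge0 h0// => j; exact: modulus_ge0.
apply: contrapT => /(not_embedding (operator_bounded T)); apply.
by exists (CC * (2 / d)).
Qed.

End Core.

(** * Compactness *)

Section ScalarParts.
Variables (R : realType) (s : scalar_kind).
Local Notation K := (scalars R s).

(** Pigeonhole and completeness for both scalar fields are reduced to R through these parts; for
    real scalars the imaginary part is 0. *)
Lemma scalar_parts : exists (re im : K -> R) (mk : R -> R -> K),
  [/\ forall a b, `|re a - re b| <= modulus (a - b),
      forall a b, `|im a - im b| <= modulus (a - b),
      forall a, mk (re a) (im a) = a &
      forall a u v, modulus (a - mk u v) <= `|re a - u| + `|im a - v| ].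
Proof.
rewrite /modulus; case: s => /=.
  exists id, (fun=> 0), (fun u _ => u); split=> //= [a b|a u v].
    by rewrite subrr normr0.
  by rewrite lerDl.
have Re_le (z : R[i]) : `|complex.Re z| <= complex.Re `|z|.
  by have := normc_ge_Re z; rewrite lecE => /andP[].
have normi : complex.Re `|'i%C : R[i]| = 1.
  by rewrite normc_def /= expr0n /= add0r expr1n sqrtr1.
have normM (z z' : R[i]) : complex.Re `|z * z'| = complex.Re `|z| * complex.Re `|z'|.
  by rewrite normrM !normc_def -rmorphM.
have normD (z z' : R[i]) : complex.Re `|z + z'| <= complex.Re `|z| + complex.Re `|z'|.
  by have := ler_normD z z'; rewrite lecE => /andP[_]; rewrite raddfD.
have Im_le (z : R[i]) : `|complex.Im z| <= complex.Re `|z|.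
  by have := Re_le (z * 'i%C); rewrite ReiNIm normrN normM normi mulr1.
have normr (r : R) : complex.Re `|r%:C%C : R[i]| = `|r|.
  by rewrite normc_def /= expr0n /= addr0 sqrtr_sqr.
exists (@complex.Re R), (@complex.Im R), (fun u v => u%:C%C + 'i%C * v%:C%C); split.
- by move=> a b; have := Re_le (a - b); rewrite raddfB.
- by move=> a b; have := Im_le (a - b); rewrite raddfB.
- by move=> a; rewrite -complexE.
- move=> a u v; rewrite {1}(complexE a) opprD addrACA.
  rewrite -[leLHS]/(complex.Re `|_ + _ : R[i]|).
  apply: le_trans (normD _ _) _; rewrite -mulrBr normM normi mul1r.
  by rewrite -!rmorphB !normr.
Qed.

Lemma pigeonhole (T : finType) (g : nat -> T) : exists n n', (n < n')%N /\ g n = g n'.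
Proof.
apply: contrapT => no.
have inj : injective (fun i : 'I_#|T|.+1 => g i).
  move=> i j gij; apply: val_inj; apply/eqP; case: ltngtP => // ij; exfalso; apply: no.
    by exists i, j.
  by exists j, i.
by have := leq_card _ inj; rewrite card_ord ltnn.
Qed.

(** The cube of side 2 B is cut into finitely many cells of side e, named by the integral parts of
    (f + B) / e. *)
Lemma real_pigeonhole (D : finType) (f : nat -> D -> R) (B e : R) :
  (forall n d, `|f n d| <= B) -> 0 < e ->
  exists n n', (n < n')%N /\ forall d, `|f n d - f n' d| <= e.
Proof.
move=> fB e0.
pose c n d := (f n d + B) / e.
have c0 n d : 0 <= c n d.
  by rewrite divr_ge0 ?(ltW e0)//; have := fB n d; rewrite ler_norml; lra.
have cB n d : c n d < (Num.bound (2 * B / e))%:R.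
  have B0 : 0 <= 2 * B / e.
    by rewrite divr_ge0 ?(ltW e0)// mulr_ge0// (le_trans _ (fB n d)).
  apply: le_lt_trans (archi_boundP B0); rewrite ler_wpM2r ?invr_ge0 ?(ltW e0)//.
  by have := fB n d; rewrite ler_norml; lra.
pose M := Num.bound (2 * B / e).
have cell n d : (Num.trunc (c n d) < M)%N.
  have /andP[h _] := trunc_itv (c0 n d).
  by rewrite -(ltr_nat R); exact: le_lt_trans h (cB n d).
have [n [n' [nn' gE]]] := pigeonhole (fun n => [ffun d => Ordinal (cell n d)]).
exists n, n'; split=> // d; have /ffunP/(_ d) := gE; rewrite !ffunE => -[tE].
have /andP[h1 h2] := trunc_itv (c0 n d); have /andP[h3 h4] := trunc_itv (c0 n' d).
have cE k : f k d = c k d * e - B by rewrite divfK ?gt_eqF// addrK.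
have -> : f n d - f n' d = (c n d - c n' d) * e by rewrite !cE; lra.
rewrite normrM (gtr0_norm e0) -[leRHS]mul1r ler_wpM2r ?(ltW e0)//.
move: h1 h2 h3 h4; rewrite tE -natr1 ler_norml; lra.
Qed.

Lemma scalar_pigeonhole (D : finType) (f : nat -> D -> K) (B e : R) :
  (forall n d, modulus (f n d) <= B) -> 0 < e ->
  exists n n', (n < n')%N /\ forall d, modulus (f n d - f n' d) <= e.
Proof.
move=> fB e0; have [re [im [mk [hre him hmk hle]]]] := scalar_parts.
(* Only differences of parts are controlled by the modulus, so the values at 0 are subtracted. *)
pose h n (d : D * bool) := if d.2 then re (f n d.1) - re 0 else im (f n d.1) - im 0.
have [||n [n' [nn' hn]]] := @real_pigeonhole _ h B (e / 2).
- move=> n [d []]; rewrite /h/=.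
    by apply: le_trans (hre _ _) _; rewrite subr0.
  by apply: le_trans (him _ _) _; rewrite subr0.
- by rewrite divr_gt0.
exists n, n'; split=> // d.
have := hle (f n d) (re (f n' d)) (im (f n' d)); rewrite hmk; move=> /le_trans; apply.
rewrite [leRHS]splitr; apply: lerD.
  by have := hn (d, true); rewrite /h /= opprB addrA subrK.
by have := hn (d, false); rewrite /h /= opprB addrA subrK.
Qed.

Lemma real_complete (u : nat -> R) :
  (forall e, 0 < e -> exists N, forall n n', (N <= n)%N -> (N <= n')%N -> `|u n - u n'| <= e) ->
  exists l, forall e, 0 < e -> exists N, forall n, (N <= n)%N -> `|u n - l| <= e.
Proof.
move=> hu; have cu : cvg (u @ \oo).
  apply: cauchy_cvg; apply: cauchy_exP => e /= e0.
  have [|N hN] := hu (e / 2); first by rewrite divr_gt0.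
  exists (u N), N => // n /= Nn; rewrite -ball_normE /=.
  by apply: le_lt_trans (hN _ _ (leqnn _) Nn) _; rewrite ltr_pdivrMr// ltr_pMr// ltr1n.
exists (limn u) => e e0.
have /cvgrPdist_le /(_ _ e0)[N _ hN] := cu.
by exists N => n Nn; rewrite distrC; exact: hN.
Qed.

Lemma scalar_complete (u : nat -> K) :
  (forall e, 0 < e -> exists N, forall n n', (N <= n)%N -> (N <= n')%N ->
     modulus (u n - u n') <= e) ->
  exists l, forall e, 0 < e -> exists N, forall n, (N <= n)%N -> modulus (u n - l) <= e.
Proof.
move=> hu; have [re [im [mk [hre him hmk hle]]]] := scalar_parts.
have [|x hx] := @real_complete (re \o u).
  move=> e /hu[N hN]; exists N => n n' Nn Nn'.
  exact: le_trans (hre _ _) (hN _ _ Nn Nn').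
have [|y hy] := @real_complete (im \o u).
  move=> e /hu[N hN]; exists N => n n' Nn Nn'.
  exact: le_trans (him _ _) (hN _ _ Nn Nn').
exists (mk x y) => e e0; have e2 : 0 < e / 2 by rewrite divr_gt0.
have [N hN] := hx _ e2; have [N' hN'] := hy _ e2.
exists (maxn N N') => n; rewrite geq_max => /andP[Nn Nn'].
by apply: le_trans (hle _ _ _) _; rewrite [leRHS]splitr lerD ?hN ?hN'.
Qed.

End ScalarParts.

(** * A sequential criterion for precompactness *)

Section CompactnessCriterion.
Variables (R : realType) (s : scalar_kind).
Local Notation K := (scalars R s).
Variables (X : normedModType K).

Definition rnorm_complete := forall x : nat -> X,
  (forall e : R, 0 < e -> exists N, forall n n', (N <= n)%N -> (N <= n')%N ->
     rnorm (x n - x n') <= e) ->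
  exists l, forall e : R, 0 < e -> exists N, forall n, (N <= n)%N -> rnorm (x n - l) <= e.

Definition rball (x : X) (e : R) : set X := [set y | rnorm (x - y) < e].

Lemma rball_ball (x : X) (e : R) : rball x e = ball x (of_real s e).
Proof.
rewrite -ball_normE; apply/seteqP; split => y /=; rewrite /rball /=;
  by rewrite -of_real_rnorm ltr_of_real.
Qed.

Lemma nbhs_rball (x : X) (e : R) : 0 < e -> nbhs x (rball x e).
Proof.
move=> e0; rewrite rball_ball; apply/nbhs_ballP; exists (of_real s e) => //=.
by rewrite of_real_gt0.
Qed.

Lemma rball_nbhs (x : X) (A : set X) : nbhs x A -> exists2 e : R, 0 < e & rball x e `<=` A.
Proof.
move=> /nbhs_ballP[e /= e0 eA]; have eE : e = of_real s (modulus e).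
  by rewrite of_real_modulus gtr0_norm.
by exists (modulus e); [rewrite -(of_real_gt0 s) -eE|rewrite rball_ball -eE].
Qed.

(** [List.In] is used because Y is a bare type. The choice of the next point is first made total,
    with no requirement on lists that leave D. *)
Lemma separated_sequence (Y : Type) (D : set Y) (f : Y -> X) (e : R) :
  (forall l : seq Y, (forall y, List.In y l -> D y) ->
     exists y, D y /\ forall y', List.In y' l -> e <= rnorm (f y' - f y)) ->
  exists x : nat -> Y, (forall n, D (x n)) /\
    forall n n', (n < n')%N -> e <= rnorm (f (x n) - f (x n')).
Proof.
move=> h.
have h' (l : seq Y) : exists y, (forall y, List.In y l -> D y) ->
    D y /\ forall y', List.In y' l -> e <= rnorm (f y' - f y).
  have [/h[y hy]|no] := pselect (forall y, List.In y l -> D y); first by exists y.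
  have [y _] := h [::] (fun _ => False_ind _).
  by exists y.
have [g hg] := choice h'.
pose L n := iter n (fun l => g l :: l) [::].
have LD n : forall y, List.In y (L n) -> D y.
  elim: n => //= n IH y [<-|/IH//]; exact: (hg _ IH).1.
exists (fun n => g (L n)); split=> [n|n n' nn']; first exact: (hg _ (LD n)).1.
apply: (hg _ (LD n')).2; elim: n' nn' => // n' IH; rewrite ltnS leq_eqVlt.
by move=> /predU1P[->|/IH]; [left|right].
Qed.

Lemma ultra_cover (T : Type) (F : set_system X) (l : seq T) (B : T -> set X) :
  UltraFilter F -> F [set x | exists2 t, List.In t l & B t x] ->
  exists2 t, List.In t l & F (B t).
Proof.
move=> UF; elim: l => [|t l IH] Fl.
  by exfalso; apply: (filter_not_empty F); apply: filterS Fl => x [].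
have [Ft|FnB] := in_ultra_setVsetC (B t) UF; first by exists t; [left|].
have [|t' t'l Ft'] := IH; last by exists t' => //; right.
by apply: filterS (filterI Fl FnB) => x [[t' [<-|t'l] Bx] nB]; [|exists t'].
Qed.

(** Without separated sequences the image has finite nets. An ultrafilter on its closure then
    contains balls of radius 2 / (n + 1) for all n; their centres form a Cauchy sequence, to whose
    limit the ultrafilter converges. *)
Lemma precompact_of_no_separated (Y : Type) (D : set Y) (f : Y -> X) :
  rnorm_complete ->
  (forall (x : nat -> Y) (e : R), (forall n, D (x n)) -> 0 < e ->
     exists n n', (n < n')%N /\ rnorm (f (x n) - f (x n')) < e) ->
  precompact (f @` D).
Proof.
move=> complete nosep; rewrite precompactE compact_ultra => F UF FA.
(* The radius doubles because the ultrafilter contains the closure of the image, not the image. *)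
have cover (e : R) : 0 < e -> exists y, D y /\ F (rball (f y) (e + e)).
  move=> e0.
  have [l [lD lcov]] : exists l : seq Y, (forall y, List.In y l -> D y) /\
      forall y, D y -> exists2 y', List.In y' l & rnorm (f y' - f y) < e.
    apply: contrapT => no.
    have [l lD|x [xD xsep]] := @separated_sequence Y D f e.
      apply: contrapT => no'; apply: no; exists l; split=> // y Dy.
      apply: contrapT => no''; apply: no'; exists y; split=> // y' y'l.
      by rewrite leNgt; apply/negP => h; apply: no''; exists y'.
    have [n [n' [nn' h]]] := nosep x e xD e0.
    by have := xsep _ _ nn'; rewrite leNgt h.
  have : F [set x | exists2 y, List.In y l & rball (f y) (e + e) x].
    apply: filterS FA => x /(_ _ (nbhs_rball x e0))[_ [[y Dy <-] xy]].
    have [y' y'l h] := lcov y Dy; exists y' => //; rewrite /rball /=.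
    have -> : f y' - x = (f y' - f y) + - (x - f y) by rewrite opprB addrA subrK.
    by apply: le_lt_trans (rnormD _ _) _; rewrite rnormN ltrD.
  by move=> /ultra_cover[y yl Fy]; exists y; split => //; exact: lD.
have pos n : 0 < (n.+1%:R : R)^-1 by rewrite invr_gt0.
have /choice[y hy] (n : nat) := cover _ (pos n).
have close n n' : rnorm (f (y n) - f (y n')) <=
    (n.+1%:R^-1 + n.+1%:R^-1) + (n'.+1%:R^-1 + n'.+1%:R^-1).
  have [z [zn zn']] := filter_ex (filterI (hy n).2 (hy n').2).
  have -> : f (y n) - f (y n') = (f (y n) - z) + - (f (y n') - z) by rewrite opprB addrA subrK.
  by apply: le_trans (rnormD _ _) _; rewrite rnormN lerD// ltW.
have small (e : R) : 0 < e -> exists N, forall n, (N <= n)%N -> (n.+1%:R : R)^-1 <= e.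
  move=> e0; exists (Num.bound e^-1) => n Nn.
  have e1 : 0 <= e^-1 by rewrite invr_ge0 ltW.
  rewrite invf_ple ?posrE//; apply: le_trans (ltW (archi_boundP e1)) _.
  by rewrite ler_nat leqW.
have [|l hl] := complete (f \o y).
  move=> e e0; have [|N hN] := small (e / 4); first by rewrite divr_gt0.
  exists N => n n' /hN h /hN h'; apply: le_trans (close n n') _; move: h h'.
  move: (n.+1%:R^-1) (n'.+1%:R^-1) => u v; lra.
have Fl : F --> l.
  move=> A /rball_nbhs[e e0 eA].
  have e4 : 0 < e / 4 by rewrite divr_gt0.
  have [N1 h1] := small _ e4; have [N2 h2] := hl _ e4.
  pose n := maxn N1 N2.
  apply: filterS (hy n).2 => x xn; apply: eA; rewrite /rball /=.
  have -> : l - x = - (f (y n) - l) + (f (y n) - x) by rewrite opprB addrA subrK.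
  apply: le_lt_trans (rnormD _ _) _; rewrite rnormN.
  have := h1 n (leq_maxl _ _); have /= := h2 n (leq_maxr _ _); move: xn; rewrite /rball/=.
  move: (n.+1%:R^-1) => v; lra.
exists l; split=> //= A lA.
have [x [xA xl]] := filter_ex (filterI FA (Fl _ (nbhs_interior lA))).
by have [z [? ?]] := xA _ xl; exists z; split => //; exact: interior_subset.
Qed.

End CompactnessCriterion.

(** * Completeness of sequence models and direct sums *)

Section Completeness.
Variables (R : realType) (s : scalar_kind).
Local Notation K := (scalars R s).
Local Notation sseq := (scalar_seq R s).

Lemma ampB_le (x y z : sseq) n : amp (x - y) n <= amp (x - z) n + amp (z - y) n.
Proof. by have <- : (x - z) + (z - y) = x - y; [rewrite addrA subrK|exact: ampD]. Qed.

(** A fixed chain involves finitely many coordinates, so bounds on chain norms pass to the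
    coordinatewise limit. The limit inherits vanishing tails from a close term of the sequence. *)
Lemma model_complete sg (V : normedModType K) (coord : V -> sseq) :
  sequence_model sg coord -> rnorm_complete V.
Proof.
move=> mV x hx; have g := model_good mV.
have cauchy n n' e : rnorm (x n - x n') <= e -> bnd id sg (amp (coord (x n) - coord (x n'))) e.
  by move=> h; rewrite -(modelB mV); apply/(model_norm mV).
have /choice[y hy] k : exists l : K, forall e, 0 < e -> exists N, forall n, (N <= n)%N ->
    modulus (coord (x n) k - l) <= e.
  apply: scalar_complete => e /hx[N hN]; exists N => n n' Nn Nn'.
  apply: (bnd_term k g _ (cauchy _ _ _ (hN _ _ Nn Nn'))) => j; exact: amp_ge0.
have close e N : (forall n n', (N <= n)%N -> (N <= n')%N -> rnorm (x n - x n') <= e) ->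
    forall n, (N <= n)%N -> bnd id sg (amp (coord (x n) - (y : sseq))) e.
  move=> hN n Nn C hC; apply/ler_addgt0Pr => eta eta0.
  have [n' Nn' small] : exists2 n', (N <= n')%N &
      \sum_(k <- flatten C) amp (coord (x n') - (y : sseq)) k <= eta.
    have : exists M, forall n', (M <= n')%N ->
        \sum_(k <- flatten C) amp (coord (x n') - (y : sseq)) k <= eta.
      elim: (flatten C) eta eta0 => [|k r IH] eta eta0.
        by exists 0%N => n' _; rewrite big_nil ltW.
      have e2 : 0 < eta / 2 by rewrite divr_gt0.
      have [M1 h1] := IH _ e2; have [M2 h2] := hy k _ e2.
      exists (maxn M1 M2) => n'; rewrite geq_max => /andP[Mn1 Mn2].
      rewrite big_cons [leRHS]splitr; apply: lerD; last exact: h1.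
      exact: h2.
    move=> [M hM]; exists (maxn N M); [exact: leq_maxl|apply: hM; exact: leq_maxr].
  apply: (@le_trans _ _ (chain_norm sg C (fun k => amp (coord (x n) - coord (x n')) k +
      amp (coord (x n') - (y : sseq)) k))).
    by apply: chain_norm_mono => // k *; rewrite ?ampB_le ?amp_ge0.
  apply: le_trans (chain_normD _ g _ _) _; try by move=> k; exact: amp_ge0.
  apply: lerD; first exact: cauchy (hN _ _ Nn Nn') _ hC.
  by apply: le_trans small; apply: chain_norm_le_sum => // k; exact: amp_ge0.
have yE n : (y : sseq) = coord (x n) - (coord (x n) - (y : sseq)) by rewrite opprB addrC subrK.
have [v hv] : exists v, coord v = y.
  have [N hN] := hx 1 ltr01.
  apply: (@model_onto _ _ _ _ _ mV _ (rnorm (x N) + 1)).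
    rewrite (yE N); apply: bnd_ampD => //; first exact: model_rnorm.
    by apply: bnd_ampN => //; exact: close hN _ (leqnn _).
  move=> e e0; have e2 : 0 < e / 2 by rewrite divr_gt0.
  have [M hM] := hx _ e2; have [n hn] := model_tail mV (x M) e2.
  exists n; rewrite (splitr e).
  have := bndD g _ _ hn (bnd_ampN g (close _ _ hM _ (leqnn _))).
  move=> /(_ (fun k => from_ge0 n (@amp_ge0 _ _ _) k) (@amp_ge0 _ _ _)).
  apply: bnd_mono => // k; first by apply: from_ge0; exact: amp_ge0.
  rewrite /from; case: ifP => _; last by rewrite add0r; exact: amp_ge0.
  by rewrite {1}(yE M); exact: ampD.
exists v => e /hx[N hN]; exists N => n Nn; apply/(model_norm mV).
by rewrite (modelB mV) hv; exact: close hN _ Nn.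
Qed.

Lemma direct_sum_complete (I : finType) (E : I -> normedModType K) :
  (forall i, rnorm_complete (E i)) -> rnorm_complete (direct_sum E).
Proof.
move=> hE x hx.
have ex i : exists li : E i, forall e : R, 0 < e -> exists N, forall n, (N <= n)%N ->
    rnorm (component (x n) i - li) <= e.
  apply: hE => e /hx[N hN]; exists N => n n' Nn Nn'.
  by apply: le_trans (hN _ _ Nn Nn'); exact: (component_le (x n - x n') i).
pose l : direct_sum E := DirectSum (fun i => projT1 (cid (ex i))).
exists l => e e0.
have [M hM] := choice (fun i => projT2 (cid (ex i)) e e0).
exists (\max_i M i) => n Mn; rewrite rnorm_direct_sum; apply: bigmax_le => [|i _].
  exact: ltW.
by apply: hM; apply: leq_trans Mn; exact: leq_bigmax.
Qed.

End Completeness.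

(** * Ranks of types and compact products *)

Section Rank.
Variables (R : realType) (s : scalar_kind) (I : finType).
Local Notation K := (scalars R s).
Local Notation sseq := (scalar_seq R s).
Variables (E : I -> normedModType K) (sg : I -> \bar R * \bar R).
Variable coord : forall i, E i -> sseq.
Hypothesis mE : forall i, sequence_model (sg i) (@coord i).
Local Notation X := (direct_sum E).
Local Notation cf x i := (coord (component x i)).
Local Notation type := (\bar R *l \bar R)%type.
Variable Lam : seq type.
Hypothesis Lam_steep : forall i, (sg i : type) \in Lam.
Hypothesis Lam_flat : forall i, (((sg i).2, (sg i).2) : type) \in Lam.

Definition rank (t : type) := count (fun u : type => (u < t)%O) Lam.

Lemma count_ltn (T : eqType) (p q : pred T) (r : seq T) t :
  subpred p q -> t \in r -> q t -> ~~ p t -> (count p r < count q r)%N.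
Proof.
move=> pq + qt pt; elim: r => //= u r IH; rewrite inE => /predU1P[<-|/IH h].
  by rewrite qt (negbTE pt) ltnS; exact: sub_count.
have : (p u <= q u)%N by case: (p u) (pq u) => // ->.
by move: h; lia.
Qed.

Lemma rank_lt (t u : type) : t \in Lam -> (t < u)%O -> (rank t < rank u)%N.
Proof.
move=> tL tu; apply: (count_ltn (t := t)) => //; last by rewrite ltxx.
by move=> v vt; exact: lt_trans tu.
Qed.

Lemma rank_size t : t \in Lam -> (rank t < size Lam)%N.
Proof.
by move=> tL; rewrite -(count_predT Lam); apply: (count_ltn (t := t)) => //; rewrite ltxx.
Qed.

(** Types of rank below l are excluded: if (s, p) has smaller rank, z must be flat in component i,
    and if (p, p) has too, it must be null there. *)
Definition at_level (l : nat) (z : nat -> X) := forall i,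
  [\/ (l <= rank (sg i))%N, (l <= rank ((sg i).2, (sg i).2))%N /\ flat_at coord i z |
      null_at sg coord i z].

Lemma at_level0 z : at_level 0 z.
Proof. by move=> i; constructor 1. Qed.

Lemma at_level_last l z : (size Lam <= l)%N -> at_level l z -> forall i, null_at sg coord i z.
Proof.
move=> Ll hz i; case: (hz i) => // [/(leq_trans Ll)|[/(leq_trans Ll) + _]].
  by rewrite leqNgt (rank_size (Lam_steep i)).
by rewrite leqNgt (rank_size (Lam_flat i)).
Qed.

Lemma not_near_infty (P : nat -> Prop) : ~ (\forall n \near \oo, P n) ->
  forall n0, exists2 n, (n0 <= n)%N & ~ P n.
Proof.
move=> h n0; apply: contrapT => no; apply: h; exists n0 => // n n0n.
by apply: contrapT => nP; apply: no; exists n.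
Qed.

(** If T z fails level l + 1 in component i, it has there a type mu of rank at most l. All types of
    z have rank at least l, so they are at least mu in the total order, and [not_strictly_singular]
    applies. *)
Lemma at_level_step l (T : operator X) (z : nat -> X) (B : R) :
  strictly_singular T -> (forall n, rnorm (z n) <= B) ->
  coordinatewise_null coord z -> coordinatewise_null coord (fun n => T (z n)) ->
  at_level l z -> at_level l.+1 (fun n => T (z n)).
Proof.
move=> ss hB hz hTz lz i.
have up (mu : type) : (rank mu <= l)%N -> forall j, upper_type sg coord z j mu.
  move=> mul j.
  have le_of_rank (t : type) : t \in Lam -> (l <= rank t)%N -> (mu <= t)%O.
    by move=> tL lt; rewrite leNgt; apply/negP => /(rank_lt tL); rewrite ltnNge (leq_trans mul lt).
  case: (lz j) => [lj|[lj fl]|nl]; [constructor 1|constructor 2|by constructor 3].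
    exact: le_of_rank.
  by split=> //; exact: le_of_rank.
have [h1|h1] := leqP l.+1 (rank (sg i)); first by constructor 1.
have [h2|h2] := leqP l.+1 (rank ((sg i).2, (sg i).2)).
  constructor 2; split=> // e e0; apply: contrapT => /not_near_infty hlow.
  apply: (not_strictly_singular mE (i0 := i) (steep := true) hB hz hTz e0 _ _ ss).
    move=> n0; have [n n0n /existsNP[k /negP hk]] := hlow n0.
    by exists n => //; exists k; rewrite ltW// ltNge.
  exact: up.
constructor 3 => e e0; apply: contrapT => /not_near_infty hlow.
have e2 : 0 < e / 2 by rewrite divr_gt0.
apply: (not_strictly_singular mE (i0 := i) (steep := false) hB hz hTz e2 _ _ ss).
  by move=> n0; have [n n0n hn] := hlow n0; exists n => //; rewrite /lower_type -splitr.
exact: up.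
Qed.

(** The last factor of a product acts first, so the intermediate images of z come from the suffixes
    of [Ts]. *)
Lemma at_level_prod (Ts : seq (operator X)) (z : nat -> X) (B : R) :
  (forall T, T \in Ts -> strictly_singular T) ->
  (forall j n, rnorm ((\prod_(T <- drop j Ts) T) (z n)) <= B) ->
  (forall j, coordinatewise_null coord (fun n => (\prod_(T <- drop j Ts) T) (z n))) ->
  at_level (size Ts) (fun n => (\prod_(T <- Ts) T) (z n)).
Proof.
elim: Ts => [|T Ts IH] ss hB hz; first exact: at_level0.
rewrite big_cons /=; apply: at_level_step.
- by apply: ss; exact: mem_head.
- by have := hB 1%N; rewrite /= drop0; exact.
- by have := hz 1%N; rewrite /= drop0.
- by have := hz 0%N; rewrite drop0 big_cons.
- apply: IH => [U UTs|j|j]; first by apply: ss; rewrite inE UTs orbT.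
    exact: (hB j.+1).
  exact: (hz j.+1).
Qed.

(** If the images of the x n were e-separated, differences of the x n would keep images of norm at
    least e. Along differences that are coordinatewise null under all partial products, the images
    become null at the level [size Lam]. *)
Theorem compact_product (Ts : seq (operator X)) :
  (size Lam <= size Ts)%N -> (forall T, T \in Ts -> strictly_singular T) ->
  compact_map (\prod_(T <- Ts) T).
Proof.
move=> LT ss; set P := \prod_(T <- Ts) T.
apply: (precompact_of_no_separated (s := s)).
  by apply: direct_sum_complete => i; exact: model_complete (mE i).
move=> x e x1 e0; apply: contrapT => sep.
have {}sep n n' : (n < n')%N -> e <= rnorm (P (x n) - P (x n')).
  by move=> nn'; rewrite leNgt; apply/negP => h; apply: sep; exists n, n'.
have x1' n : rnorm (x n) <= 1.
  have := x1 n; rewrite /= -of_real_rnorm (_ : 1 = of_real s 1) ?ler_of_real//.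
  by case: (s).
pose Q j := \prod_(T <- drop j Ts) T.
have /choice[b hb] j : exists bj : R, forall v, rnorm (Q j v) <= bj * rnorm v.
  by have [bj _ h] := bounded_map_real (operator_bounded (Q j)); exists bj.
pose B := \sum_(j < (size Ts).+1) `|b j|.
have hB j n : rnorm (Q j (x n)) <= B.
  have [j' ->] : exists j' : 'I_(size Ts).+1, Q j = Q j'.
    have [jT|Tj] := leqP j (size Ts); first by exists (Ordinal (jT : (j < (size Ts).+1)%N)).
    exists ord_max; rewrite /Q /= drop_size drop_oversize// ltnW//.
  apply: le_trans (hb _ _) _; apply: (@le_trans _ _ `|b j'|).
    apply: le_trans (ler_wpM2r (rnorm_ge0 _) (ler_norm _)) _.
    by rewrite -[leRHS]mulr1 ler_wpM2l.
  by rewrite /B (bigD1 j')//= lerDl sumr_ge0.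
(* The pigeonhole runs over all suffix products, components and coordinates up to N simultaneously,
   which are finitely many. *)
have pair_ex N : exists nn : nat * nat, (nn.1 < nn.2)%N /\
    forall j i k, (k <= N)%N ->
      amp (cf (Q j (x nn.1 - x nn.2)) i) k <= N.+1%:R^-1.
  pose f n (d : 'I_(size Ts).+1 * I * 'I_N.+1) := cf (Q d.1.1 (x n)) d.1.2 d.2.
  have [||n [n' [nn' hn]]] := @scalar_pigeonhole R s _ f B N.+1%:R^-1.
  - move=> n [[j i] k]; rewrite /f /=; apply: le_trans (hB j n).
    have := bnd_component mE (Q j (x n)) i.
    by apply: (bnd_term k (model_good (mE i))) => l; exact: amp_ge0.
  - by rewrite invr_gt0.
  exists (n, n'); split=> // j i k kN.
  have [j' ->] : exists j' : 'I_(size Ts).+1, Q j = Q j'.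
    have [jT|Tj] := leqP j (size Ts); first by exists (Ordinal (jT : (j < (size Ts).+1)%N)).
    exists ord_max; rewrite /Q /= drop_size drop_oversize// ltnW//.
  have cfB : cf (Q j' (x n - x n')) i = cf (Q j' (x n)) i - cf (Q j' (x n')) i.
    by rewrite linearB; exact: (modelB (mE i)).
  by rewrite cfB; exact: (hn (j', i, Ordinal (kN : (k < N.+1)%N))).
have {pair_ex}[nn hnn] := choice pair_ex.
pose z N := x (nn N).1 - x (nn N).2.
have zB j N : rnorm (Q j (z N)) <= B + B.
  by rewrite /z linearB; apply: le_trans (rnormD _ _) _; rewrite rnormN lerD ?hB.
have znull j : coordinatewise_null coord (fun N => Q j (z N)).
  move=> i k eta eta0; exists (maxn k (Num.bound eta^-1)) => // N /=.
  rewrite geq_max => /andP[kN bN]; apply: le_trans ((hnn N).2 j i k kN) _.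
  have e1 : 0 <= eta^-1 by rewrite invr_ge0 ltW.
  rewrite invf_ple ?posrE//; apply: le_trans (ltW (archi_boundP e1)) _.
  by rewrite ler_nat leqW.
have := at_level_prod ss zB znull => /(at_level_last LT) hnull.
have e2 : 0 < e / 2 by rewrite divr_gt0.
have [N _ hN] : \forall n \near \oo, forall i, bnd id (sg i) (amp (cf (P (z n)) i)) (e / 2).
  by apply: filter_forall => i; exact: hnull.
have := rnorm_direct_sum_le mE (ltW e2) (hN N (leqnn _)).
rewrite /z linearB; have := sep _ _ (hnn N).1; move=> h1 h2.
by have := le_trans h1 h2; rewrite leNgt ltr_pdivrMr// ltr_pMr// ltr1n.
Qed.

End Rank.

(** * Strict singularity of formal inclusions *)

Section FormalInclusion.
Variables (R : realType) (s : scalar_kind).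
Local Notation K := (scalars R s).
Local Notation sseq := (scalar_seq R s).
Implicit Types (sg tau : \bar R * \bar R) (v : sseq).

Lemma bnd_outer k sg tau (y : nat -> R) c : good sg -> sg.1 = tau.1 -> (sg.2 <= tau.2)%E ->
  bnd k sg y c -> bnd k tau y c.
Proof.
move=> g e1 e2 h C hC; apply: le_trans (h _ hC).
rewrite /chain_norm -e1; apply: lpn_antimono => //; first exact: good2.
by move=> F; exact: lpn_ge0.
Qed.

Lemma bnd_sup k (y : nat -> R) c : (forall n, 0 <= y n) -> 0 <= c -> (forall n, y n <= c) ->
  bnd k (+oo, +oo)%E y c.
Proof.
move=> y0 c0 yc; apply: bnd_diag => //; first exact: leey.
by move=> F _ /=; apply: bigmax_le.
Qed.

Variables (sg : \bar R * \bar R) (V : set sseq).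
Hypothesis g : good sg.
Hypothesis V_lin : forall a u v, V u -> V v -> V (a *: u + v).
Hypothesis V0 : V 0.
Hypothesis V_fin : forall v, V v -> exists c, bnd id sg (amp v) c.
Hypothesis V_tail : forall v, V v -> tails_vanish sg (amp v).
Hypothesis V_far : forall n, exists v, [/\ V v, v != 0 & forall i, (i < n)%N -> v i = 0].

Definition unit_vector v := bnd id sg (amp v) 1 /\ forall c, bnd id sg (amp v) c -> 1 <= c.

Let VZ a v : V v -> V (a *: v).
Proof. by move=> Vv; rewrite -[_ *: _]addr0; exact: V_lin. Qed.

Let V_sum (T : Type) (r : seq T) (f : T -> sseq) : (forall t, V (f t)) ->
  V (\sum_(t <- r) f t).
Proof.
move=> Vf; elim/big_rec: _ => // t u _ Vu.
by have := V_lin 1 (Vf t) Vu; rewrite scale1r.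
Qed.

Lemma normalize v r : 0 < r -> bnd id sg (amp v) r ->
  (forall c, bnd id sg (amp v) c -> r <= c) -> unit_vector (of_real s r^-1 *: v).
Proof.
move=> r0 hr hmin; have rm : modulus (of_real s r^-1) = r^-1.
  by rewrite modulus_of_real// invr_ge0 ltW.
split; first by have := bnd_ampZ (of_real s r^-1) g hr; rewrite rm mulVf ?gt_eqF.
move=> c hc; have := bnd_ampZ (of_real s r) g hc.
rewrite scalerA -of_realM mulfV ?gt_eqF// (_ : of_real s 1 = 1) ?scale1r; last by case: (s).
rewrite modulus_of_real ?(ltW r0)// => /hmin.
by rewrite -[X in X <= _]mulr1 ler_pM2l.
Qed.

Lemma unit_vector_far n : exists v, [/\ V v, unit_vector v & forall i, (i < n)%N -> v i = 0].
Proof.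
have [v [Vv v0 hv]] := V_far n; have [c hc] := V_fin Vv.
have [r [hr hmin]] := norm_attained hc.
have r0 : 0 < r.
  rewrite lt_def (bnd_ge0 hr) andbT; apply: contra_neq v0 => r0.
  apply/funext => i; apply: modulus_eq0; apply/eqP; rewrite eq_le modulus_ge0 andbT.
  by rewrite -r0; exact: (bnd_term i g (@amp_ge0 _ _ v) hr).
exists (of_real s r^-1 *: v); split; [exact: VZ|exact: normalize|].
by move=> i /hv vi; rewrite /= [LHS](_ : _ = of_real s r^-1 * v i)// vi mulr0.
Qed.

(** A gliding hump inside V. As V contains vectors vanishing on any initial segment, heads vanish
    exactly and only tails leave an error. *)
Lemma select_blocks (P : nat -> R -> sseq -> Prop) (e : R) : 0 < e ->
  (forall l eps, 0 < eps -> exists v, [/\ V v, P l eps v & forall i, (i < l)%N -> v i = 0]) ->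
  exists (v : nat -> sseq) (m b : nat -> nat), [/\ {homo m : i j / (i < j)%N},
    forall n, (m (b n) <= n < m (b n).+1)%N &
    forall j, [/\ V (v j), P (m j) (half_pow e j) (v j),
      forall i, (i < m j)%N -> v j i = 0 &
      bnd id sg (off b j (amp (v j))) (half_pow e j)]].
Proof.
move=> e0 hP.
have step (jl : nat * nat) : exists vl : sseq * nat, [/\ (jl.2 < vl.2)%N, V vl.1,
    P jl.2 (half_pow e jl.1) vl.1, forall i, (i < jl.2)%N -> vl.1 i = 0 &
    bnd id sg (from vl.2 (amp vl.1)) (half_pow e jl.1 / 2)].
  case: jl => j l /=; have ej0 := half_pow_gt0 j e0.
  have ej2 : 0 < half_pow e j / 2 by rewrite divr_gt0.
  have [v [Vv Pv v0]] := hP l _ ej0; have [l' hl'] := V_tail Vv ej2.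
  exists (v, maxn l.+1 l') => /=; split=> //; first by rewrite leq_maxl.
  move: hl'; apply: bnd_mono => // [|n]; first exact: from_ge0 (@amp_ge0 _ _ v).
  rewrite /from geq_max; case: (ltnP l n) => //= _; case: ifP => // _; exact: amp_ge0.
have [f hf] := choice step.
pose m := fix m j := if j is j'.+1 then (f (j', m j')).2 else 0%N.
have mS j : m j.+1 = (f (j, m j)).2 by [].
have mlt j : (m j < m j.+1)%N by rewrite mS; case: (hf (j, m j)).
have mh : {homo m : i j / (i < j)%N} by apply: homo_ltn => //; exact: ltn_trans.
have [b hb] := block_index (erefl : m 0%N = 0%N) mh.
exists (fun j => (f (j, m j)).1), m, b; split=> // j.
case: (hf (j, m j)) => /= _ h1 h2 h3 h4; split=> //.
apply: (bnd_off g _ mh hb _ h4); first exact: amp_ge0.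
rewrite big_seq big1 ?divr_ge0 ?ltW ?half_pow_gt0// => i; rewrite mem_iota add0n => /andP[_ im].
by rewrite /amp h3// modulus0.
Qed.

Lemma homo_ge (m : nat -> nat) : {homo m : i j / (i < j)%N} -> forall j, (j <= m j)%N.
Proof. by move=> mh; elim=> // j IH; exact: leq_ltn_trans IH (mh _ _ (ltnSn j)). Qed.

(* If the coordinates of all unit vectors supported far out had a lower bound,
   a sum of J blocks would have bounded coordinates and norm at least c J^(1/q). *)
Lemma flat_vector (q : R) n (h : R) : sg.1 = q%:E -> 0 < h -> exists v,
  [/\ V v, unit_vector v, forall i, amp v i <= h & forall i, (i < n)%N -> v i = 0].
Proof.
move=> sq h0; have q1 : 1 <= q by have := good1 g; rewrite sq lee_fin.
apply: contrapT => no.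
have steep v : V v -> unit_vector v -> (forall i, (i < n)%N -> v i = 0) ->
    exists k, h <= amp v k.
  move=> Vv uv v0; apply: contrapT => /forallNP no'; apply: no; exists v; split=> // i.
  by rewrite leNgt; apply/negP => /ltW; exact: no'.
pose P (l : nat) (eps : R) v := unit_vector v /\ forall i, (i < n)%N -> v i = 0.
have [||v [m [b [mh mb sel]]]] := @select_blocks P (h / 2).
- by rewrite divr_gt0.
- move=> l eps _; have [v [Vv uv v0]] := unit_vector_far (maxn n l).
  by exists v; split=> //; [split=> //|] => i il; apply: v0; rewrite leq_max il ?orbT.
pose eps := half_pow (h / 2).
have h20 : 0 < h / 2 by rewrite divr_gt0.
have eps0 j : 0 <= eps j by rewrite ltW// half_pow_gt0.
have epsS J : \sum_(j <- iota 0 J) eps j <= h / 2 by apply: half_pow_sum; exact: ltW.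
have epsle j : eps j <= h / 2.
  apply: le_trans (epsS j.+1); rewrite -addn1 iotaD big_cat big_seq1 add0n lerDr.
  exact: sumr_ge0.
have q0 : 0 < q^-1 by rewrite invr_gt0 (lt_le_trans ltr01).
pose bound := 1 + 1 + h / 2.
have bound0 : 0 < bound by rewrite /bound; lra.
(* J is so large that the sum has norm above bound / h; after normalization its coordinates are then
   at most h. *)
have [J J0 hJ] := powR_unbounded (2 / h * (bound / h)) q0.
(* The indices from J to 2 J - 1 form a Schreier set at the positions m j >= j, so that the J ones
   sit in a single chain member and have norm J^(1/q). *)
pose al j : K := if (J <= j < J + J)%N then 1 else 0.
have al0 j : (J + J <= j)%N -> al j = 0 by rewrite /al ltnNge => ->; rewrite andbF.
have alE j : modulus (al j) = if (J <= j < J + J)%N then 1 else 0.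
  by rewrite /al; case: ifP => _; rewrite ?modulus1 ?modulus0.
pose x := \sum_(j <- iota 0 (J + J)) al j *: v j.
have near j : bnd id sg (off b j (amp (v j))) (eps j) by case: (sel j).
have Vx : V x by apply: V_sum => j; apply: VZ; case: (sel j).
have x0 i : (i < n)%N -> x i = 0.
  move=> ni; rewrite /x sum_scalar_seqE big1// => j _; case: (sel j) => _ [_ vj0] _ _.
  by rewrite [LHS](_ : _ = al j * v j i)// vj0// mulr0.
have [c hc] := V_fin Vx; have [r [hr hmin]] := norm_attained hc.
have hJr : J%:R `^ q^-1 <= 2 / h * r.
  have low : bnd m sg (fun j => modulus (al j)) (2 / h * r).
    apply: (steep_lower g mh mb eps0 epsS near al0 h0 (lexx _) _ hr) => j.
    case: (sel j) => Vv [uv v0] _ _; have [k hk] := steep _ Vv uv v0.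
    exists k; split=> //; apply/eqP/negPn/negP => bk.
    have off0 l : 0 <= off b j (amp (v j)) l by rewrite /off; case: ifP => // _; exact: amp_ge0.
    have := bnd_term k g off0 (near j); rewrite /off (negbTE bk).
    by have := epsle j; move: hk h0; lra.
  have hch : chain m [:: iota J J].
    apply: chain1; first exact: pairwise_ltn_iota.
    move=> i; rewrite mem_iota size_iota => /andP[Ji _].
    by apply: leqW; apply: leq_trans Ji (homo_ge mh i).
  have := low _ hch; rewrite /chain_norm lpn_seq1 ?lpn_ge0//; last exact: good2.
  rewrite (@eq_lpn _ _ _ _ _ (fun=> 1)); last by move=> i; rewrite mem_iota alE => ->.
  have iJ : iota J J != [::] by case: (J) J0.
  by rewrite sq lpn_const ?lee_fin// size_iota mulr1.
have r0 : 0 < r.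
  have : 0 < 2 / h * r by apply: lt_le_trans hJr; rewrite powR_gt0// ltr0n.
  by rewrite pmulr_rgt0// divr_gt0.
(* The coordinates of the sum are bounded by the upper block estimate for the type of c_0. *)
have xsup i : amp x i <= bound.
  have goo : good (+oo, +oo : \bar R)%E by rewrite /good /= leey lexx.
  have near' j : bnd id (+oo, +oo)%E (off b j (amp (v j))) (eps j).
    have off0 l : 0 <= off b j (amp (v j)) l by rewrite /off; case: ifP => // _; exact: amp_ge0.
    by apply: bnd_sup => // l; exact: bnd_term (near j).
  have v1 j : bnd id (+oo, +oo)%E (amp (v j)) 1.
    apply: bnd_sup => // [|l]; first exact: amp_ge0.
    by case: (sel j) => _ [[hv _] _] _ _; exact: (bnd_term l g (@amp_ge0 _ _ _) hv).
  have A1 : bnd m (+oo, +oo)%E (fun j => modulus (al j)) 1.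
    apply: bnd_sup => // l; first exact: modulus_ge0.
    by rewrite alE; case: ifP.
  have := steep_upper goo mh mb eps0 epsS near' al0 erefl v1 A1; rewrite mulr1.
  by apply: bnd_term => //; exact: amp_ge0.
apply: no; exists (of_real s r^-1 *: x); split.
- exact: VZ.
- exact: normalize.
- move=> i; rewrite ampZ modulus_of_real ?invr_ge0 ?(ltW r0)// mulrC ler_pdivrMr//.
  apply: le_trans (xsup i) _.
  have := lt_le_trans hJ hJr; rewrite ltr_pM2l ?divr_gt0// ltr_pdivrMr// => /ltW.
  by rewrite mulrC.
- by move=> i /x0 xi; rewrite [LHS](_ : _ = of_real s r^-1 * x i)// xi mulr0.
Qed.

(* On V the norms of types sg and tau would be equivalent, which fails for a flat
   vector if sg.1 < tau.1, and for sums of J flat blocks, of norms about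
   J^(1/p) and J^(1/p'), if sg.1 = tau.1. *)
Lemma formal_inclusion_singular tau : good tau ->
  (sg < tau :> (\bar R *l \bar R)%type)%O ->
  ~ exists C : R, forall v, V v -> forall c, bnd id tau (amp v) c -> bnd id sg (amp v) (C * c).
Proof.
move=> gt /lex_lt_cases lt [C hC].
have C1 : 0 < `|C| + 1 by rewrite ltr_wpDl.
(* The only type with first exponent +oo is (+oo, +oo), which is the largest and cannot be sg. *)
have [q q1 sq] : exists2 q, 1 <= q & sg.1 = q%:E.
  case: (exponentP (good1 g)) => // sq; exfalso; case: lt => [[_]|].
    have : (+oo <= sg.2)%E by rewrite -sq; exact: good12.
    by rewrite leye_eq => /eqP ->; rewrite ltNge leey.
  by rewrite sq ltNge leey.
case: lt => [[e1 e2]|lt]; last first.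
  have d0 : 0 < (`|C| + 1)^-1 / 2 by rewrite divr_gt0// invr_gt0.
  have [h h0 hh] := bnd_flat_small 1 g gt lt d0.
  have [v [Vv [v1 vmin] vh _]] := flat_vector 0 sq h0.
  have := vmin _ (hC _ Vv _ (hh _ (@amp_ge0 _ _ v) v1 vh)).
  rewrite leNgt => /negP; apply.
  apply: (@le_lt_trans _ _ ((`|C| + 1) * ((`|C| + 1)^-1 / 2))).
    rewrite ler_wpM2r ?(ltW d0)//; apply: le_trans (ler_norm _) _; by rewrite lerDl.
  by rewrite mulrA mulfV ?gt_eqF// mul1r invf_lt1// ltr1n.
pose P (l : nat) (eps : R) v := unit_vector v /\ forall i, l%:R * amp v i <= eps.
(* Unit vectors have norm above 1/4 + 1/4, so [flat_lower] applies with d = 1/4, and this asks for a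
   total error of at most d / 2 = 1/8. *)
have quarter : 0 < 4^-1 :> R by rewrite invr_gt0.
have e80 : 0 < 8^-1 :> R by rewrite invr_gt0.
have [|v [m [b [mh mb sel]]]] := @select_blocks P 8^-1 e80.
  move=> l eps eps0; have [|v [Vv uv vh v0]] := @flat_vector q l (eps / l.+1%:R) sq.
    by rewrite divr_gt0.
  exists v; split=> //; split=> // i; have := vh i; rewrite ler_pdivlMr// mulrC; apply: le_trans.
  by rewrite ler_wpM2r ?amp_ge0// ler_nat.
pose eps := half_pow (8^-1 : R).
have eps0 j : 0 <= eps j by rewrite ltW// half_pow_gt0.
have epsS J : \sum_(j <- iota 0 J) eps j <= 8^-1 by apply: half_pow_sum; exact: ltW.
have near j : bnd id sg (off b j (amp (v j))) (eps j) by case: (sel j).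
have flat j i : (m j)%:R * amp (v j) i <= eps j by case: (sel j) => _ [_ /(_ i)].
have near' j : bnd id tau (off b j (amp (v j))) (eps j) by apply: bnd_outer (near j); rewrite ?ltW.
have v1 j : bnd id tau (amp (v j)) 1.
  by apply: (@bnd_outer _ sg); rewrite ?ltW//; case: (sel j) => _ [[]].
have p1 := good2 g; have p1' := good2 gt.
have gap : 0 < iexp sg.2 - iexp tau.2.
  rewrite subr_gt0; case: (exponentP p1) e2 => [[p pp ->]|->]; last by rewrite ltNge leey.
  have p0 : 0 < p by exact: lt_le_trans pp.
  case: (exponentP p1') => [[p' pp' ->]|->] /=; last by rewrite invr_gt0.
  by rewrite lte_fin => pp2; rewrite ltf_pV2 ?posrE// (lt_trans p0).
pose M := 2 / 4^-1 * ((`|C| + 1) * (1 + 8^-1 + 8^-1)).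
have key J : (0 < J)%N -> J%:R `^ iexp sg.2 <= M * J%:R `^ iexp tau.2.
  move=> J0; pose al j : K := if (j < J)%N then 1 else 0.
  have al0 j : (J <= j)%N -> al j = 0 by rewrite /al ltnNge => ->.
  have alE j : modulus (al j) = if (j < J)%N then 1 else 0.
    by rewrite /al; case: ifP => _; rewrite ?modulus1 ?modulus0.
  have lpn_al p : (1 <= p)%E -> lpn p (iota 0 J) (fun j => modulus (al j)) = J%:R `^ iexp p.
    move=> hp; have iJ : iota 0 J != [::] by case: (J) J0.
    rewrite (@eq_lpn _ _ _ _ _ (fun=> 1)); last by move=> j; rewrite mem_iota alE => /andP[_ ->].
    by rewrite lpn_const// size_iota mulr1.
  have hA : bnd m (tau.2, tau.2) (fun j => modulus (al j)) (J%:R `^ iexp tau.2).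
    apply: bnd_diag => // [j|F hF]; first exact: modulus_ge0.
    rewrite -(@lpn_filter0 _ _ _ (fun j => j < J)%N)//.
    - rewrite -lpn_al//; apply: lpn_subset => //.
      + by move=> j _; exact: modulus_ge0.
      + by apply: filter_uniq; apply: (@pairwise_uniq _ ltn) => //; exact: ltnn.
      + by move=> j; rewrite mem_filter mem_iota => /andP[].
    - by move=> j _ /negbTE jJ; rewrite alE jJ.
    - by move=> j; exact: modulus_ge0.
  have Vx : V (\sum_(j <- iota 0 J) al j *: v j).
    by apply: V_sum => j; apply: VZ; case: (sel j).
  have up := flat_upper gt mh mb eps0 epsS near' al0 erefl v1 flat hA.
  have low_v j : ~ bnd id sg (amp (v j)) (4^-1 + 4^-1).
    by case: (sel j) => _ [[_ vmin] _] _ _ /vmin; lra.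
  have e84 : 8^-1 <= 4^-1 / 2 :> R by lra.
  have low := flat_lower g mh mb eps0 epsS near al0 quarter e84 low_v (hC _ Vx _ up).
  have gp : good (sg.2, sg.2) by rewrite /good lexx p1.
  have := bnd_lpn gp (fun j => modulus_ge0 (al j)) low (pairwise_ltn_iota 0 J).
  rewrite lpn_al// => /le_trans; apply.
  rewrite /M -!mulrA ler_wpM2l// ler_wpM2l ?invr_ge0 ?(ltW quarter)//.
  apply: ler_wpM2r; first by rewrite mulr_ge0 ?powR_ge0.
  by apply: le_trans (ler_norm _) _; rewrite lerDl.
have [J J0 hJ] := powR_unbounded M gap.
have := key _ J0; rewrite leNgt => /negP; apply.
rewrite -(subrK (iexp tau.2) (iexp sg.2)) powRD; last by rewrite pnatr_eq0 -lt0n J0 implybT.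
by rewrite ltr_pM2r// powR_gt0// ltr0n.
Qed.

End FormalInclusion.

(** * Operators along the chain of types *)

Section Chain.
Variables (R : realType) (s : scalar_kind) (I : finType).
Local Notation K := (scalars R s).
Local Notation sseq := (scalar_seq R s).
Variables (E : I -> normedModType K) (sg : I -> \bar R * \bar R).
Variable coord : forall i, E i -> sseq.
Hypothesis mE : forall i, sequence_model (sg i) (@coord i).
Local Notation X := (direct_sum E).
Local Notation cf x i := (coord (component x i)).
Let gE i : good (sg i) := model_good (mE i).
Implicit Types (A J Q : sseq -> sseq).

Definition unit_seq (n : nat) : sseq := fun k => (k == n)%:R.

Definition seq_linear A := forall a u v, A (a *: u + v) = a *: A u + A v.

Definition seq_bounded (sg1 sg2 : \bar R * \bar R) A (C : R) :=
  forall x c, bnd id sg1 (amp x) c ->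
    bnd id sg2 (amp (A x)) (C * c) /\
    (tails_vanish sg1 (amp x) -> tails_vanish sg2 (amp (A x))).

Lemma ext_coord (x y : X) : (forall i, cf x i = cf y i) -> x = y.
Proof. by move=> xy; apply: direct_sumP => i; exact: (model_inj (mE i)). Qed.

Lemma in_component i (w : sseq) c : bnd id (sg i) (amp w) c ->
  tails_vanish (sg i) (amp w) -> exists x : X, forall j, cf x j = if j == i then w else 0.
Proof.
move=> wc wt.
have ex j : exists v : E j, coord v = if j == i then w else 0.
  case: eqP => [->|_]; first exact: (model_onto (mE i) wc wt).
  by exists 0; exact: model0 (mE j).
by exists (DirectSum (fun j => projT1 (cid (ex j)))) => j /=; exact: projT2 (cid (ex j)).
Qed.

Lemma operator_of_seq A i i' C : seq_linear A -> 0 <= C ->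
  seq_bounded (sg i) (sg i') A C ->
  exists T : operator X, forall x j, cf (T x) j = if j == i' then A (cf x i) else 0.
Proof.
move=> lA C0 bA.
have /choice[T hT] (x : X) : exists y : X, forall j,
    cf y j = if j == i' then A (cf x i) else 0.
  have [h1 h2] := bA _ _ (bnd_component mE x i).
  by apply: in_component h1 (h2 _); exact: (model_tail (mE i)).
have opT : T \in @is_operator K X.
  rewrite inE; split.
    move=> a x y; apply: ext_coord => j; rewrite hT.
    rewrite [RHS](model_linear (mE j) a (component (T x) j) (component (T y) j)) !hT.
    case: (j == i'); last by rewrite scaler0 addr0.
    by rewrite -lA; congr A; exact: (model_linear (mE i)).
  apply: (@real_bounded_map _ _ _ _ _ C) => x.
  apply: (rnorm_direct_sum_le mE) => [|j]; first by rewrite mulr_ge0 ?rnorm_ge0.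
  rewrite hT; case: eqP => [->|_]; first exact: (bA _ _ (bnd_component mE x i)).1.
  by apply: bnd_le (bnd_amp0 s (gE j)) _; rewrite mulr_ge0 ?rnorm_ge0.
by exists (Operator opT).
Qed.

(** T passes through the formal inclusion of type tau in type tau'. If it were an embedding on W,
    the two norms would be equivalent on the image V of W under Q, against
    [formal_inclusion_singular]. *)
Lemma operator_of_seq_singular J Q i i' C tau tau' (T : operator X) :
  good tau -> good tau' -> (tau < tau' :> (\bar R *l \bar R)%type)%O ->
  seq_linear J -> seq_linear Q -> seq_bounded tau' (sg i') J C -> 0 <= C ->
  seq_bounded (sg i) tau Q 1 ->
  (forall x j, cf (T x) j = if j == i' then J (Q (cf x i)) else 0) ->
  strictly_singular T.
Proof.
move=> gt gt' lt lJ lQ bJ C0 bQ hT W subW infW embW.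
have [D D0 hD] := embedding_lower embW.
pose V : set sseq := [set u | exists2 w, W w & u = Q (cf w i)].
have W_lin a x y : W x -> W y -> W (a *: x + y).
  by have := subW.2 a x y; rewrite !inE.
have W0 : W 0 by have := subW.1; rewrite inE.
have QL a x y : Q (cf (a *: x + y) i) = a *: Q (cf x i) + Q (cf y i).
  by rewrite -lQ; congr Q; exact: (model_linear (mE i)).
have Tnorm w c : bnd id tau' (amp (Q (cf w i))) c -> rnorm (T w) <= C * c.
  move=> hc; have c0 := bnd_ge0 hc.
  apply: (rnorm_direct_sum_le mE) => [|j]; first exact: mulr_ge0.
  rewrite hT; case: eqP => [->|_]; first exact: (bJ _ _ hc).1.
  by apply: bnd_le (bnd_amp0 s (gE j)) _; exact: mulr_ge0.
apply: (@formal_inclusion_singular R s tau V gt _ _ _ _ _ tau' gt' lt).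
- move=> a _ _ [w Ww ->] [w' Ww' ->]; exists (a *: w + w'); first exact: W_lin.
  by rewrite QL.
- exists 0 => //; have := QL 1 0 0; rewrite !scale1r addr0 => /eqP.
  by rewrite -{1}[Q _]addr0 (inj_eq (addrI _)) => /eqP.
- by move=> _ [w _ ->]; eexists; exact: (bQ _ _ (bnd_component mE w i)).1.
- move=> _ [w _ ->]; apply: (bQ _ _ (bnd_component mE w i)).2.
  exact: (model_tail (mE i)).
(* If V had no non-zero vector vanishing on the first n coordinates, these n coordinates would
   separate W: where they vanish, Q and hence T vanish, and T is bounded below on W. *)
- move=> n; apply: contrapT => no; apply: infW.
  apply: (@finite_dimensional_separated _ _ n (fun k w => Q (cf w i) k)) => //.
    by move=> k a x y; rewrite QL.
  move=> w Ww hw; have Qw0 : Q (cf w i) = 0.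
    apply: contrapT => /eqP Qw; apply: no; exists (Q (cf w i)); split=> //; first by exists w.
    by move=> k kn; exact: (hw (Ordinal kn)).
  apply: rnorm_eq0; apply/eqP; rewrite eq_le rnorm_ge0 andbT.
  apply: le_trans (hD _ Ww) _.
  have : rnorm (T w) <= C * 0 by apply: Tnorm; rewrite Qw0; exact: bnd_amp0.
  by rewrite mulr0 pmulr_rle0.
- exists (D * C) => _ [w Ww ->] c hc.
  have := (bQ _ _ (bnd_component mE w i)).1; rewrite mul1r => /bnd_le; apply.
  apply: le_trans (hD _ Ww) _; rewrite -mulrA ler_wpM2l ?(ltW D0)//.
  exact: Tnorm.
Qed.

(* J embeds the sequence space of type tau in component i, and Q is a left
   inverse of J. No Q is needed at the last level (+oo, +oo). *)
Record realizes (tau : \bar R * \bar R) i J Q (C : R) : Prop := Realizes {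
  realizes_good : good tau;
  realizes_ge0 : 0 <= C;
  realizes_J_linear : seq_linear J;
  realizes_Q_linear : seq_linear Q;
  realizes_J : seq_bounded tau (sg i) J C;
  realizes_Q : seq_bounded (sg i) tau Q 1;
  realizes_QJ : tau.1 != +oo%E -> forall n, Q (J (unit_seq n)) = unit_seq n;
  realizes_separated : forall n n' c, n != n' ->
    bnd id (sg i) (amp (J (unit_seq n) - J (unit_seq n'))) c -> 1 <= c }.

Lemma amp_unit_seq n k : amp (unit_seq n) k = (k == n)%:R.
Proof. by rewrite /amp /unit_seq; case: eqP => _; rewrite ?modulus1 ?modulus0. Qed.

Lemma bnd_unit_seq tau n : good tau -> bnd id tau (amp (unit_seq n)) 1.
Proof.
move=> g C [hC _]; apply: le_trans (chain_norm_le_sum _ g (@amp_ge0 _ _ _)) _.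
rewrite (eq_bigr (fun k => if k == n then 1 else 0)); last first.
  by move=> k _; rewrite amp_unit_seq; case: eqP.
rewrite -big_mkcond -big_filter.
apply: (@le_trans _ _ (\sum_(k <- [:: n]) 1)); last by rewrite big_seq1.
apply: ler_sum_subset => //.
  by apply: filter_uniq; apply: (@pairwise_uniq _ ltn) => //; exact: ltnn.
by move=> k; rewrite mem_filter inE => /andP[].
Qed.

Lemma tails_unit_seq tau n : good tau -> tails_vanish tau (amp (unit_seq n)).
Proof.
move=> g e e0; exists n.+1; apply: bnd_le (ltW e0); refine (bnd_mono g _ _ (bnd0 g)) => k.
  by apply: from_ge0; exact: amp_ge0.
by rewrite /from; case: ifP => // nk; rewrite amp_unit_seq gtn_eqF.
Qed.

Lemma inclusion_bounded tau tau' : good tau -> good tau' ->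
  (tau <= tau' :> (\bar R *l \bar R)%type)%O ->
  exists2 D, 0 < D & seq_bounded tau tau' id D.
Proof.
move=> g g' le; have [D D0 hD] := bnd_inclusion g g' le; exists D => // x c hx; split.
  by apply: hD => //; exact: amp_ge0.
move=> tx e e0; have [n hn] := tx (e / D) (divr_gt0 e0 D0); exists n.
have := hD id _ _ (fun=> leqnn _) (fun k => from_ge0 n (@amp_ge0 _ _ x) k) hn.
by rewrite mulrC divfK ?gt_eqF.
Qed.

Lemma seq_bounded_comp sg1 sg2 sg3 A A' C C' : seq_bounded sg1 sg2 A C ->
  seq_bounded sg2 sg3 A' C' -> seq_bounded sg1 sg3 (A' \o A) (C' * C).
Proof.
move=> h h' x c hx; have [h1 h2] := h _ _ hx; have [h3 h4] := h' _ _ h1.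
by rewrite -mulrA; split=> // /h2/h4.
Qed.

Variable Lam : seq (\bar R *l \bar R)%type.
Hypothesis Lam_uniq : uniq Lam.
Hypothesis Lam_pos : (0 < size Lam)%N.
Hypothesis Lam_real : forall tau, tau \in Lam -> exists i J Q C, realizes tau i J Q C.

Let k := (size Lam).-1.
Let lev j : (\bar R *l \bar R)%type := nth (0%E, 0%E) (sort <=%O Lam) j.

Let lev_lt j : (j < k)%N -> (lev j < lev j.+1)%O.
Proof.
move=> jk; have := @sort_lt_sorted _ _ Lam; rewrite Lam_uniq => srt.
apply: (sorted_ltn_nth (leT := <%O) lt_trans _ srt); rewrite ?inE ?size_sort//.
  by apply: ltn_trans jk _; rewrite /k prednK.
by rewrite -(prednK Lam_pos) ltnS.
Qed.

Let lev_mem j : (j <= k)%N -> lev j \in Lam.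
Proof. by move=> jk; rewrite -(mem_sort <=%O) mem_nth// size_sort -(prednK Lam_pos) ltnS. Qed.

(** [f j n] is the copy of e_n at the j-th smallest type, and [T j] is Q at level j, followed by the
    formal inclusion and by J at level j + 1. *)
Lemma level_operators : exists (f : nat -> nat -> X) (T : nat -> operator X),
  [/\ forall j n, (j < k)%N -> T j (f j n) = f j.+1 n,
      forall j, (j < k)%N -> strictly_singular (T j),
      exists B, forall n, rnorm (f 0 n) <= B &
      forall n n', n != n' -> 1 <= rnorm (f k n - f k n')].
Proof.
have [i0 _] : exists i0 : I, True.
  by have [i _] := Lam_real (lev_mem (leq0n k)); exists i.
have real j : exists r : I * (sseq -> sseq) * (sseq -> sseq) * R, (j <= k)%N ->
    realizes (lev j) r.1.1.1 r.1.1.2 r.1.2 r.2.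
  have [jk|kj] := leqP j k; last by exists (i0, id, id, 0).
  by have [i [J [Q [C h]]]] := Lam_real (lev_mem jk); exists (i, J, Q, C).
have [r hr] := choice real.
pose ii j := (r j).1.1.1; pose J j := (r j).1.1.2; pose Q j := (r j).1.2; pose C j := (r j).2.
have f_ex (jn : nat * nat) : exists x : X, (jn.1 <= k)%N -> forall l,
    cf x l = if l == ii jn.1 then J jn.1 (unit_seq jn.2) else 0.
  case: jn => j n /=; have [jk|kj] := leqP j k; last by exists 0.
  have h := hr _ jk; have g := realizes_good h.
  have [h1 h2] := realizes_J h (bnd_unit_seq n g).
  by have [x hx] := in_component h1 (h2 (tails_unit_seq n g)); exists x.
have [f hf] := choice f_ex.
have T_ex j : exists T : operator X, (j < k)%N -> strictly_singular T /\
    forall x l, cf (T x) l = if l == ii j.+1 then J j.+1 (Q j (cf x (ii j))) else 0.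
  have [kj|jk] := leqP k j; first by exists 0.
  have h := hr _ (ltnW jk); have h' := hr _ jk.
  have [D D0 hD] := inclusion_bounded (realizes_good h) (realizes_good h') (ltW (lev_lt jk)).
  have bA := seq_bounded_comp (seq_bounded_comp (realizes_Q h) hD) (realizes_J h').
  have C0 := realizes_ge0 h'.
  have lA : seq_linear (J j.+1 \o (id \o Q j)).
    by move=> a u v; rewrite /= /J /Q (realizes_Q_linear h) (realizes_J_linear h').
  have [|T hT] := operator_of_seq lA _ bA.
    by rewrite !mulr_ge0// ltW.
  exists T => _; split=> //.
  exact: (operator_of_seq_singular (realizes_good h) (realizes_good h') (lev_lt jk)
    (realizes_J_linear h') (realizes_Q_linear h) (realizes_J h') C0 (realizes_Q h) hT).
have [T hT] := choice T_ex.
exists (fun j n => f (j, n)), T; split.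
- move=> j n jk; apply: ext_coord => l; rewrite (hT _ jk).2 (hf (j.+1, n) jk l) /=.
  case: ifP => // _; rewrite (hf (j, n) (ltnW jk)) /= eqxx.
  rewrite /Q /J (realizes_QJ (hr _ (ltnW jk)))//.
  (* Below the last level the first exponent is finite, as (+oo, +oo) has no larger type above it;
     so Q is a left inverse of J there. *)
  apply/eqP => oo; have := lev_lt jk => /lex_lt_cases; rewrite oo => -[[e lt]|]; last by rewrite ltNge leey.
  have := good12 (realizes_good (hr _ (ltnW jk))); rewrite oo leye_eq => /eqP e'.
  by move: lt; rewrite e' ltNge leey.
- by move=> j /hT[].
- exists (C 0%N) => n; have h := hr _ (leq0n k).
  apply: (rnorm_direct_sum_le mE) => [|l]; first exact: realizes_ge0 h.
  rewrite (hf (0%N, n) (leq0n k)) /=; case: eqP => [->|_].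
    have := (realizes_J h (bnd_unit_seq n (realizes_good h))).1.
    by rewrite mulr1.
  by apply: bnd_le (bnd_amp0 s (gE l)) _; exact: realizes_ge0 h.
- move=> n n' nn'; have h := hr _ (leqnn k).
  apply: (realizes_separated h nn').
  have := bnd_component mE (f (k, n) - f (k, n')) (ii k).
  rewrite (_ : cf (f (k, n) - f (k, n')) (ii k) = J k (unit_seq n) - J k (unit_seq n'))//.
  rewrite [LHS](modelB (mE (ii k)) (component (f (k, n)) (ii k)) (component (f (k, n')) (ii k))).
  by rewrite (hf (k, n) (leqnn k)) (hf (k, n') (leqnn k)) /= eqxx.
Qed.

End Chain.

(** * Non-compactness of products *)

Section Noncompact.
Variables (R : realType) (s : scalar_kind) (X : normedModType (scalars R s)).

Lemma separated_not_precompact (A : set X) (y : nat -> X) (e : R) : 0 < e ->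
  (forall n, A (y n)) -> (forall n n', n != n' -> e <= rnorm (y n - y n')) -> ~ precompact A.
Proof.
move=> e0 yA ysep; rewrite precompactE => cA.
have [|l [_ hl]] := cA (y @ \oo) _.
  by exists 0%N => // n _; apply: subset_closure; exact: yA.
have e2 : 0 < e / 2 by rewrite divr_gt0.
have near_l N : exists2 n, (N <= n)%N & rnorm (l - y n) < e / 2.
  have [z [[n /= Nn <-] hz]] := hl (y @` [set n | (N <= n)%N]) (rball l (e / 2))
    (@filterS _ \oo _ _ _ (fun n (Nn : (N <= n)%N) => ex_intro2 _ _ n Nn erefl) (nbhs_infty_ge N))
    (nbhs_rball l e2).
  by exists n.
have [n _ hn] := near_l 0%N; have [n' nn' hn'] := near_l n.+1.
have := ysep n n'; rewrite neq_ltn nn' => /(_ isT).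
have -> : y n - y n' = - (l - y n) + (l - y n') by rewrite opprB addrA subrK.
rewrite leNgt => /negP; apply; apply: le_lt_trans (rnormD _ _) _.
by rewrite rnormN (splitr e) ltrD.
Qed.

(** The operators are indexed backwards, since the last factor of the product acts first. *)
Lemma prod_chain (T : nat -> operator X) (f : nat -> X) j :
  (forall i, (i < j)%N -> T i (f i) = f i.+1) ->
  (\prod_(i < j) T (j - i.+1)%N) (f 0%N) = f j.
Proof.
elim: j => [|j IH] h; first by rewrite big_ord0.
rewrite big_ord_recl subn1 /= -[LHS]/(T j ((\prod_(i < j) T (j.+1 - (lift ord0 i).+1)%N) (f 0%N))).
rewrite (eq_bigr (fun i : 'I_j => T (j - i.+1)%N)); last first.
  by move=> i _; rewrite /= /bump /= add1n subSS.
by rewrite IH ?h// => i ij; apply: h; exact: ltnW.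
Qed.

End Noncompact.

Section ChainTheorem.
Variables (R : realType) (s : scalar_kind) (I : finType).
Local Notation K := (scalars R s).
Local Notation sseq := (scalar_seq R s).
Variables (E : I -> normedModType K) (sg : I -> \bar R * \bar R).
Variable coord : forall i, E i -> sseq.
Hypothesis mE : forall i, sequence_model (sg i) (@coord i).
Variable Lam : seq (\bar R *l \bar R)%type.
Hypothesis Lam_uniq : uniq Lam.
Hypothesis Lam_pos : (0 < size Lam)%N.
Hypothesis Lam_real : forall tau, tau \in Lam ->
  exists i (J Q : sseq -> sseq) C, realizes sg tau i J Q C.

Theorem noncompact_product k : k = (size Lam).-1 ->
  exists T : 'I_k -> operator (direct_sum E),
    (forall i, strictly_singular (T i)) /\ ~ compact_map (\prod_i T i).
Proof.
move=> ->; have [f [T [hT ssT [B hB] sep]]] := level_operators mE Lam_uniq Lam_pos Lam_real.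
set k' := (size Lam).-1 in hT ssT sep *.
exists (fun i : 'I_k' => T (k' - i.+1)%N); split=> [i|].
  by apply: ssT; rewrite ltn_subrL /= (leq_ltn_trans _ (ltn_ord i)).
have B1 : 0 < `|B| + 1 by rewrite ltr_wpDl.
pose c : R := (`|B| + 1)^-1; have c0 : 0 < c by rewrite invr_gt0.
apply: (@separated_not_precompact _ _ _ _ (fun n => of_real s c *: f k' n) c c0).
  move=> n; exists (of_real s c *: f 0%N n).
    rewrite /= -of_real_rnorm (_ : 1 = of_real s 1); last by case: (s).
    rewrite ler_of_real rnormZ modulus_of_real ?(ltW c0)// /c mulrC ler_pdivrMr// mul1r.
    by apply: le_trans (hB n) _; apply: le_trans (ler_norm _) _; rewrite lerDl.
  rewrite linearZ; congr (_ *: _).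
  by apply: (prod_chain (f := fun j => f j n)) => j; exact: hT.
move=> n n' nn'; rewrite -scalerBr rnormZ modulus_of_real ?(ltW c0)//.
by rewrite -[leLHS]mulr1 ler_pM2l// sep.
Qed.

End ChainTheorem.

(** * The spaces l_q, B_p and S_r *)

Section FiniteSets.
Variable R : realType.
Implicit Types (F : {fset nat}) (y : nat -> R) (p : \bar R).

Definition sorted_enum F : seq nat := sort leq (enum_fset F).

Lemma mem_sorted_enum F : sorted_enum F =i F.
Proof. by move=> n; rewrite mem_sort. Qed.

Lemma size_sorted_enum F : size (sorted_enum F) = #|` F|%fset.
Proof. by rewrite size_sort. Qed.

Lemma pairwise_sorted_enum F : pairwise ltn (sorted_enum F).
Proof.
rewrite -sorted_pairwise; last exact: ltn_trans.
by rewrite ltn_sorted_uniq_leq sort_uniq fset_uniq sort_sorted//; exact: leq_total.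
Qed.

Lemma lpn_fset p F (r : seq nat) y : (1 <= p)%E -> (forall n, 0 <= y n) ->
  uniq r -> r =i F -> lpn p r y = lpn p (enum_fset F) y.
Proof.
move=> p1 y0 ur rF; apply/eqP; rewrite eq_le; apply/andP; split; apply: lpn_subset => //.
- by move=> n; rewrite rF.
- by move=> n; rewrite rF.
Qed.

Lemma lpn_sorted_enum p F y : (1 <= p)%E -> (forall n, 0 <= y n) ->
  lpn p (sorted_enum F) y = lpn p (enum_fset F) y.
Proof.
move=> p1 y0; apply: lpn_fset => //; last exact: mem_sorted_enum.
by rewrite sort_uniq fset_uniq.
Qed.

Lemma chain_sorted_enum (C : seq {fset nat}) : schreier_chain C ->
  chain id [seq sorted_enum F | F <- C].
Proof.
move=> [_ hC sC]; split; last first.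
  move=> _ /mapP[F FC ->] n; rewrite mem_sorted_enum size_sorted_enum => nF.
  exact: (hC F FC).2.
have : pairwise fset_before C.
  (* [fset_before] is transitive only through a non-empty middle set. *)
  rewrite -(@sorted_pairwise_in _ (fun F => F != fset0))//.
    move=> G F H /fset0Pn[g gG] _ _ /allP FG /allP GH.
    apply/allP => n /FG /allP/(_ _ gG) ng; apply/allP => m mH.
    by have /allP/(_ _ mH) := GH _ gG; exact: ltn_trans.
  by apply/allP => F /hC[].
elim: C {hC sC} => //= F C IH /andP[/allP FC /IH {}IH].
rewrite pairwise_cat IH pairwise_sorted_enum !andbT.
apply/allrelP => n n' + /flattenP[_ /mapP[G GC ->]]; rewrite !mem_sorted_enum => nF n'G.
by have /allP/(_ _ nF)/allP/(_ _ n'G) := FC _ GC.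
Qed.

Definition fset_of (r : seq nat) : {fset nat} := [fset n in r]%fset.

Lemma mem_fset_of r n : (n \in fset_of r) = (n \in r).
Proof. by rewrite !inE. Qed.

Lemma card_fset_of r : uniq r -> #|` fset_of r|%fset = size r.
Proof. by move=> ur; rewrite card_fseq undup_id. Qed.

Lemma chain_uniq k (C : seq (seq nat)) r : chain k C -> r \in C -> uniq r.
Proof.
move=> hC rC; have [+ _] := chain_mem hC rC; rewrite /= cats0.
by apply: (@pairwise_uniq _ ltn); exact: ltnn.
Qed.

Lemma schreier_fset_of (C : seq (seq nat)) r : chain id C -> r \in C -> schreier (fset_of r).
Proof.
move=> hC rC n; rewrite mem_fset_of card_fset_of; last exact: chain_uniq hC rC.
exact: hC.2.
Qed.

Lemma schreier_chain_fset_of (C : seq (seq nat)) : chain id C ->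
  [seq r <- C | r != [::]] != [::] ->
  schreier_chain [seq fset_of r | r <- C & r != [::]].
Proof.
move=> hC C0; split.
- by case: [seq r <- C | r != [::]] C0.
- move=> _ /mapP[r + ->]; rewrite mem_filter => /andP[r0 rC]; split.
    by case: r r0 {rC} => // n r _; apply/fset0Pn; exists n; rewrite mem_fset_of mem_head.
  exact: schreier_fset_of hC rC.
- apply: pairwise_sorted; rewrite pairwise_map; apply: pairwise_filter.
  case: hC => + _ {C0}; elim: C => //= r C IH; rewrite pairwise_cat.
  move=> /and3P[/allrelP h1 _ /IH ->]; rewrite andbT; apply/allP => r' r'C /=.
  apply/allP => n nr; apply/allP => n' n'r'; apply: h1; first by rewrite mem_fset_of in nr.
  by apply/flattenP; exists r' => //; rewrite mem_fset_of in n'r'.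
Qed.

Lemma lpn_fset_of p (r : seq nat) y : (1 <= p)%E -> (forall n, 0 <= y n) -> uniq r ->
  lpn p (enum_fset (fset_of r)) y = lpn p r y.
Proof.
by move=> p1 y0 ur; apply/esym/lpn_fset => // n; rewrite mem_fset_of.
Qed.

End FiniteSets.

(** * The norms of the summands as chain norms *)

Section NormComparison.
Variables (R : realType) (s : scalar_kind).
Local Notation K := (scalars R s).
Local Notation sseq := (scalar_seq R s).
Implicit Types (p : exponent R) (y : sseq) (c : R).

Definition ell_type p : \bar R * \bar R := ((val p)%:E, (val p)%:E).
Definition baernstein_type p : \bar R * \bar R := (1%:E, (val p)%:E).
Definition schreier_type p : \bar R * \bar R := ((val p)%:E, +oo%E).

Lemma ell_good p : good (ell_type p).
Proof. by rewrite /good /= lexx lee_fin (valP p). Qed.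

Lemma baernstein_good p : good (baernstein_type p).
Proof. by rewrite /good /= lexx lee_fin (valP p). Qed.

Lemma schreier_good p : good (schreier_type p).
Proof. by rewrite /good /= leey lee_fin (valP p). Qed.

Lemma baernstein_normE p y c :
  (baernstein_norm p y <= c%:E)%E <-> bnd id (baernstein_type p) (amp y) c.
Proof.
have p1 : (1 <= (val p)%:E)%E by rewrite lee_fin (valP p).
have valE (T : eqType) (C : seq T) (h : T -> seq nat) :
    (\sum_(F <- C) (\sum_(n <- h F) amp y n) `^ val p) `^ (val p)^-1 =
    chain_norm (baernstein_type p) [seq h F | F <- C] (amp y).
  rewrite /chain_norm lpn_map; congr (_ `^ _); apply: eq_bigr => F _.
  by congr (_ `^ _); symmetry; apply: lpn1; exact: amp_ge0.
have amp0 := @amp_ge0 R s y.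
split=> h.
  have c0 : 0 <= c by rewrite -lee_fin; apply: le_trans h; exact: baernstein_norm_ge0.
  (* Empty members, which Schreier chains exclude, contribute 0 and are discarded. *)
  move=> C hC; have -> : chain_norm (baernstein_type p) C (amp y) =
      chain_norm (baernstein_type p) [seq r <- C | r != [::]] (amp y).
    rewrite /chain_norm lpn_filter0//; last by move=> r; exact: lpn_ge0.
    by move=> r _ /negPn/eqP ->; rewrite lpn_nil.
  have [->|C0] := eqVneq [seq r <- C | r != [::]] [::]; first by rewrite /chain_norm lpn_nil.
  rewrite -lee_fin; apply: le_trans h; apply: ereal_sup_ubound.
  exists [seq fset_of r | r <- C & r != [::]]; first exact: schreier_chain_fset_of.
  rewrite big_map; congr (_%:E).
  rewrite (valE _ _ (fun r => enum_fset (fset_of r))) /chain_norm lpn_map.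
  apply: eq_lpn => r; rewrite mem_filter => /andP[_ rC].
  exact: (lpn_fset_of (p := 1%:E) (lexx _) amp0 (chain_uniq hC rC)).
apply: ge_ereal_sup => _ [C hC <-]; rewrite lee_fin.
have -> : (\sum_(F <- C) (\sum_(n <- F) modulus (y n)) `^ val p) `^ (val p)^-1 =
    chain_norm (baernstein_type p) [seq sorted_enum F | F <- C] (amp y).
  rewrite (valE _ C (fun F => enum_fset F)) /chain_norm !lpn_map; apply: eq_lpn => F _.
  exact/esym/(@lpn_sorted_enum _ 1%:E).
exact: h (chain_sorted_enum hC).
Qed.

Lemma schreier_normE p y c :
  (schreier_norm p y <= c%:E)%E <-> bnd id (schreier_type p) (amp y) c.
Proof.
have p1 : (1 <= (val p)%:E)%E by rewrite lee_fin (valP p).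
have amp0 := @amp_ge0 R s y.
split=> h.
  have c0 : 0 <= c by rewrite -lee_fin; apply: le_trans h; exact: schreier_norm_ge0.
  move=> C hC; rewrite /chain_norm /=; rewrite big_seq; apply: bigmax_le => // r rC.
  rewrite -lee_fin; apply: le_trans h; apply: ereal_sup_ubound.
  exists (fset_of r); first exact: schreier_fset_of hC rC.
  by congr (_%:E); exact: (lpn_fset_of p1 amp0 (chain_uniq hC rC)).
apply: ge_ereal_sup => _ [F sF <-]; rewrite lee_fin.
have hF : chain id [:: sorted_enum F].
  apply: chain1; first exact: pairwise_sorted_enum.
  by move=> n; rewrite mem_sorted_enum size_sorted_enum; exact: sF.
have := h _ hF; rewrite /chain_norm lpn_seq1 ?leey ?lpn_ge0//.
by rewrite lpn_sorted_enum.
Qed.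

Lemma poweR_root_le (q c : R) (S : \bar R) : 1 <= q -> 0 <= c -> (0 <= S)%E ->
  ((S `^ q^-1 <= c%:E) = (S <= (c `^ q)%:E))%E.
Proof.
move=> q1 c0; have q0 : 0 < q by exact: lt_le_trans q1.
case: S => [x||]//; last first.
  by move=> _; rewrite poweRyr ?invr_eq0 ?gt_eqF// !leye_eq.
by rewrite lee_fin => x0; rewrite poweR_EFin !lee_fin le_root_powR.
Qed.

Lemma ell_normE p y c : (ell_norm p y <= c%:E)%E <-> bnd id (ell_type p) (amp y) c.
Proof.
have p1 := valP p; have p1' : (1 <= (val p)%:E)%E by rewrite lee_fin.
have amp0 := @amp_ge0 R s y.
have t0 i : (0 <= (amp y i `^ val p)%:E)%E by rewrite lee_fin powR_ge0.
have S0 : (0 <= \sum_(0 <= n <oo) (amp y n `^ val p)%:E)%E by apply: nneseries_ge0.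
split=> h.
  have c0 : 0 <= c by rewrite -lee_fin; apply: le_trans h; exact: ell_norm_ge0.
  move: h; rewrite /ell_norm poweR_root_le// => h.
  apply: bnd_diag => // F hF; rewrite /= le_root_powR ?powR_sum_ge0//.
  rewrite -lee_fin; apply: le_trans h.
  apply: le_trans (nneseries_lim_ge (\max_(n <- F) n).+1 (fun i _ _ => t0 i)).
  rewrite sumEFin lee_fin; apply: ler_sum_subset.
  - by move=> t; exact: powR_ge0.
  - by apply: (@pairwise_uniq _ ltn) => //; exact: ltnn.
  - move=> n nF; rewrite mem_index_iota ltnS /=.
    exact: (@leq_bigmax_seq _ _ xpredT id n).
have c0 := bnd_ge0 h.
rewrite /ell_norm poweR_root_le//; apply: lime_le; first by apply: is_cvg_nneseries => n _ _; exact: t0.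
near=> n; rewrite sumEFin lee_fin -le_root_powR ?powR_sum_ge0//.
have := bnd_lpn (ell_good p) amp0 h (pairwise_ltn_iota 0 n).
by rewrite /index_iota subn0.
Unshelve. all: by end_near. Qed.

End NormComparison.

Section Models.
Variables (R : realType) (s : scalar_kind).
Local Notation K := (scalars R s).
Local Notation sseq := (scalar_seq R s).
Implicit Types (p : exponent R).

Lemma finite_norm_val_linear (nu : ext_norm sseq) a (u v : finite_norm_space nu) :
  finite_norm_val (a *: u + v) = a *: finite_norm_val u + finite_norm_val v.
Proof. by []. Qed.

Lemma subspace_val_linear (W : normedModType K) (D : submodClosed W) a (u v : Defs.subspace D) :
  subspace_val (a *: u + v) = a *: subspace_val u + subspace_val v.
Proof. by []. Qed.

Lemma finite_norm_le (nu : ext_norm sseq) (x : finite_norm_space nu) (c : R) :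
  rnorm x <= c <-> (nu x <= c%:E)%E.
Proof.
have -> : rnorm x = fine (nu x) by exact: of_realK.
by rewrite -lee_fin fineK// finite_norm_fin.
Qed.

Lemma finite_norm_space_of (nu : ext_norm sseq) (y : sseq) (c : R) :
  (nu y <= c%:E)%E -> exists x : finite_norm_space nu, finite_norm_val x = y.
Proof.
move=> yc; have yoo : y \in has_finite_norm nu by rewrite inE; exact: le_lt_trans yc (ltry c).
by exists (FiniteNormSpace yoo).
Qed.

Lemma finite_norm_model (nu : ext_norm sseq) sg : good sg -> (sg.2 < +oo)%E ->
  (forall y c, (nu y <= c%:E)%E <-> bnd id sg (amp y) c) ->
  sequence_model sg (fun x : finite_norm_space nu => finite_norm_val x).
Proof.
move=> g p_fin nuE.
have nrm (v : finite_norm_space nu) c : rnorm v <= c <-> bnd id sg (amp (finite_norm_val v)) c.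
  by rewrite finite_norm_le; exact: nuE.
split=> // [v|y c /nuE yc _]; last exact: finite_norm_space_of yc.
apply: (@bnd_tail _ _ _ (rnorm v)) => //; first exact: amp_ge0.
exact/nrm.
Qed.

Lemma ell_model p : sequence_model (ell_type p) (fun x : ell s p => finite_norm_val x).
Proof.
by apply: finite_norm_model; [exact: ell_good|exact: ltry|exact: ell_normE].
Qed.

Lemma baernstein_model p :
  sequence_model (baernstein_type p) (fun x : baernstein s p => finite_norm_val x).
Proof.
by apply: finite_norm_model; [exact: baernstein_good|exact: ltry|exact: baernstein_normE].
Qed.

Lemma Z_norm p (z : Z_space s p) c :
  rnorm z <= c <-> bnd id (schreier_type p) (amp (finite_norm_val z)) c.
Proof. by rewrite finite_norm_le; exact: schreier_normE. Qed.

(** Beyond the support of a finitely supported u the tail of z is that of z - u; conversely,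
    truncations of z approximate it when its tails vanish. *)
Lemma in_closure_c00P p (z : Z_space s p) :
  z \in @in_closure_c00 R s p <-> tails_vanish (schreier_type p) (amp (finite_norm_val z)).
Proof.
have g := schreier_good p; rewrite inE; split=> [cz e e0|tz].
  have [u [[n un] zu]] := cz _ (nbhs_rball z e0); exists n.
  have := (Z_norm (z - u) e).1 (ltW zu).
  apply: bnd_mono => // [|i]; first by apply: from_ge0; exact: amp_ge0.
  rewrite /from; case: ifP => [/un ui|_]; last exact: amp_ge0.
  rewrite /amp [X in _ <= modulus X](_ : _ = finite_norm_val z i - finite_norm_val u i)//.
  by rewrite ui subr0.
move=> B /rball_nbhs[e e0 eB].
have e2 : 0 < e / 2 by rewrite divr_gt0.
have [n hn] := tz _ e2.
pose y : sseq := fun i => if (i < n)%N then finite_norm_val z i else 0.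
have yz : bnd id (schreier_type p) (amp (finite_norm_val z - y)) (e / 2).
  move: hn; apply: bnd_mono => // [|i]; first exact: amp_ge0.
  rewrite /amp /from [X in modulus X](_ : _ = finite_norm_val z i - y i)// /y.
  by case: ltnP => _; rewrite ?subrr ?modulus0 ?subr0.
have [v vE] : exists v : Z_space s p, finite_norm_val v = finite_norm_val z - y.
  by apply: finite_norm_space_of; apply/schreier_normE; exact: yz.
exists (z - v); split.
  exists n => i ni.
  rewrite (_ : finite_norm_val (z - v) = finite_norm_val z - finite_norm_val v)// vE.
  by rewrite opprB addrC subrK /y ltnNge ni.
apply: eB; rewrite /rball /= opprB addrC subrK.
apply: (@le_lt_trans _ _ (e / 2)); first by apply/Z_norm; rewrite vE.
by rewrite ltr_pdivrMr// ltr_pMr// ltr1n.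
Qed.

Lemma subspace_model sg (W : normedModType K) (D : submodClosed W) (coord : W -> sseq) :
  good sg -> (forall a u v, coord (a *: u + v) = a *: coord u + coord v) ->
  (forall v c, rnorm v <= c <-> bnd id sg (amp (coord v)) c) ->
  (forall v, v \in D <-> tails_vanish sg (amp (coord v))) ->
  (forall y c, bnd id sg (amp y) c -> exists v, coord v = y) ->
  sequence_model sg (fun x : Defs.subspace D => coord (subspace_val x)).
Proof.
move=> g lin nrm tails onto; split=> //.
- by move=> a u v; rewrite subspace_val_linear lin.
- by move=> v c; rewrite -nrm.
- by case=> v /= /tails.
- by move=> y c /onto[v <-] /tails vD; exists (Subspace vD).
Qed.

Lemma schreier_model p : sequence_model (schreier_type p)
  (fun x : schreier_space s p => finite_norm_val (subspace_val x)).
Proof.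
apply: (@subspace_model _ (Z_space s p) _ (fun z => finite_norm_val z)).
- exact: schreier_good.
- exact: finite_norm_val_linear.
- exact: Z_norm.
- exact: in_closure_c00P.
- by move=> y c /schreier_normE yc; exact: (@finite_norm_space_of (schreier_ext_norm s p) y c yc).
Qed.

End Models.

(** * Flat blocks *)

Section FlatBlocks.
Variables (R : realType) (s : scalar_kind).
Local Notation K := (scalars R s).
Local Notation sseq := (scalar_seq R s).

(** Block i starts at m i and ends with the positions g i, ..., 2 g i, that is the integers g i + 1,
    ..., 2 g i + 1, which form a maximal Schreier set. Taking g i large makes the normalized
    indicator so small that it is flat with respect to m i. *)
Lemma block_data (q : R) : 1 <= q -> exists g m b : nat -> nat,
  [/\ {homo m : i j / (i < j)%N}, forall n, (m (b n) <= n < m (b n).+1)%N,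
      forall i, (m i <= g i)%N, forall i, m i.+1 = (g i + g i).+1 &
      forall i, (m i)%:R * ((g i).+1%:R `^ q^-1)^-1 <= half_pow 1 i :> R].
Proof.
move=> q1; have q0 : 0 < q^-1 by rewrite invr_gt0 (lt_le_trans ltr01).
have step (im : nat * nat) : exists g, (im.2 <= g)%N /\
    im.2%:R * (g.+1%:R `^ q^-1)^-1 <= half_pow 1 im.1 :> R.
  case: im => i m /=; have [N _ hN] := powR_unbounded (m%:R / half_pow (1 : R) i) q0.
  exists (maxn m N); split; first exact: leq_maxl.
  have h0 := @half_pow_gt0 R 1 i ltr01.
  rewrite ler_pdivrMr ?powR_gt0// mulrC -ler_pdivrMr//; apply: le_trans (ltW hN) _.
  by apply: ge0_ler_powR; rewrite ?nnegrE ?(ltW q0)// ler_nat leqW// leq_maxr.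
have [f hf] := choice step.
pose m := fix m j := if j is j'.+1 then (f (j', m j') + f (j', m j')).+1 else 0%N.
have mS j : m j.+1 = (f (j, m j) + f (j, m j)).+1 by [].
have mlt j : (m j < m j.+1)%N.
  by rewrite mS ltnS; apply: leq_trans (hf (j, m j)).1 (leq_addr _ _).
have mh : {homo m : i j / (i < j)%N} by apply: homo_ltn => //; exact: ltn_trans.
have [b hb] := block_index (erefl : m 0%N = 0%N) mh.
by exists (fun j => f (j, m j)), m, b; split=> // i; case: (hf (i, m i)).
Qed.

Variables (q : R) (g m b : nat -> nat).
Hypothesis q1 : 1 <= q.
Hypothesis m_homo : {homo m : i j / (i < j)%N}.
Hypothesis m_b : forall n, (m (b n) <= n < m (b n).+1)%N.
Hypothesis m_g : forall i, (m i <= g i)%N.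
Hypothesis mS : forall i, m i.+1 = (g i + g i).+1.
Let eta i : R := ((g i).+1%:R `^ q^-1)^-1.
Hypothesis m_eta : forall i, (m i)%:R * eta i <= half_pow 1 i.

Definition plateau i := iota (g i) (g i).+1.

(* The flat blocks: [e_i] is sent to a multiple of the indicator of a maximal
   Schreier set, normalized in l_q. *)
Definition spread (a : sseq) : sseq := fun n =>
  if (g (b n) <= n)%N then of_real s (eta (b n)) * a (b n) else 0.

(** For q = 1 this is a left inverse of [spread], and a sum over a plateau is at most an l_1 norm
    over one Schreier set. *)
Definition gather (x : sseq) : sseq := fun i => \sum_(n <- plateau i) x n.

Let eta_gt0 i : 0 < eta i.
Proof. by rewrite invr_gt0 powR_gt0. Qed.

Lemma block_plateau i n : n \in plateau i -> b n = i.
Proof.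
rewrite mem_iota => /andP[gn ng]; apply: (block_eq m_homo m_b).
by rewrite (leq_trans (m_g i) gn) mS ltnS -ltnS -addnS.
Qed.

Lemma mem_plateau i n : b n = i -> (n \in plateau i) = (g i <= n)%N.
Proof.
move=> bn; rewrite mem_iota; have := m_b n; rewrite bn mS => /andP[_ h].
by rewrite addnS h andbT.
Qed.

Lemma amp_spread a n : amp (spread a) n =
  if (g (b n) <= n)%N then eta (b n) * amp a (b n) else 0.
Proof.
rewrite /amp /spread; case: ifP => _; last exact: modulus0.
by rewrite modulusM modulus_of_real// ltW.
Qed.

Lemma lpn_plateau i : lpn q%:E (plateau i) (fun=> eta i) = 1.
Proof.
rewrite lpn_const ?(ltW (eta_gt0 i))// size_iota /= /eta mulfV// gt_eqF//.
Qed.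

Lemma spread_linear : seq_linear spread.
Proof.
move=> c u v; apply/funext => n.
rewrite [RHS](_ : _ = c * spread u n + spread v n)// /spread.
case: ifP => _; last by rewrite mulr0 addr0.
by rewrite [(c *: u + v) _](_ : _ = c * u (b n) + v (b n))// mulrDr mulrCA.
Qed.

Lemma gather_linear : seq_linear gather.
Proof.
move=> c u v; apply/funext => i.
rewrite [RHS](_ : _ = c * gather u i + gather v i)// /gather mulr_sumr -big_split.
exact: eq_bigr.
Qed.

Variable p : \bar R.
Hypothesis qp : (q%:E <= p)%E.
Let p1 : (1 <= p)%E. Proof. by apply: le_trans qp; rewrite lee_fin. Qed.
Let gqp : good (q%:E, p). Proof. by rewrite /good /= lee_fin q1. Qed.
Let gpp : good (p, p). Proof. by rewrite /good /= lexx p1. Qed.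

(** Block i of [spread a] has norm at most |a i| by the normalization, and its flatness bounds the
    later parts by c times the sum of the 2^-(i + 1). Each contributes one c. *)
Let spread_bnd a c : bnd id (p, p) (amp a) c -> bnd id (q%:E, p) (amp (spread a)) (c + c).
Proof.
move=> ha; have a0 := @amp_ge0 R s a.
apply: (@bnd_block_flat _ m b m_homo m_b _ _ (amp a) (fun i => amp a i * half_pow 1 i)) => //.
- exact: amp_ge0.
- by move=> i; rewrite mulr_ge0// ltW// half_pow_gt0.
- move=> i C hC bC; apply: le_trans (chain_norm_le_flatten _ gqp (@amp_ge0 _ _ _)) _.
  rewrite -(@lpn_filter0 _ _ _ (fun n => g i <= n)%N)//; last first.
    exact: amp_ge0.
    by move=> n nC gn; rewrite amp_spread (bC _ nC) (negbTE gn).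
  apply: (@le_trans _ _ (lpn q%:E (plateau i) (fun n => amp a i * eta i))).
    apply: (@le_trans _ _ (lpn q%:E (plateau i) (amp (spread a)))).
      apply: lpn_subset => //.
      + by move=> n _; exact: amp_ge0.
      + by apply: filter_uniq; apply: (@pairwise_uniq _ ltn); [exact: ltnn|case: hC].
      + by move=> n; rewrite mem_filter => /andP[gn nC]; rewrite mem_plateau// bC.
    apply: lpn_mono => // [n _|n nP]; first exact: amp_ge0.
    rewrite amp_spread (block_plateau nP); case: ifP => _; first by rewrite mulrC.
    by rewrite mulr_ge0// ltW.
  rewrite lpn_scale//; last by move=> _; exact: ltW.
  by rewrite lpn_plateau mulr1.
- move=> n; rewrite amp_spread; case: ifP => _; last first.
    by rewrite mulr0 mulr_ge0// ltW// half_pow_gt0.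
  by rewrite mulrA mulrC ler_wpM2l.
- by move=> J; apply: (bnd_lpn gpp a0 ha); exact: pairwise_ltn_iota.
- move=> J; apply: (@le_trans _ _ (\sum_(i <- iota 0 J) c * half_pow 1 i)).
    apply: ler_sum => i _; apply: ler_wpM2r; first by rewrite ltW// half_pow_gt0.
    exact: (bnd_term i gpp a0 ha).
  rewrite -mulr_sumr -[leRHS]mulr1; apply: ler_wpM2l; first exact: bnd_ge0 ha.
  exact: half_pow_sum.
Qed.

Lemma spread_bounded : seq_bounded (p, p) (q%:E, p) spread 2.
Proof.
move=> a c ha; split; first by rewrite mulr_natl; exact: spread_bnd.
move=> ta e e0; have [n hn] := ta (e / 2) (divr_gt0 e0 (ltr0n _ 2)).
(* Beyond m n, [spread a] agrees with the image of the truncation of a to the indices from n on. *)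
pose a' : sseq := fun k => if (n <= k)%N then a k else 0.
have a'E k : amp a' k = from n (amp a) k.
  by rewrite /amp /a' /from; case: ifP => // _; exact: modulus0.
exists (m n); rewrite (splitr e).
have : bnd id (p, p) (amp a') (e / 2) by move=> C /hn; rewrite (@eq_chain_norm _ _ _ _ (from n (amp a))).
move=> /spread_bnd; apply: bnd_mono => // [|k]; first by apply: from_ge0; exact: amp_ge0.
rewrite /from; case: ifP => [mk|_]; last exact: amp_ge0.
have nb : (n <= b k)%N.
  rewrite leqNgt; apply/negP => /(boundary_le m_homo) h.
  by have /andP[_] := m_b k; rewrite ltnNge (leq_trans h mk).
by rewrite !amp_spread a'E /from nb.
Qed.

Lemma spread_unit_seq n k : amp (spread (unit_seq R s n)) k =
  if k \in plateau n then eta n else 0.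
Proof.
rewrite amp_spread amp_unit_seq; have [bk|bk] := eqVneq (b k) n.
  by rewrite mem_plateau// bk mulr1.
rewrite mulr0 if_same ifF//; apply/negbTE; apply: contra_neqN bk => kn.
exact: block_plateau.
Qed.

(** The n-th plateau is a Schreier set on which the image of e_n has l_q norm 1 and that of e_n'
    vanishes. *)
Lemma spread_separated n n' c : n != n' ->
  bnd id (q%:E, p) (amp (spread (unit_seq R s n) - spread (unit_seq R s n'))) c -> 1 <= c.
Proof.
move=> nn' hc; have hC : chain id [:: plateau n].
  apply: chain1; first exact: pairwise_ltn_iota.
  by move=> k; rewrite mem_iota size_iota => /andP[gk _]; rewrite ltnS.
have := hc _ hC; rewrite /chain_norm lpn_seq1 ?lpn_ge0//; apply: le_trans.
rewrite -(lpn_plateau n); apply: lpn_mono => // [k _|k kn]; first exact: ltW.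
have := modulusB_le (spread (unit_seq R s n) k) (- spread (unit_seq R s n') k).
have := spread_unit_seq n k; have := spread_unit_seq n' k; rewrite kn /amp modulusN ifF.
  by move=> -> ->; rewrite addr0.
apply: contra_neqF nn' => kn'; by rewrite -(block_plateau kn) (block_plateau kn').
Qed.

Lemma gather_spread n : q = 1 -> gather (spread (unit_seq R s n)) = unit_seq R s n.
Proof.
move=> q_1; apply/funext => i; rewrite /gather.
have val k : k \in plateau i -> spread (unit_seq R s n) k = of_real s (eta i) * (i == n)%:R.
  by move=> ki; rewrite /spread (block_plateau ki) -mem_plateau ?ki// (block_plateau ki).
rewrite (eq_big_seq _ val) sum_const size_iota /unit_seq.
case: (i == n); last by rewrite mulr0 mul0rn.
rewrite mulr1 /eta q_1 invr1 powRr1// -[LHS]mulr_natl.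
have -> : ((g i).+1%:R : K) = of_real s (g i).+1%:R.
  by case: (s) => //=; rewrite rmorph_nat.
by rewrite -of_realM mulfV ?pnatr_eq0//; case: (s).
Qed.

(** Plateaus are Schreier sets, so those with index in F form a chain, and the norm of x over this
    chain dominates the l_p norm of [gather x] over F. *)
Lemma gather_bounded : q = 1 -> (p < +oo)%E -> seq_bounded (q%:E, p) (p, p) gather 1.
Proof.
move=> q_1 p_fin x c hx; rewrite mul1r.
have bG : bnd id (p, p) (amp (gather x)) c.
  apply: bnd_diag => // [|F hF]; first exact: amp_ge0.
  have : chain id [seq plateau i | i <- F].
    split.
      elim: F hF => [//|i F IH /andP[/allP iF /IH {}IH]].
      rewrite -[flatten _]/(plateau i ++ flatten [seq plateau i | i <- F]).
      rewrite pairwise_cat pairwise_ltn_iota IH !andbT; apply/allrelP => n n' ni /flattenP[_ /mapP[j jF ->] nj].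
      rewrite /= ltnNge; apply/negP => /(block_homo m_homo m_b).
      rewrite (block_plateau ni) (block_plateau nj) => ji.
      by have := iF _ jF; rewrite /= ltnNge ji.
    by move=> _ /mapP[i _ ->] n; rewrite mem_iota size_iota => /andP[gn _]; rewrite ltnS.
  move=> /hx; apply: le_trans; rewrite /chain_norm lpn_map.
  apply: lpn_mono => // [i _|i _]; first exact: amp_ge0.
  rewrite /= q_1 -[leRHS]/(lpn 1%:E (plateau i) (amp x)) lpn1; last exact: amp_ge0.
  exact: modulus_sum.
split=> // _; apply: (bnd_tail gpp p_fin _ bG); exact: amp_ge0.
Qed.

End FlatBlocks.

Section Realizations.
Variables (R : realType) (s : scalar_kind) (I : finType) (sg : I -> \bar R * \bar R).
Local Notation sseq := (scalar_seq R s).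

Lemma realizes_id i : good (sg i) -> realizes sg (sg i) i (id : sseq -> sseq) id 1.
Proof.
move=> gi; split=> //; try by move=> x c hx; rewrite mul1r.
move=> n n' c nn' hc.
have := bnd_term n gi (@amp_ge0 _ _ _) hc.
rewrite /amp [X in modulus X](_ : _ = (n == n)%:R - (n == n')%:R)//.
by rewrite eqxx (negbTE nn') subr0 modulus1.
Qed.

Lemma realizes_flat i p : sg i = (1%:E, p) -> (1 <= p)%E -> (p < +oo)%E ->
  exists (J Q : sseq -> sseq) C, realizes sg (p, p) i J Q C.
Proof.
move=> sgi p1 p_fin; have [g [m [b [mh mb mg mS meta]]]] := block_data (lexx (1 : R)).
exists (spread 1 g b), (gather g), 2; split; rewrite ?sgi.
- by rewrite /good /= lexx p1.
- by [].
- exact: spread_linear.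
- exact: gather_linear.
- exact: (spread_bounded (lexx 1) mh mb mg mS meta p1).
- exact: (gather_bounded (lexx 1) mh mb mg mS p1 erefl p_fin).
- by move=> _ n; exact: (gather_spread s mh mb mg mS n erefl).
- by move=> n n' c; exact: (spread_separated (lexx 1) mh mb mg mS p1).
Qed.

Lemma realizes_top i q : sg i = (q%:E, +oo%E) -> 1 <= q ->
  exists (J Q : sseq -> sseq) C, realizes sg (+oo, +oo)%E i J Q C.
Proof.
move=> sgi q1; have [g [m [b [mh mb mg mS meta]]]] := block_data q1.
have goo : good (+oo, +oo : \bar R)%E by rewrite /good /= leey lexx.
have qp : (q%:E <= +oo)%E by exact: leey.
exists (spread q g b), (fun=> 0), 2; split; rewrite ?sgi//.
- exact: spread_linear.
- by move=> a u v; rewrite scaler0 addr0.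
- exact: (spread_bounded q1 mh mb mg mS meta qp).
- move=> x c hx; have c0 := bnd_ge0 hx; rewrite mul1r; split.
    by apply: bnd_le (bnd_amp0 s goo) c0.
  move=> _ e e0; exists 0%N; apply: bnd_le (ltW e0).
  refine (bnd_mono goo _ _ (bnd0 goo)) => k; first by apply: from_ge0; exact: amp_ge0.
  by rewrite /from leq0n /amp modulus0.
- by move=> n n' c; exact: (spread_separated q1 mh mb mg mS qp).
Qed.

End Realizations.

(** * The quotient algebra and the types of X *)

Section Calkin.
Variables (K : numFieldType) (X : normedModType K).

Lemma to_calkin_prod n (T : 'I_n -> operator X) :
  to_calkin (\prod_i T i) = \prod_i to_calkin (T i).
Proof. exact: (big_morph _ (@to_calkinM K X) erefl). Qed.

Lemma to_calkin_eq0 (T : operator X) : to_calkin T = 0 <-> compact_map T.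
Proof.
have -> : (0 : calkin X) = to_calkin 0.
  by rewrite -(subrr (to_calkin 0)) -to_calkinB subrr.
by rewrite to_calkinP subr0.
Qed.

Lemma nilpotent_at_calkin n : nilpotent_at (@singular_mod_compact K X) n <->
  forall T : 'I_n -> operator X, (forall i, strictly_singular (T i)) ->
    compact_map (\prod_i T i).
Proof.
split=> [nil T ssT|cpt a ha].
  by apply/to_calkin_eq0; rewrite to_calkin_prod; apply: nil => i; exists (T i) => //; exact: ssT.
have /choice[T hT] i : exists T : operator X, strictly_singular T /\ to_calkin T = a i.
  by have [T h1 h2] := ha i; exists T.
rewrite (eq_bigr (fun i => to_calkin (T i))); last by move=> i _; case: (hT i).
by rewrite -to_calkin_prod; apply/to_calkin_eq0/cpt => i; case: (hT i).
Qed.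

(** If all products of j <= k strictly singular operators were compact, so would be the given
    product of k, since its first j factors have a compact product. *)
Lemma nilpotency_index_calkin k :
  (forall T : 'I_k.+1 -> operator X, (forall i, strictly_singular (T i)) ->
     compact_map (\prod_i T i)) ->
  (exists T : 'I_k -> operator X, (forall i, strictly_singular (T i)) /\
     ~ compact_map (\prod_i T i)) ->
  nilpotency_index (@singular_mod_compact K X) k.+1.
Proof.
move=> cpt [T [ssT ncT]]; split=> //; first exact/nilpotent_at_calkin.
move=> j j0 /nilpotent_at_calkin nil; rewrite ltnNge; apply/negP => jk; apply: ncT.
(* T is extended by 0 to all natural numbers, so that the product can be cut at j. *)
pose Tn n := if insub n is Some i then T i else 0.
have TnE (i : 'I_k) : T i = Tn i by rewrite /Tn valK.
under eq_bigr do rewrite TnE.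
rewrite -(big_mkord xpredT Tn) (@big_cat_nat _ _ _ j)//=.
apply: compact_mapMr; rewrite big_mkord; apply: nil => i.
have ik : (i < k)%N by exact: leq_trans (ltn_ord i) jk.
by rewrite -[nat_of_ord i]/(nat_of_ord (Ordinal ik)) -TnE.
Qed.

End Calkin.

Section SumSpace.
Variables (R : realType) (s : scalar_kind) (L M N : {fset exponent R}).
Local Notation sseq := (scalar_seq R s).
Local Notation type := (\bar R *l \bar R)%type.

Definition summand_type (i : L + M + N) : \bar R * \bar R :=
  match i with
  | inl (inl p) => baernstein_type (val p)
  | inl (inr q) => ell_type (val q)
  | inr r => schreier_type (val r)
  end.

Definition summand_coord (i : L + M + N) : summand s i -> sseq :=
  match i return summand s i -> sseq with
  | inl (inl p) => fun x : baernstein s (val p) => finite_norm_val x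
  | inl (inr q) => fun x : ell s (val q) => finite_norm_val x
  | inr r => fun x : schreier_space s (val r) => finite_norm_val (subspace_val x)
  end.

Lemma summand_model i : sequence_model (summand_type i) (@summand_coord i).
Proof.
case: i => [[p|q]|r]; [exact: baernstein_model|exact: ell_model|exact: schreier_model].
Qed.

(** Besides the types of the summands, (p, p) occurs through flat sequences in B_p, and (+oo, +oo)
    through those in S_r. The latter is one more type, present only for non-empty N, and this
    explains the two cases in the value of k. *)
Definition types : seq type :=
  [seq (ell_type p : type) | p <- enum_fset (L `|` M)%fset] ++
  ([seq (baernstein_type p : type) | p <- enum_fset L] ++
   if N == fset0 then [::]
   else ((+oo, +oo)%E : type) :: [seq (schreier_type r : type) | r <- enum_fset N]).

Lemma size_types : size types = (#|` (L `|` M)%fset| +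
  (#|` L|%fset + if N == fset0 then 0 else #|` N|%fset.+1))%N.
Proof. by rewrite !size_cat !size_map; case: (N == fset0); rewrite //= size_map. Qed.

(** A coincidence of (1, p) with (q, q) would force p = 1, which L excludes; the other coincidences
    would equate a finite exponent with +oo. *)
Lemma types_uniq (hL : forall p, p \in L -> 1 < val p) : uniq types.
Proof.
have fin_neq (x : R) : (x%:E : \bar R) <> +oo%E by [].
rewrite !cat_uniq !map_inj_uniq ?fset_uniq /=.
- apply/and3P; split.
  + rewrite has_cat negb_or; apply/andP; split.
      apply/hasPn => _ /mapP[p /hL p1 ->]; apply/negP => /mapP[q _ [qE pE]].
      by have pe : val p = 1 := etrans pE (esym qE); rewrite pe ltxx in p1.
    case: ifP => //= _; rewrite negb_or; apply/andP; split.
      by apply/negP => /mapP[q _ [/esym/fin_neq]].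
    by apply/hasPn => _ /mapP[r _ ->]; apply/negP => /mapP[q _ [_ /esym/fin_neq]].
  + case: ifP => //= _; rewrite negb_or; apply/andP; split.
      by apply/negP => /mapP[q _ [/esym/fin_neq]].
    by apply/hasPn => _ /mapP[r _ ->]; apply/negP => /mapP[q _ [_ /esym/fin_neq]].
  + case: ifP => //= _; rewrite map_inj_uniq ?fset_uniq ?andbT.
      by apply/negP => /mapP[q _ [/esym/fin_neq]].
    by move=> p q [pq]; apply: val_inj.
- by move=> p q [pq]; apply: val_inj.
- by move=> p q [pq]; apply: val_inj.
Qed.

Lemma ell_type_in p : p \in (L `|` M)%fset -> (ell_type p : type) \in types.
Proof. by move=> pLM; rewrite mem_cat (map_f (fun p => ell_type p : type) pLM). Qed.

Lemma baernstein_type_in p : p \in L -> (baernstein_type p : type) \in types.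
Proof.
by move=> pL; rewrite !mem_cat (map_f (fun p => baernstein_type p : type) pL) orbT.
Qed.

Lemma schreier_type_in p : p \in N ->
  (schreier_type p : type) \in types /\ ((+oo, +oo)%E : type) \in types.
Proof.
move=> pN; have N0 : N == fset0 = false by apply/negbTE/fset0Pn; exists p.
rewrite !mem_cat N0 !inE (map_f (fun p => schreier_type p : type) pN) eqxx.
by rewrite !orbT.
Qed.

Lemma summand_type_in i : (summand_type i : type) \in types /\
  (((summand_type i).2, (summand_type i).2) : type) \in types.
Proof.
case: i => [[p|q]|r] /=.
- split; first exact: baernstein_type_in (valP p).
  by apply: ell_type_in; rewrite inE (valP p).
- by split; apply: ell_type_in; rewrite inE (valP q) orbT.
- exact: schreier_type_in (valP r).
Qed.

Lemma types_realized tau : tau \in types ->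
  exists i (J Q : sseq -> sseq) C, realizes summand_type tau i J Q C.
Proof.
have gd i := model_good (summand_model i).
rewrite !mem_cat => /orP[/mapP[p + ->]|/orP[/mapP[p pL ->]|]].
- rewrite inE => /orP[pL|pM].
    have [||J [Q [C h]]] := @realizes_flat R s _ summand_type (inl (inl [` pL]%fset)) (val p)%:E erefl.
    + by rewrite lee_fin (valP p).
    + exact: ltry.
    by exists (inl (inl [` pL]%fset)), J, Q, C.
  exists (inl (inr [` pM]%fset)), id, id, 1.
  exact: (realizes_id s (gd (inl (inr [` pM]%fset)))).
- exists (inl (inl [` pL]%fset)), id, id, 1.
  exact: (realizes_id s (gd (inl (inl [` pL]%fset)))).
- case: ifPn => // /fset0Pn[r rN]; rewrite inE => /orP[/eqP ->|/mapP[p pN ->]].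
    have [J [Q [C h]]] := @realizes_top R s _ summand_type (inr [` rN]%fset) _ erefl (valP r).
    by exists (inr [` rN]%fset), J, Q, C.
  exists (inr [` pN]%fset), id, id, 1.
  exact: (realizes_id s (gd (inr [` pN]%fset))).
Qed.

End SumSpace.

Theorem theorem1p1 (R : realType) (s : scalar_kind)
    (L M N : {fset exponent R})
    (hL : forall p, p \in L -> 1 < val p)
    (hne : ~ (L = fset0 /\ M = fset0 /\ N = fset0)) :
  let k := if N == fset0 then (#|` L| + #|` (L `|` M)%fset| - 1)%N
           else (#|` L| + #|` (L `|` M)%fset| + #|` N|)%N in
  let X := sum_space s L M N in
  [/\ forall T : 'I_k.+1 -> operator X,
        (forall i, strictly_singular (T i)) -> compact_map (\prod_i T i),
      exists T : 'I_k -> operator X,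
        (forall i, strictly_singular (T i)) /\ ~ compact_map (\prod_i T i)
    & nilpotency_index (@singular_mod_compact _ X) k.+1].
Proof.
move=> k X.
have pos : (0 < size (types L M N))%N.
  rewrite lt0n; apply/negP; rewrite size_types !addn_eq0 => /and3P[LM _].
  case: ifP => [/eqP N0 _|//]; apply: hne.
  move: LM; rewrite cardfs_eq0 fsetU_eq0 => /andP[/eqP -> /eqP ->].
  by [].
have kE : k = (size (types L M N)).-1.
  by rewrite size_types /k; case: (N == fset0); lia.
have cpt (T : 'I_k.+1 -> operator X) : (forall i, strictly_singular (T i)) ->
    compact_map (\prod_i T i).
  move=> ssT; rewrite -(big_map T xpredT id).
  apply: (compact_product (@summand_model R s L M N) (Lam := types L M N)).
  - by move=> i; exact: (summand_type_in i).1.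
  - by move=> i; exact: (summand_type_in i).2.
  - by rewrite size_map [index_enum _]unlock -enumT size_enum_ord kE prednK.
  - by move=> _ /mapP[i _ ->].
have ncpt := noncompact_product (@summand_model R s L M N) (types_uniq M N hL) pos
  (@types_realized R s L M N) kE.
by split=> //; exact: nilpotency_index_calkin.
Qed.
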